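(* Let $(G,\Gamma)$ be a weak pseudo-Riemannian structure with Levi-Civita connection on an open subset $\mathcal{N}$ of a Fréchet space $E$, let $V\in C^\infty(\mathcal{N})$ admit a $G$-gradient, and let $L(g,k)=\tfrac12G_g(k,k)-V(g)$ be the associated mechanical Lagrangian. Let $e\in\mathbb{R}$, and put $$\mathcal{N}_e:=\{g\in\mathcal{N}: V(g)\neq e\},\qquad \widetilde G:=2(e-V)\,G\ \text{ on }\ \mathcal{N}_e,$$ a weak pseudo-Riemannian metric with Levi-Civita connection $\widetilde\Gamma$ given, with $f=2(e-V)$ and $\operatorname{grad}f=-2\operatorname{grad}V$, by $\widetilde\Gamma_g(h,k)=\Gamma_g(h,k)-\frac{1}{2f(g)}[df(g)(h)k+df(g)(k)h-G_g(h,k)\operatorname{grad}f(g)]$. (a) Let $c\colon I\to\mathcal{N}_e$ be an extremal of $L$ with constant energy $\tfrac12G_c(c',c')+V(c)\equiv e$. Reparametrize by $s(t)=\int_{t_0}^{t}2(e-V(c(r)))\,dr$ ($t_0\in I$), that is, $ds/dt=2(e-V(c))=f(c)$, and write $\gamma(s)=c(t(s))$. Then $\gamma$ is a geodesic of $\widetilde G$, of constant $\widetilde G$-speed $\widetilde G(\gamma',\gamma')\equiv1$ (where $'=d/ds$). (b) Conversely, let $\gamma\colon J\to\mathcal{N}_e$ be a geodesic of $\widetilde G$ with $\widetilde G(\gamma',\gamma')\equiv1$. Reparametrize by $dt/ds=1/f(\gamma)=1/(2(e-V(\gamma)))$ and put $c(t)=\gamma(s(t))$. Then $c$ is an extremal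 of $L$ with energy $e$.
   Context: Smoothness is in the convenient sense: a map between open subsets of Fréchet spaces is smooth if it sends smooth curves to smooth curves. $L^2_{\mathrm{sym}}(E;F)$ is the space of continuous symmetric bilinear maps $E\times E\to F$; a map from $\mathcal{N}$ into it is smooth when the joint evaluation is smooth. $I,J\subset\mathbb{R}$ are open intervals and curves are smooth. A weak pseudo-Riemannian structure with Levi-Civita connection on $\mathcal{N}$ is a pair $(G,\Gamma)$ where $G\colon\mathcal{N}\to L^2_{\mathrm{sym}}(E;\mathbb{R})$ is smooth with each $G_g$ weakly non degenerate ($G_g(h,k)=0$ for all $k\in E$ implies $h=0$), and $\Gamma\colon\mathcal{N}\to L^2_{\mathrm{sym}}(E;E)$ is smooth and satisfies $$DG(g)(l)(h,k)+G_g(\Gamma_g(l,h),k)+G_g(h,\Gamma_g(l,k))=0,\qquad g\in\mathcal{N},\ l,h,k\in E.$$ The covariant derivative along a curve $c$ is $\nabla_{\partial_t}h=h'-\Gamma_c(c',h)$, and geodesics are the curves with $c''=\Gamma_c(c',c')$ (for $\widetilde G$, with $\widetilde\Gamma$ in place of $\Gamma$). $V$ admits a $G$-gradient if there is a smooth $\operatorname{grad}V\colon\mathcal{N}\to E$ with $dV(g)(h)=G_g(\operatorname{grad}V(g),h)$ for all $g,h$. Extremal of $L$ means critical curve: a smooth curve $c\colon I\to\mathcal{N}$ such that for every smooth map $(s,t)\mapsto c_s(t)$, $\mathbb{R}\times I\to\mathcal{N}$, with $c_0=c$ and $c_s(t)=c(t)$ for all $s$ and all $t$ outside some compact $K\subset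 I$, and some (equivalently, any) relatively compact open $J'\subset I$ containing $K$, $\frac{d}{ds}\big|_{s=0}\int_{J'}L(c_s,\partial_tc_s)\,dt=0$. The energy of $L$ is $\tfrac12G_g(k,k)+V(g)$. No sign of $2(e-V)$ is assumed. *)

(* Defs.v *)
From HB Require Import structures.
From mathcomp Require Import all_boot all_order all_algebra.
From mathcomp Require Import all_classical all_reals all_analysis.

Set Implicit Arguments.
Unset Strict Implicit.
Unset Printing Implicit Defensive.

Import Order.TTheory GRing.Theory Num.Theory.
Import numFieldNormedType.Exports.

Local Open Scope classical_set_scope.
Local Open Scope ring_scope.

(* The uniform structure carried by a [tvsType] is only required to induce the
   topology, it need not be translation invariant. Completeness is therefore
   expressed with the seminorms and not with [entourage]. *)
Definition seminorm {R : realType} {E : tvsType R} (p : E -> R) : Prop :=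
  (forall x y, p (x + y) <= p x + p y) /\
  (forall (a : R) x, p (a *: x) = `|a| * p x).

Definition frechet_space {R : realType} (E : tvsType R) : Prop :=
  hausdorff_space E /\
  exists p : nat -> E -> R,
    [/\ forall i, seminorm (p i),
        forall (x : E) (U : set E), nbhs x U <->
          exists (n : nat) (r : R), 0 < r /\
            forall y, (forall i, (i <= n)%N -> p i (y - x) < r) -> U y
      & forall u : nat -> E,
          (forall i (r : R), 0 < r ->
            exists n0 : nat, forall m n, (n0 <= m)%N -> (n0 <= n)%N ->
              p i (u m - u n) < r) ->
          exists l : E, u @ \oo --> l].

(* [derive1] and [lim] are not available for curves in a [tvsType]; the following
   is the same notion. *)
Definition is_curve_derive {R : realType} {F : tvsType R} (c : R -> F) (t : R)
  (l : F) : Prop := h^-1 *: (c (h + t) - c t) @[h --> (0 : R)^'] --> l.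

Definition curve_derivable {R : realType} {F : tvsType R} (c : R -> F) (t : R) :
  Prop := exists l, is_curve_derive c t l.

Definition curve_derive {R : realType} {F : tvsType R} (c : R -> F) (t : R) :
  F := xget 0 [set l | is_curve_derive c t l].

Lemma is_curve_deriveE (R : realType) (F : normedModType R) (c : R -> F) t l :
  is_curve_derive c t l <-> is_derive t (1 : R) c l.
Proof.
have dE : (fun h : R => h^-1 *: ((c \o shift t) (h *: (1 : R)) - c t)) =
          (fun h : R => h^-1 *: (c (h + t) - c t)).
  by apply/funext => h /=; rewrite [h *: 1]mulr1.
split=> [cl|[]]; last by rewrite /derivable /derive dE => + <-.
split; first by rewrite /derivable dE; apply/cvg_ex; exists l.
by rewrite /derive dE; exact: cvg_lim cl.
Qed.

Lemma curve_deriveE (R : realType) (F : normedModType R) (c : R -> F) t :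
  derivable c t 1 -> curve_derive c t = derive1 c t.
Proof.
move=> dc; rewrite derive1E; have [l cl] : curve_derivable c t.
  by exists ('D_1 c t); apply/is_curve_deriveE; split.
rewrite /curve_derive; case: xgetP => [x _ /is_curve_deriveE[]//|/(_ l)].
by move/(_ cl).
Qed.

(* Only meaningful for open [I]: the values of [c] outside [I] do not matter. *)
Definition smooth_curve {R : realType} {F : tvsType R} (I : set R)
  (c : R -> F) : Prop :=
  forall (n : nat) t, I t -> curve_derivable (iter n curve_derive c) t.

(* Convenient smoothness in the sense of Froelicher, Kriegl and Michor. *)
Definition conv_smooth {R : realType} {E F : tvsType R} (U : set E)
  (f : E -> F) : Prop :=
  forall c : R -> E, smooth_curve setT c -> (forall t, U (c t)) ->
    smooth_curve setT (f \o c).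

(* dirD f g l = Df(g)(l) *)
Definition dirD {R : realType} {E F : tvsType R} (f : E -> F) (g l : E) : F :=
  curve_derive (fun t : R => f (g + t *: l)) 0.

Definition L2sym {R : realType} {E F : tvsType R} (b : E -> E -> F) : Prop :=
  [/\ forall h k, b h k = b k h,
      forall h, linear (b h),
      forall k, linear (b ^~ k)
    & continuous (fun p : E * E => b p.1 p.2)].

Definition smooth_L2sym {R : realType} {E F : tvsType R} (N : set E)
  (B : E -> E -> E -> F) : Prop :=
  (forall g, N g -> L2sym (B g)) /\
  conv_smooth [set p : E * E * E | N p.1.1]
    (fun p : E * E * E => B p.1.1 p.1.2 p.2).

(* Sign convention: the covariant derivative along c is h' - Gam (c) (c', h), so
   that Gam is minus the Christoffel symbol of the usual convention. *)
Record weak_pseudo_riemannian {R : realType} {E : tvsType R} (N : set E)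
    (G : E -> E -> E -> R) (Gam : E -> E -> E -> E) : Prop := {
  wpr_open : open N ;
  wpr_metric : smooth_L2sym N G ;
  wpr_nondegenerate : forall g, N g ->
    forall h, (forall k, G g h k = 0) -> h = 0 ;
  wpr_connection : smooth_L2sym N Gam ;
  wpr_levi_civita : forall g, N g -> forall l h k,
    dirD (fun x => G x h k) g l + G g (Gam g l h) k + G g h (Gam g l k) = 0
}.

Definition is_gradient {R : realType} {E : tvsType R} (N : set E)
  (G : E -> E -> E -> R) (V : E -> R) (gradV : E -> E) : Prop :=
  conv_smooth N gradV /\
  forall g, N g -> forall h, dirD V g h = G g (gradV g) h.

Definition geodesic {R : realType} {E : tvsType R} (N : set E)
  (Gam : E -> E -> E -> E) (I : set R) (c : R -> E) : Prop :=
  [/\ smooth_curve I c,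
      forall t, I t -> N (c t)
    & forall t, I t -> curve_derive (curve_derive c) t =
        Gam (c t) (curve_derive c t) (curve_derive c t)].

Definition lagrangian {R : realType} {E : tvsType R} (G : E -> E -> E -> R)
  (V : E -> R) (g k : E) : R := 2^-1 * G g k k - V g.

Definition energy {R : realType} {E : tvsType R} (G : E -> E -> E -> R)
  (V : E -> R) (g k : E) : R := 2^-1 * G g k k + V g.

Definition lagrangian_action {R : realType} {E : tvsType R} (L : E -> E -> R)
  (J : set R) (c : R -> E) : R :=
  (\int[@lebesgue_measure R]_(t in J) L (c t) (curve_derive c t))%R.

(* C (s, t) stands for c_s(t). The choice of J' is immaterial: outside K the
   integrand does not depend on s. *)
Definition extremal {R : realType} {E : tvsType R} (N : set E)
  (L : E -> E -> R) (I : set R) (c : R -> E) : Prop :=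
  [/\ smooth_curve I c,
      forall t, I t -> N (c t)
    & forall (C : R * R -> E) (K : set R),
        conv_smooth [set p : R * R | I p.2] C ->
        (forall s t, I t -> N (C (s, t))) ->
        (forall t, I t -> C (0, t) = c t) ->
        compact K -> K `<=` I ->
        (forall s t, I t -> ~ K t -> C (s, t) = c t) ->
        exists J' : set R,
          [/\ open J', compact (closure J'), closure J' `<=` I, K `<=` J'
            & is_derive (0 : R) (1 : R)
                (fun s : R => lagrangian_action L J' (fun t => C (s, t))) (0 : R)]].

Definition oriented_integral {R : realType} (a b : R) (f : R -> R) : R :=
  if a <= b then (\int[@lebesgue_measure R]_(x in `[a, b]) f x)%R
  else (- \int[@lebesgue_measure R]_(x in `[b, a]) f x)%R.

Section Jacobi.
Context {R : realType} {E : tvsType R}.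
Variables (G : E -> E -> E -> R) (Gam : E -> E -> E -> E).
Variables (V : E -> R) (gradV : E -> E) (e : R).

Definition jacobi_factor (g : E) : R := 2 * (e - V g).

Definition jacobi_metric (g h k : E) : R := jacobi_factor g * G g h k.

Definition jacobi_connection (g h k : E) : E :=
  let f := jacobi_factor in
  let gradf := (- 2) *: gradV g in
  Gam g h k -
  (2 * f g)^-1 *: (dirD f g h *: k + dirD f g k *: h - G g h k *: gradf).

Definition jacobi_domain (N : set E) : set E := [set g | N g /\ V g != e].
End Jacobi.

(* Main.v *)
(** Evaluating a conveniently smooth map along curves that pass through rapidly
    converging sequences of points with prescribed velocities shows that its
    iterated directional derivatives are locally bounded. Hence such a map on a
    metrizable space is continuous, obeys the chain rule along curves and has
    additive first and symmetric mixed second derivatives. This is enough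
    calculus for the first variation formula
      [d/ds int L = - int G (d_s c_s) (c'' - Gam (c', c') + grad V)],
    so, by weak non-degeneracy and bump variations, the extremals are the
    solutions of [c'' = Gam (c', c') - grad V].

    Along a curve of energy [e] one has [G (c', c') = f (c)]. With [ds/dt = f (c)]
    the acceleration of [gamma = c o t] is [f^-2 c'' - f^-3 (f o c)' c'], and
    substituting the equation of motion, the terms containing [grad V] are those
    by which the connection of [f G] differs from [Gam]. *)
Require Import Defs.
From HB Require Import structures.
From mathcomp Require Import all_boot all_order all_algebra.
From mathcomp Require Import all_classical all_reals all_analysis.
From mathcomp Require Import ring lra.

Set Implicit Arguments.
Unset Strict Implicit.
Unset Printing Implicit Defensive.

Import Order.TTheory GRing.Theory Num.Theory.
Import numFieldNormedType.Exports.

Local Open Scope classical_set_scope.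
Local Open Scope ring_scope.

(** * Calculus for curves in a topological vector space *)

(** Convenient smoothness speaks only of curves, whereas differentiating the action under the
    integral sign needs the $s$-derivative of the Lagrangian to be jointly continuous in $(s,t)$,
    and the integration by parts needs $\partial_s\partial_tC=\partial_t\partial_sC$. This gap
    shapes the first half of the proof. It is closed without ever forming a derivative as a
    continuous linear map: only the derivatives $D^nf(x)(v,\dots,v)$ along lines occur, with
    seminorm estimates uniform in the base point, and the mixed second derivative comes from
    polarization. Seminorm estimates also take the place of duality: the mean value inequality is
    proved for a seminorm directly. Since the sign of $f=2(e-V)$ is free, the change of parameter
    may reverse orientation. On an interval $f\circ c$ keeps one sign by the intermediate value
    theorem, and the inversion of the parameter works from $f\circ c\neq0$. *)

Section TvsLimits.
Context {R : realType} {E : tvsType R} {T : Type} (F : set_system T) {FF : Filter F}.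

Lemma tvs_cvgD (f g : T -> E) (a b : E) :
  f @ F --> a -> g @ F --> b -> (fun x => f x + g x) @ F --> a + b.
Proof.
move=> fa gb.
apply: (@cvg_comp _ _ _ (fun x => (f x, g x)) (fun z : E * E => z.1 + z.2)).
  exact: cvg_pair fa gb.
exact: (@add_continuous E (a, b)).
Qed.

Lemma tvs_cvgZ (r : T -> R) (g : T -> E) (a : R) (b : E) :
  r @ F --> a -> g @ F --> b -> (fun x => r x *: g x) @ F --> a *: b.
Proof.
move=> fa gb.
apply: (@cvg_comp _ _ _ (fun x => (r x, g x)) (fun z : R^o * E => z.1 *: z.2)).
  exact: (cvg_pair fa gb).
exact: (@scale_continuous R E (a, b)).
Qed.

Lemma tvs_cvgN (f : T -> E) (a : E) : f @ F --> a -> (fun x => - f x) @ F --> - a.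
Proof. by move=> fa; apply: (cvg_comp _ _ fa); exact: opp_continuous. Qed.

Lemma tvs_cvgB (f g : T -> E) (a b : E) :
  f @ F --> a -> g @ F --> b -> (fun x => f x - g x) @ F --> a - b.
Proof. by move=> fa gb; apply: tvs_cvgD => //; exact: tvs_cvgN. Qed.

End TvsLimits.

Section CurveDerive.
Context {R : realType}.
Implicit Types (E F : tvsType R).

Lemma near_shift0 (t : R) (P : set R) :
  (\forall x \near t, P x) -> \forall h \near (0 : R), P (h + t).
Proof.
move=> Pt; have tc : (fun h : R => h + t) @ (0 : R) --> 0 + t.
  by apply: cvgD; [exact: cvg_id|exact: cvg_cst].
by apply: tc; rewrite add0r.
Qed.

Lemma near_dshift0 (t : R) (P : set R) :
  (\forall x \near t, P x) -> \forall h \near (0 : R)^', P (h + t).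
Proof. by move=> /near_shift0; exact: cvg_within. Qed.

Lemma curve_derive_near E (c d : R -> E) (t : R) l :
  (\forall r \near t, c r = d r) -> is_curve_derive c t l -> is_curve_derive d t l.
Proof.
move=> cd; apply: cvg_trans; apply: near_eq_cvg.
have cdt : c t = d t by exact: (nbhs_singleton cd).
by apply: filterS (near_dshift0 cd) => h; rewrite cdt => ->.
Qed.

Lemma curve_derive_eq E (c d : R -> E) (t : R) l :
  c =1 d -> is_curve_derive c t l -> is_curve_derive d t l.
Proof. by move=> /funext ->. Qed.

Lemma curve_derive_cvg E (c : R -> E) t l :
  is_curve_derive c t l -> c (h + t) @[h --> (0 : R)^'] --> c t.
Proof.
move=> cl.
have : (fun h : R => h *: (h^-1 *: (c (h + t) - c t)) + c t) @ 0^' --> 0 *: l + c t.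
  apply: tvs_cvgD; last exact: cvg_cst.
  apply: tvs_cvgZ => //; exact: cvg_within.
rewrite scale0r add0r; apply: cvg_trans; apply: near_eq_cvg; near=> h.
rewrite scalerA divff ?scale1r ?subrK//; near: h; exact: nbhs_dnbhs_neq.
Unshelve. all: by end_near. Qed.

Lemma curve_derive_continuous E (c : R -> E) (t : R) l :
  is_curve_derive c t l -> {for t, continuous c}.
Proof.
move=> /curve_derive_cvg cl.
have : {for (0 : R), continuous (c \o shift t)}.
  by apply/continuous_withinNx; rewrite /= add0r.
by rewrite /continuous_at /prop_for /= cvg_comp_shift !add0r.
Qed.

Lemma curve_derive_cst E (a : E) t : is_curve_derive (fun=> a) t 0.
Proof.
rewrite /is_curve_derive; under eq_fun do rewrite subrr scaler0; exact: cvg_cst.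
Qed.

Lemma curve_derive_id t : is_curve_derive (fun r : R => r) t 1.
Proof. by apply/is_curve_deriveE; exact: is_derive_id. Qed.

Lemma curve_deriveD E (c d : R -> E) t k l : is_curve_derive c t k ->
  is_curve_derive d t l -> is_curve_derive (fun r => c r + d r) t (k + l).
Proof.
move=> ck dl; apply: cvg_trans (tvs_cvgD ck dl); apply: near_eq_cvg.
by apply: nearW => h; rewrite -scalerDr opprD addrACA.
Qed.

Lemma curve_deriveZ E (a : R -> R) (d : R -> E) t (k : R) l : is_curve_derive a t k ->
  is_curve_derive d t l ->
  is_curve_derive (fun r => a r *: d r) t (k *: d t + a t *: l).
Proof.
move=> ck dl; apply: cvg_trans
  (tvs_cvgD (tvs_cvgZ ck (curve_derive_cvg dl)) (tvs_cvgZ (cvg_cst (a t)) dl)).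
apply: near_eq_cvg; apply: nearW => h /=.
rewrite [a t *: _]scalerA [a t * _]mulrC -scalerA.
by rewrite -[(_ * _) *: _]scalerA -scalerDr; congr (_ *: _); rewrite scalerBl scalerBr addrA subrK.
Qed.

Lemma curve_derive_scale E (a : R) (d : R -> E) t l :
  is_curve_derive d t l -> is_curve_derive (fun r => a *: d r) t (a *: l).
Proof.
move=> dl; have := curve_deriveZ (curve_derive_cst (a : R^o) t) dl.
by rewrite scale0r add0r.
Qed.

Lemma curve_deriveN E (d : R -> E) t l :
  is_curve_derive d t l -> is_curve_derive (fun r => - d r) t (- l).
Proof.
move=> /(@curve_derive_scale E (-1)); rewrite scaleN1r.
by apply: curve_derive_eq => r; rewrite scaleN1r.
Qed.

Lemma curve_deriveB E (c d : R -> E) t k l : is_curve_derive c t k ->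
  is_curve_derive d t l -> is_curve_derive (fun r => c r - d r) t (k - l).
Proof. by move=> ck dl; apply: curve_deriveD => //; exact: curve_deriveN. Qed.

Lemma curve_derive_unique E (c : R -> E) t k l : hausdorff_space E ->
  is_curve_derive c t k -> is_curve_derive c t l -> k = l.
Proof. by move=> hE; exact: (cvg_unique hE). Qed.

Lemma curve_derive_val E (c : R -> E) t l : hausdorff_space E ->
  is_curve_derive c t l -> curve_derive c t = l.
Proof.
move=> hE cl; rewrite /curve_derive; case: xgetP => [x _ xl|/(_ l)].
  exact: curve_derive_unique xl cl.
by move/(_ cl).
Qed.

Lemma curve_derivableP E (c : R -> E) t :
  curve_derivable c t -> is_curve_derive c t (curve_derive c t).
Proof.
by move=> [l cl]; rewrite /curve_derive; case: xgetP => [x _//|/(_ l)/(_ cl)].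
Qed.

Lemma curve_derive_comp E (c : R -> E) (phi : R -> R) t k l :
  is_curve_derive phi t k -> is_curve_derive c (phi t) l ->
  is_curve_derive (c \o phi) t (k *: l).
Proof.
move=> phik cl.
(* The difference quotient of [c], filled in with [l] at 0, stays meaningful for those [h] with
   [phi (h + t) = phi t], where one cannot divide by the increment of [phi]. *)
pose q (h : R) := if h == 0 then l else h^-1 *: (c (h + phi t) - c (phi t)).
have qc : q @ (0 : R) --> l.
  have : {for (0 : R), continuous q}; last by rewrite /prop_for /continuous_at {2}/q eqxx.
  apply/continuous_withinNx; rewrite {2}/q eqxx; apply: cvg_trans cl.
  apply: near_eq_cvg; near=> h; rewrite /q ifF//.
  by apply/negbTE; near: h; exact: nbhs_dnbhs_neq.
have pc : (fun h => phi (h + t) - phi t) @ (0 : R)^' --> (0 : R).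
  rewrite -[X in _ --> X](subrr (phi t)); apply: cvgB; last exact: cvg_cst.
  exact: curve_derive_cvg phik.
apply: cvg_trans (tvs_cvgZ phik (cvg_comp _ _ pc qc)).
apply: near_eq_cvg; apply: nearW => h /=; rewrite /q.
case: eqVneq => [/eqP|hn].
  by rewrite subr_eq0 => /eqP->; rewrite !subrr !scaler0 scale0r.
have -> : (h^-1 *: (phi (h + t) - phi t)) = h^-1 * (phi (h + t) - phi t) by [].
by rewrite scalerA -mulrA divff// mulr1 subrK.
Unshelve. all: by end_near. Qed.

Lemma curve_derive_pair E F (c : R -> E) (d : R -> F) t k l :
  is_curve_derive (fun r => (c r, d r)) t (k, l) <->
  is_curve_derive c t k /\ is_curve_derive d t l.
Proof.
split=> [cd|[ck dl]].
  split.
    exact: (cvg_comp _ _ cd cvg_fst).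
  exact: (cvg_comp _ _ cd cvg_snd).
exact: (cvg_pair ck dl).
Qed.

End CurveDerive.

(** * Finite orders of differentiability and smooth curves *)

Section NDerivable.
Context {R : realType}.
Implicit Types (E F : tvsType R) (I J : set R).

(** The derivative is an existential witness rather than [curve_derive u], so the closure rules
    below are inductions with explicit formulas that never appeal to uniqueness of limits;
    [smooth_curveP] translates back to [smooth_curve]. *)
Fixpoint nderivable {E} (n : nat) I (u : R -> E) : Prop :=
  if n is m.+1 then
    exists2 v, (forall t, I t -> is_curve_derive u t (v t)) & nderivable m I v
  else True.

Lemma open_near I (P : set R) t :
  open I -> I t -> (forall r, I r -> P r) -> \forall r \near t, P r.
Proof. by move=> oI It IP; apply: filterS (open_nbhs_nbhs (conj oI It)). Qed.

Lemma nderivableW E n I (u : R -> E) : nderivable n.+1 I u -> nderivable n I u.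
Proof.
elim: n u => [//|n IHn] u [v uv nv]; exists v => //; exact: IHn.
Qed.

Lemma nderivable_eq E n I (u v : R -> E) : open I ->
  (forall t, I t -> u t = v t) -> nderivable n I u -> nderivable n I v.
Proof.
move=> oI uv; case: n => [//|n] [w uw nw]; exists w => // t It.
by apply: curve_derive_near (uw _ It); exact: (open_near oI).
Qed.

Lemma nderivable_cst E n I (a : E) : nderivable n I (fun=> a).
Proof.
elim: n a => [//|n IHn] a; exists (fun=> 0) => // t _; exact: curve_derive_cst.
Qed.

Lemma nderivable_id n I : nderivable n I (fun t : R => t).
Proof.
case: n => [//|n]; exists (fun=> 1); last exact: nderivable_cst.
by move=> t _; exact: curve_derive_id.
Qed.

Lemma nderivableD E n I (u v : R -> E) : nderivable n I u -> nderivable n I v ->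
  nderivable n I (fun t => u t + v t).
Proof.
elim: n u v => [//|n IHn] u v [u' uu' nu] [v' vv' nv].
exists (fun t => u' t + v' t); last exact: IHn.
by move=> t It; apply: curve_deriveD; [exact: uu'|exact: vv'].
Qed.

Lemma nderivableZ E n I (a : R -> R) (v : R -> E) : nderivable n I a ->
  nderivable n I v -> nderivable n I (fun t => a t *: v t).
Proof.
elim: n a v => [//|n IHn] a v na nv.
have [a' aa' na'] := na; have [v' vv' nv'] := nv.
exists (fun t => a' t *: v t + a t *: v' t).
  by move=> t It; apply: curve_deriveZ; [exact: aa'|exact: vv'].
by apply: nderivableD; apply: IHn => //; exact: nderivableW.
Qed.

Lemma nderivable_scale E n I a (v : R -> E) :
  nderivable n I v -> nderivable n I (fun t => a *: v t).
Proof. by move=> nv; apply: nderivableZ => //; exact: nderivable_cst. Qed.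

Lemma nderivableN E n I (v : R -> E) :
  nderivable n I v -> nderivable n I (fun t => - v t).
Proof.
move=> /(@nderivable_scale _ _ _ (-1)).
by congr (nderivable _ _ _); apply/funext => t; rewrite scaleN1r.
Qed.

Lemma nderivableB E n I (u v : R -> E) : nderivable n I u -> nderivable n I v ->
  nderivable n I (fun t => u t - v t).
Proof. by move=> nu nv; apply: nderivableD => //; exact: nderivableN. Qed.

Lemma nderivable_comp E n I J (c : R -> E) (phi : R -> R) :
  (forall t, I t -> J (phi t)) -> nderivable n I phi -> nderivable n J c ->
  nderivable n I (c \o phi).
Proof.
move=> IJ; elim: n c => [//|n IHn] c np [c' cc' nc'].
have [p' pp' np'] := np.
exists (fun t => p' t *: (c' \o phi) t).
  by move=> t It; apply: curve_derive_comp; [exact: pp'|exact/cc'/IJ].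
by apply: nderivableZ => //; apply: IHn => //; exact: nderivableW.
Qed.

Lemma curve_derive_inv (a : R -> R) t k : a t != 0 -> is_curve_derive a t k ->
  is_curve_derive (fun r => (a r)^-1) t (- k * (a t)^-1 * (a t)^-1).
Proof.
move=> at0 /is_curve_deriveE ak; apply/is_curve_deriveE.
apply: is_derive_eq.
rewrite -exprVn expr2 [_ *: _]mulNr mulNr mulNr.
by rewrite [in LHS]mulrC mulrA.
Qed.

Lemma nderivableV n I (a : R -> R) : (forall t, I t -> a t != 0) ->
  nderivable n I a -> nderivable n I (fun t => (a t)^-1).
Proof.
move=> a0; elim: n => [//|n IHn] na; have [a' aa' na'] := na.
exists (fun t => - a' t * (a t)^-1 * (a t)^-1).
  by move=> t It; apply: curve_derive_inv; [exact: a0|exact: aa'].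
have nV := IHn (nderivableW na).
apply: (@nderivableZ (R : tvsType R)) => //; apply: (@nderivableZ (R : tvsType R)) => //.
exact: nderivableN.
Qed.

Lemma nderivable_pair E F n I (u : R -> E) (v : R -> F) :
  nderivable n I (fun t => (u t, v t)) <-> nderivable n I u /\ nderivable n I v.
Proof.
split.
  elim: n u v => [//|n IHn] u v [w uvw nw].
  have /IHn[n1 n2] : nderivable n I (fun t => ((w t).1, (w t).2)).
    by congr (nderivable _ _ _): nw; apply/funext => t; case: (w t).
  by split; [exists (fun t => (w t).1)|exists (fun t => (w t).2)] => // t It;
    have := uvw _ It; case: (w t) => a b /curve_derive_pair[].
elim: n u v => [//|n IHn] u v [[u' uu' nu] [v' vv' nv]].
exists (fun t => (u' t, v' t)); last exact: IHn.
by move=> t It; apply/curve_derive_pair; split; [exact: uu'|exact: vv'].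
Qed.

Lemma nderivable_curve_derive E n I (u : R -> E) : hausdorff_space E -> open I ->
  nderivable n.+1 I u -> nderivable n I (curve_derive u).
Proof.
move=> hE oI [v uv nv]; apply: nderivable_eq nv => // t It.
by apply/esym; apply: curve_derive_val => //; exact: uv.
Qed.

Lemma smooth_curveP E I (u : R -> E) : hausdorff_space E -> open I ->
  smooth_curve I u <-> forall n, nderivable n I u.
Proof.
move=> hE oI; split=> [su n|nu n].
  suff : forall k, nderivable n I (iter k curve_derive u) by move/(_ 0).
  elim: n => [//|n IHn] k; exists (iter k.+1 curve_derive u) => // t It.
  exact/curve_derivableP/su.
suff [v uv _] : nderivable 1 I (iter n curve_derive u).
  by move=> t It; exists (v t); exact: uv.
(* Each passage to [curve_derive] costs one order, so the order of derivability is generalized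
   before the induction. *)
elim: n (1%N) => [|n IHn] m; first exact: nu.
exact/nderivable_curve_derive/IHn.
Qed.

(** The candidate derivatives form the same set for both curves, so [xget] picks the same element,
    also where no derivative exists. *)
Lemma iter_curve_derive_eq E I (u v : R -> E) n t : open I -> I t ->
  (forall r, I r -> u r = v r) ->
  iter n curve_derive u t = iter n curve_derive v t.
Proof.
move=> oI It uv; elim: n t It => [t It|n IHn t It]; first exact: uv.
rewrite /= /curve_derive; congr (xget 0 _); apply/seteqP; split=> l /=;
  apply: curve_derive_near; apply: (open_near oI It) => r Ir; by rewrite IHn.
Qed.

Lemma smooth_curve_eq E I (u v : R -> E) : open I ->
  (forall r, I r -> u r = v r) -> smooth_curve I u -> smooth_curve I v.
Proof.
move=> oI uv su n t It; have [l ul] := su n t It; exists l.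
apply: curve_derive_near ul; apply: (open_near oI It) => r Ir.
exact: iter_curve_derive_eq Ir uv.
Qed.

(** Source of the translation and homogeneity rules [ndirD_line] and [ndirDZ], and of the factor
    [rate k ^+ n] gained where a curve runs fast along a line. *)
Lemma iter_curve_derive_affine E I (u : R -> E) (a b : R) n t : hausdorff_space E ->
  open I -> I (a * t + b) -> smooth_curve I u ->
  iter n curve_derive (fun r => u (a * r + b)) t =
  a ^+ n *: iter n curve_derive u (a * t + b).
Proof.
move=> hE oI It su.
elim: n t It => [t It|n IHn t It]; first by rewrite expr0 scale1r.
have oJ : open [set r | I (a * r + b)].
  apply: (@open_comp _ _ (fun r : R => a * r + b)) => // x _.
  by apply: cvgD; [apply: cvgM; [exact: cvg_cst|exact: cvg_id]|exact: cvg_cst].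
have ic := curve_derivableP (su n _ It).
have ia : is_curve_derive (fun r : R => a * r + b) t (a : R).
  rewrite -[X in is_curve_derive _ _ X]addr0; apply: curve_deriveD; last exact: curve_derive_cst.
  have := @curve_derive_scale _ R a _ _ _ (curve_derive_id t).
  by rewrite [_ *: _]mulr1.
rewrite iterS; apply: curve_derive_val => //.
have := @curve_derive_scale _ E (a ^+ n) _ _ _ (curve_derive_comp ia ic).
rewrite scalerA -exprSr; apply: curve_derive_near.
by apply: (open_near oJ It) => r Ir; rewrite IHn.
Qed.

End NDerivable.

(** * Bump functions and localization *)

Section Bump.
Context {R : realType}.

(** The functions $x^{-k}e^{-1/x}$ form a family closed under differentiation,
    $\mathrm{flat}_k'=-k\,\mathrm{flat}_{k+1}+\mathrm{flat}_{k+2}$, so one induction proves all of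
    them smooth. *)
Definition flat (k : nat) (x : R) : R :=
  if 0 < x then x^-1 ^+ k * expR (- x^-1) else 0.

Lemma flat_ge0 k x : 0 <= flat k x.
Proof.
rewrite /flat; case: ifPn => // x0.
by rewrite mulr_ge0 ?expR_ge0// exprn_ge0// invr_ge0 ltW.
Qed.

Lemma flat_gt0 k x : 0 < x -> 0 < flat k x.
Proof. by move=> x0; rewrite /flat x0 mulr_gt0 ?expR_gt0// exprn_gt0// invr_gt0. Qed.

Lemma flat_le0 k x : x <= 0 -> flat k x = 0.
Proof. by rewrite /flat leNgt => /negbTE ->. Qed.

(** With $y=1/x$ one has $e^y=(e^{y/(k+1)})^{k+1}\ge(y/(k+1))^{k+1}$, hence
    $y^ke^{-y}\le(k+1)^{k+1}/y$. This linear bound makes the difference quotient of [flat k] at 0,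
    which is [flat k.+1 h] for [h > 0], tend to 0. *)
Lemma flat_le k x : 0 <= x -> flat k x <= k.+1%:R ^+ k.+1 * x.
Proof.
rewrite le_eqVlt => /orP[/eqP<-|x0]; first by rewrite flat_le0// mulr0.
rewrite /flat x0 expRN ler_pdivrMr ?expR_gt0//.
have y0 : 0 < x^-1 by rewrite invr_gt0.
set y := x^-1 in y0 *; have -> : x = y^-1 by rewrite invrK.
have k0 : (0 : R) < k.+1%:R by rewrite ltr0n.
have h : (y / k.+1%:R) ^+ k.+1 <= expR y.
  rewrite -[X in expR X](divfK (lt0r_neq0 k0)) expRM_natr lerXn2r ?nnegrE//.
  - by rewrite divr_ge0// ltW.
  - by apply: le_trans (expR_ge1Dx _); rewrite lerDr.
have -> : y ^+ k = k.+1%:R ^+ k.+1 * y^-1 * (y / k.+1%:R) ^+ k.+1.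
  rewrite expr_div_n [y ^+ k.+1]exprS; field.
  by rewrite (gt_eqF y0) expf_neq0// gt_eqF.
by rewrite ler_wpM2l// mulr_ge0// ?invr_ge0 ?exprn_ge0// ltW.
Qed.

Lemma flat_derive k x :
  is_curve_derive (flat k) x (- (k%:R) * flat k.+1 x + flat k.+2 x).
Proof.
have [x0|x0|->] := ltgtP x 0.
- rewrite !flat_le0 ?ltW// mulr0 addr0.
  apply: curve_derive_near (curve_derive_cst (0 : R) x).
  by apply: filterS (lt_nbhsl x0) => y y0; rewrite flat_le0// ltW.
- have -> : - (k%:R) * flat k.+1 x + flat k.+2 x =
     (x^-1 ^+ k) * (x ^- 2 * expR (- x^-1)) + expR (- x^-1) * (- (k%:R * x^-1 ^+ k.+1)).
    by rewrite /flat x0 -!exprVn [x^-1 ^+ k.+2]exprSr [x^-1 ^+ k.+1]exprSr; ring.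
  apply: (@curve_derive_near _ _ (fun y : R => y^-1 ^+ k * expR (- y^-1))).
    by apply: filterS (lt_nbhsr x0) => y y0; rewrite /flat ifT.
  apply/is_curve_deriveE.
  have xn0 : x != 0 by rewrite gt_eqF.
  have d1 : is_derive x 1 (fun y : R => y^-1) (- x ^- 2).
    apply/is_curve_deriveE; have := curve_derive_inv xn0 (curve_derive_id x).
    by rewrite -exprVn expr2 !mulNr mul1r.
  have d2 : is_derive x 1 (fun y : R => expR (- y^-1)) (x ^- 2 * expR (- x^-1)).
    have d3 : is_derive x 1 (fun y : R => - y^-1) (x ^- 2).
      by rewrite -[x ^- 2]opprK; apply: is_deriveN.
    have d5 := is_derive_expR (- x^-1).
    by have := @is_derive1_comp _ expR (fun y => - y^-1) x _ _ d5 d3; rewrite mulrC.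
  have d4 : is_derive x 1 (fun y : R => y^-1 ^+ k) (- (k%:R * x^-1 ^+ k.+1)).
    case: (k) => [|m].
      by under eq_fun do rewrite expr0; rewrite mul0r oppr0; exact: is_derive_cst.
    have := is_deriveX m.+1 d1; rewrite exprfctE /=.
    rewrite -exprVn [_ *: _]mulrN -mulrA -exprD addn2; exact.
  by have := is_deriveM d4 d2; rewrite addrC.
- rewrite [flat k.+1 0]flat_le0// [flat k.+2 0]flat_le0// mulr0 addr0.
  apply/(@cvgrPdist_le _ R^o) => e e0.
  have C0 : (0 : R) < k.+2%:R ^+ k.+2 by rewrite exprn_gt0// ltr0n.
  near=> h; rewrite (@flat_le0 k 0)// subr0 addr0 sub0r normrN.
  have [h0|h0] := leP h 0; first by rewrite flat_le0// scaler0 normr0 ltW.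
  have -> : h^-1 *: flat k h = flat k.+1 h by rewrite /flat h0 exprS -mulrA.
  rewrite ger0_norm ?flat_ge0//; apply: le_trans (flat_le _ (ltW h0)) _.
  rewrite -ler_pdivlMl// -[leLHS]gtr0_norm//; near: h.
  apply: dnbhs0_le; by rewrite mulr_gt0// invr_gt0.
Unshelve. all: by end_near. Qed.

Lemma nderivable_flat n k (I : set R) : nderivable n I (flat k).
Proof.
elim: n k => [//|n IHn] k; exists (fun x => - (k%:R) * flat k.+1 x + flat k.+2 x).
  by move=> t _; exact: flat_derive.
apply: nderivableD => //; exact: (@nderivable_scale _ R _ _ (- k%:R) (flat k.+1)).
Qed.

Definition smooth_step (x : R) : R := flat 0 x / (flat 0 x + flat 0 (1 - x)).

Lemma smooth_step_den x : 0 < flat 0 x + flat 0 (1 - x).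
Proof.
have [x0|x0] := ltP 0 x; first by rewrite ltr_pwDl ?flat_ge0 ?flat_gt0.
by rewrite ltr_wpDl ?flat_ge0// flat_gt0// subr_gt0 (le_lt_trans x0).
Qed.

Lemma smooth_step_itv x : 0 <= smooth_step x <= 1.
Proof.
have d0 := smooth_step_den x; apply/andP; split.
  by rewrite divr_ge0 ?flat_ge0// ltW.
by rewrite ler_pdivrMr ?smooth_step_den// mul1r lerDl flat_ge0.
Qed.

Lemma smooth_step0 x : x <= 0 -> smooth_step x = 0.
Proof. by move=> x0; rewrite /smooth_step flat_le0// mul0r. Qed.

Lemma smooth_step1 x : 1 <= x -> smooth_step x = 1.
Proof.
move=> x1; rewrite /smooth_step (flat_le0 0 (x := 1 - x)) ?subr_le0// addr0.
by rewrite divff// gt_eqF// flat_gt0// (lt_le_trans ltr01).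
Qed.

Lemma nderivable_smooth_step n : nderivable n setT smooth_step.
Proof.
have nf1 : nderivable n setT (fun x => flat 0 (1 - x)).
  apply: (@nderivable_comp _ _ _ _ setT (flat 0) (fun x : R => 1 - x)) => //.
    by apply: nderivableB; [exact: nderivable_cst|exact: nderivable_id].
  exact: nderivable_flat.
apply: (@nderivableZ _ R); first exact: nderivable_flat.
apply: nderivableV; first by move=> t _; rewrite gt_eqF// smooth_step_den.
by apply: nderivableD => //; exact: nderivable_flat.
Qed.

Definition bump (x : R) : R := smooth_step (2 - x) * smooth_step (2 + x).

Lemma bump_itv x : 0 <= bump x <= 1.
Proof.
have /andP[a0 a1] := smooth_step_itv (2 - x).
have /andP[b0 b1] := smooth_step_itv (2 + x).
by rewrite mulr_ge0//= mulr_ile1.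
Qed.

Lemma bump1 x : `|x| <= 1 -> bump x = 1.
Proof.
by rewrite ler_norml => /andP[x1 x2]; rewrite /bump !smooth_step1 ?mulr1//; lra.
Qed.

Lemma bump0 x : 2 <= `|x| -> bump x = 0.
Proof.
rewrite ler_normr /bump => /orP[x2|x2].
  by rewrite smooth_step0 ?mul0r//; lra.
by rewrite (@smooth_step0 (2 + x)) ?mulr0//; lra.
Qed.

Lemma nderivable_bump n : nderivable n setT bump.
Proof.
apply: (@nderivableZ _ R).
  apply: (@nderivable_comp _ _ _ _ setT smooth_step (fun x : R => 2 - x)) => //.
    by apply: nderivableB; [exact: nderivable_cst|exact: nderivable_id].
  exact: nderivable_smooth_step.
apply: (@nderivable_comp _ _ _ _ setT smooth_step (fun x : R => 2 + x)) => //.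
  by apply: nderivableD; [exact: nderivable_cst|exact: nderivable_id].
exact: nderivable_smooth_step.
Qed.

(** A compactly supported function that is the identity near 0. It serves to squeeze the real line
    into a small interval, and as the profile with value 0 and slope 1 that carries a prescribed
    velocity. *)
Definition bump_id (x : R) : R := x * bump x.

Lemma nderivable_bump_id n : nderivable n setT bump_id.
Proof.
apply: (@nderivableZ _ R); first exact: nderivable_id.
exact: nderivable_bump.
Qed.

Lemma bump_id_norm x : `|bump_id x| <= 2.
Proof.
have /andP[b0 b1] := bump_itv x.
have [x2|x2] := leP 2 `|x|; first by rewrite /bump_id bump0// mulr0 normr0.
by rewrite normrM (ger0_norm b0) -[leRHS]mulr1 ler_pM// ltW.
Qed.

Lemma bump_id_eq x : `|x| <= 1 -> bump_id x = x.
Proof. by move=> x1; rewrite /bump_id bump1// mulr1. Qed.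

Lemma bump_id0 x : 2 <= `|x| -> bump_id x = 0.
Proof. by move=> x1; rewrite /bump_id bump0// mulr0. Qed.

End Bump.

(** * Smooth maps along curves defined on an open set of parameters *)

Section Localization.
Context {R : realType}.
Implicit Types (E F : tvsType R).

(** [conv_smooth] tests only curves defined on the whole line. Precomposition with [phi], which is
    the identity near [t] and stays within [2 * d] of [t], hence inside [I], produces such a curve
    without changing the germ at [t]. *)
Lemma conv_smooth_curve E F (U : set E) (f : E -> F) (I : set R) (c : R -> E) :
  hausdorff_space E -> conv_smooth U f -> open I -> smooth_curve I c ->
  (forall t, I t -> U (c t)) -> smooth_curve I (f \o c).
Proof.
move=> hE fU oI sc cU n t It.
have [d d0 dI] : exists2 d : R, 0 < d & forall r, `|t - r| <= 2 * d -> I r.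
  have [d/= d0 dI] := open_nbhs_nbhs (conj oI It).
  exists (d / 3); first by rewrite divr_gt0.
  move=> r tr; apply: dI => /=; apply: le_lt_trans tr _; lra.
pose phi (r : R) := t + d * bump_id (d^-1 * (r - t)).
have phiI r : I (phi r).
  apply: dI; rewrite /phi opprD addrA subrr sub0r normrN normrM gtr0_norm//.
  by rewrite mulrC ler_pM2r// bump_id_norm.
have phin m : nderivable m setT phi.
  apply: nderivableD; first exact: nderivable_cst.
  apply: (@nderivable_scale _ R).
  apply: (@nderivable_comp _ _ _ _ setT bump_id (fun r => d^-1 * (r - t))) => //.
    apply: (@nderivable_scale _ R); apply: nderivableB; [exact: nderivable_id|exact: nderivable_cst].
  exact: nderivable_bump_id.
have s1 : smooth_curve setT (c \o phi).
  apply/smooth_curveP => //; first exact: openT.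
  move=> m; apply: (@nderivable_comp _ _ _ _ I) => //.
  by move: m; apply/smooth_curveP.
have s2 := fU _ s1 (fun r => cU _ (phiI r)).
pose J := [set r : R | `|t - r| < d].
have oJ : open J.
  by have := @ball_open R R^o t d; apply.
have Jt : J t by rewrite /J /= subrr normr0.
have : smooth_curve J (f \o c); last exact.
apply: (@smooth_curve_eq _ _ J (f \o (c \o phi))) => //.
  move=> r Jr /=; congr (f (c _)); rewrite /phi bump_id_eq.
    by rewrite mulrA divff ?gt_eqF// mul1r addrC subrK.
  rewrite normrM gtr0_norm ?invr_gt0// ler_pdivrMl// mulr1 distrC; exact: ltW.
by move=> m r _; exact: s2.
Qed.

End Localization.

(** * Seminorms and metrizable spaces *)

Section Seminorms.
Context {R : realType}.
Implicit Types (E F : tvsType R).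

Definition cont_seminorm {E} (p : E -> R) : Prop :=
  seminorm p /\ forall e, 0 < e -> \forall x \near (0 : E), p x < e.

Section Basic.
Context {E : tvsType R} (p : E -> R).
Hypothesis sp : seminorm p.

Lemma seminorm0 : p 0 = 0.
Proof. by have := sp.2 0 0; rewrite scale0r normr0 mul0r. Qed.

Lemma seminormZ a x : p (a *: x) = `|a| * p x. Proof. exact: sp.2. Qed.

Lemma seminormN x : p (- x) = p x.
Proof. by rewrite -scaleN1r seminormZ normrN1 mul1r. Qed.

Lemma seminorm_triangle x y : p (x + y) <= p x + p y. Proof. exact: sp.1. Qed.

Lemma seminormBC x y : p (x - y) = p (y - x).
Proof. by rewrite -opprB seminormN. Qed.

Lemma seminorm_ge0 x : 0 <= p x.
Proof.
have := seminorm_triangle x (- x).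
by rewrite subrr seminorm0 seminormN -mulr2n pmulrn_lge0.
Qed.

Lemma seminorm_dist x y z : p (x - z) <= p (x - y) + p (y - z).
Proof. by have := seminorm_triangle (x - y) (y - z); rewrite addrA subrK. Qed.

Lemma seminorm_sum n (f : 'I_n -> E) : p (\sum_(i < n) f i) <= \sum_(i < n) p (f i).
Proof.
elim: n f => [|n IHn] f; first by rewrite !big_ord0 seminorm0.
rewrite !big_ord_recr /=; apply: le_trans (seminorm_triangle _ _) _.
by rewrite lerD2r.
Qed.

End Basic.

Lemma cont_seminorm_cvg E (p : E -> R) (T : Type) (F : set_system T) (f : T -> E) l e :
  Filter F -> cont_seminorm p -> f @ F --> l -> 0 < e -> \forall x \near F, p (f x - l) < e.
Proof.
move=> FF [sp cp] fl e0.
have : (fun x => f x - l) @ F --> 0.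
  by rewrite -[X in _ --> X](subrr l); apply: tvs_cvgB => //; exact: cvg_cst.
by move/(_ _ (cp _ e0)).
Qed.

Lemma cont_seminorm_derive E (p : E -> R) (u : R -> E) t l e :
  cont_seminorm p -> is_curve_derive u t l -> 0 < e ->
  exists2 d : R, 0 < d & forall r, `|r - t| < d ->
    p (u r - u t - (r - t) *: l) <= e * `|r - t|.
Proof.
move=> cp ul e0; have := cont_seminorm_cvg _ cp ul e0.
rewrite near_withinE /= => -[d/= d0 H]; exists d => // r rd.
have [->|rt] := eqVneq r t.
  by rewrite !subrr scale0r subr0 (seminorm0 cp.1) normr0 mulr0.
have rt0 : r - t != 0 by rewrite subr_eq0.
have := H (r - t); rewrite /ball_ /= sub0r normrN subrK => /(_ rd rt0) /ltW.
have -> : (r - t)^-1 *: (u r - u t) - l = (r - t)^-1 *: (u r - u t - (r - t) *: l).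
  by rewrite [in RHS]scalerBr scalerA mulVf// scale1r.
by rewrite (seminormZ cp.1) normrV ?unitfE// ler_pdivrMl ?normr_gt0// mulrC.
Qed.

(** A supremum argument for the seminorm itself. Let [s] be the supremum of the times up to which
    the growth rate from [a] is at most [M + e1]. The derivative at [s] gives this rate on both
    sides of [s]; so the bound holds at [s], and if [s < b] it extends beyond [s]. *)
Lemma mean_value E (p : E -> R) (u u' : R -> E) (a b M : R) : cont_seminorm p ->
  a <= b -> (forall t, a <= t <= b -> is_curve_derive u t (u' t)) ->
  (forall t, a <= t <= b -> p (u' t) <= M) -> p (u b - u a) <= M * (b - a).
Proof.
move=> cp ab uu' u'M; have sp := cp.1.
have pT := seminorm_triangle sp; have pd := seminorm_dist sp.
apply/ler_addgt0Pr => e e0.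
(* The [+ 1] keeps the denominator positive when [a = b]. *)
pose e1 := e / (b - a + 1); have ba1 : 0 < b - a + 1 by rewrite ltr_wpDl// subr_ge0.
have e10 : 0 < e1 by rewrite divr_gt0.
suff : p (u b - u a) <= (M + e1) * (b - a).
  move/le_trans; apply; rewrite mulrDl lerD2l /e1 mulrAC -mulrA.
  apply: ler_piMr; first exact: ltW.
  by rewrite ler_pdivrMr// mul1r lerDl.
pose S := [set t : R | a <= t <= b /\
  forall r, a <= r <= t -> p (u r - u a) <= (M + e1) * (r - a)].
have Sa : S a.
  split; first by rewrite lexx.
  move=> r /le_anti <-; by rewrite !subrr (seminorm0 sp) mulr0.
have Sub : ubound S b by move=> t [/andP[]].
have hS : has_sup S by split; [exists a|exists b].
pose s := sup S.
have as_ : a <= s by apply: ub_le_sup => //; exists b.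
have sb : s <= b by apply: ge_sup => //; exists a.
have sab : a <= s <= b by rewrite as_.
have [d d0 H] := cont_seminorm_derive cp (uu' _ sab) e10.
have K r : `|r - s| < d -> p (u r - u s) <= (M + e1) * `|r - s|.
  move=> rd; rewrite -(subrK ((r - s) *: u' s) (u r - u s)).
  apply: le_trans (pT _ _) _; rewrite (seminormZ sp) mulrDl addrC lerD ?H//.
  by rewrite mulrC ler_wpM2r// u'M.
have Ss r : a <= r -> r < s -> p (u r - u a) <= (M + e1) * (r - a).
  move=> ar rs; have [t [_ St] rt] := sup_gt hS.1 rs.
  by apply: St; rewrite ar ltW.
have Sss : p (u s - u a) <= (M + e1) * (s - a).
  have [<-|as0] := eqVneq a s; first by rewrite !subrr (seminorm0 sp) mulr0.
  have {as0}as0 : a < s by rewrite lt_neqAle as0.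
  pose r := Num.max a (s - d / 2).
  have ar : a <= r by rewrite le_max lexx.
  have rs : r < s by rewrite gt_max as0 ltrBlDr ltrDl divr_gt0.
  have rds : s - r < d.
    by rewrite ltrBlDr -ltrBlDl; apply: (@lt_le_trans _ _ (s - d / 2)); [lra|rewrite le_max lexx orbT].
  apply: le_trans (pd _ (u r) _) _.
  have -> : (M + e1) * (s - a) = (M + e1) * (s - r) + (M + e1) * (r - a) by ring.
  rewrite lerD ?Ss// (seminormBC sp).
  have srn : `|r - s| = s - r by rewrite distrC ger0_norm// subr_ge0 ltW.
  by rewrite -srn K// srn.
have Sr r : s <= r -> r < s + d -> p (u r - u a) <= (M + e1) * (r - a).
  move=> sr rd; apply: le_trans (pd _ (u s) _) _.
  have -> : (M + e1) * (r - a) = (M + e1) * (r - s) + (M + e1) * (s - a) by ring.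
  rewrite lerD//; have rn : `|r - s| = r - s by rewrite ger0_norm// subr_ge0.
  by rewrite -rn K// rn ltrBlDl.
have [bs|sb'] := leP b s.
  by have -> : b = s by apply/le_anti; rewrite bs.
suff : S (Num.min b (s + d / 2)).
  move=> /(ub_le_sup (ex_intro _ b Sub)); rewrite -/s leNgt lt_min sb' /=.
  by rewrite ltrDl divr_gt0.
split.
  rewrite le_min ab ge_min lexx /= (le_trans as_)//= ?andbT ?lerDl ?divr_ge0 ?ltW//.
move=> r /andP[ar]; rewrite le_min => /andP[rb rd].
have [rs|sr] := ltP r s; first exact: Ss.
by apply: Sr => //; lra.
Qed.

Lemma mean_value_abs E (p : E -> R) (u u' : R -> E) (r M : R) : cont_seminorm p ->
  (forall t, `|t| <= `|r| -> is_curve_derive u t (u' t)) ->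
  (forall t, `|t| <= `|r| -> p (u' t) <= M) -> p (u r - u 0) <= M * `|r|.
Proof.
move=> cp uu' u'M; have [r0|r0] := leP 0 r.
  have rt t : 0 <= t <= r -> `|t| <= `|r|.
    by move=> /andP[t0 tr]; rewrite !ger0_norm.
  by have := mean_value cp r0 (fun t h => uu' t (rt t h)) (fun t h => u'M t (rt t h));
    rewrite subr0 ger0_norm.
have rt t : r <= t <= 0 -> `|t| <= `|r|.
  by move=> /andP[t0 tr]; rewrite !ler0_norm ?(ltW r0)// lerN2.
have := mean_value cp (ltW r0) (fun t h => uu' t (rt t h)) (fun t h => u'M t (rt t h)).
by rewrite sub0r (seminormBC cp.1) ltr0_norm.
Qed.

(** The mean value inequality, used twice. The constant is [M] and not [M / 2]; only the order in
    [r] matters later. *)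
Lemma taylor1 E (p : E -> R) (u u' u'' : R -> E) (r M : R) : cont_seminorm p ->
  (forall t, `|t| <= `|r| -> is_curve_derive u t (u' t)) ->
  (forall t, `|t| <= `|r| -> is_curve_derive u' t (u'' t)) ->
  (forall t, `|t| <= `|r| -> p (u'' t) <= M) ->
  p (u r - u 0 - r *: u' 0) <= M * r ^+ 2.
Proof.
move=> cp uu' u'u'' u''M; pose v t := u t - t *: u' 0.
have -> : u r - u 0 - r *: u' 0 = v r - v 0.
  by rewrite /v scale0r subr0 addrAC.
rewrite -real_normK ?num_real// expr2 mulrA.
apply: (mean_value_abs (u' := fun t => u' t - u' 0)) => // t tr.
  apply: curve_deriveB; first exact: uu'.
  by have := curve_deriveZ (curve_derive_id t) (curve_derive_cst (u' 0) t);
    rewrite scaler0 addr0 scale1r.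
have M0 : 0 <= M by apply: le_trans (u''M _ tr); exact: (seminorm_ge0 cp.1).
apply: (@le_trans _ _ (M * `|t|)); last by rewrite ler_wpM2l.
apply: (@mean_value_abs _ p u' u'' t M cp) => s st; [apply: u'u''|apply: u''M];
  exact: le_trans tr.
Qed.

(** This is [taylor1] for [u] minus its quadratic part, a curve whose second derivative is
    [u'' t - u'' 0]. *)
Lemma taylor2 E (p : E -> R) (u u' u'' : R -> E) (r e : R) : cont_seminorm p ->
  (forall t, `|t| <= `|r| -> is_curve_derive u t (u' t)) ->
  (forall t, `|t| <= `|r| -> is_curve_derive u' t (u'' t)) ->
  (forall t, `|t| <= `|r| -> p (u'' t - u'' 0) <= e) ->
  p (u r - u 0 - r *: u' 0 - (r ^+ 2 / 2) *: u'' 0) <= e * r ^+ 2.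
Proof.
move=> cp uu' u'u'' u''e.
pose v t := u t - (t ^+ 2 / 2) *: u'' 0; pose v' t := u' t - t *: u'' 0.
have -> : u r - u 0 - r *: u' 0 - (r ^+ 2 / 2) *: u'' 0 = v r - v 0 - r *: v' 0.
  rewrite /v /v' expr0n /= mul0r !scale0r !subr0.
  by rewrite addrAC [u r - _ - _]addrAC -!addrA; congr (_ + _); rewrite addrA addrC addrA.
apply: (taylor1 (u' := v') (u'' := fun t => u'' t - u'' 0)) => // t tr.
  apply: curve_deriveB; first exact: uu'.
  have h : is_curve_derive (fun t : R => t ^+ 2 / 2) t t.
    have := @curve_derive_scale _ R 2^-1 _ _ _
      (@curve_deriveZ _ R _ _ _ _ _ (curve_derive_id t) (curve_derive_id t)).
    have -> : 2^-1 *: ((1 : R) *: t + t *: (1 : R)) = t.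
      by rewrite scale1r [t *: _]mulr1 -[_ *: _]/(_ * _); lra.
    by apply: curve_derive_eq => s; rewrite -[_ *: _]/(_ * (_ * _)) expr2 mulrC.
  by have := curve_deriveZ h (curve_derive_cst (u'' 0) t); rewrite scaler0 addr0.
apply: curve_deriveB; first exact: u'u''.
by have := curve_deriveZ (curve_derive_id t) (curve_derive_cst (u'' 0) t);
  rewrite scaler0 addr0 scale1r.
Qed.

Definition generating {E} (p : nat -> E -> R) : Prop :=
  (forall i, seminorm (p i)) /\
  forall (x : E) (U : set E), nbhs x U <->
    exists (n : nat) (r : R), 0 < r /\
      forall y, (forall i, (i <= n)%N -> p i (y - x) < r) -> U y.

Lemma generating_cont E (p : nat -> E -> R) i : generating p -> cont_seminorm (p i).
Proof.
move=> [sp np]; split=> // e e0; apply/np; exists i, e; split=> // y.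
by move/(_ i (leqnn i)); rewrite subr0.
Qed.

Lemma generating_cvg E (p : nat -> E -> R) (T : Type) (F : set_system T) (f : T -> E) l :
  Filter F -> generating p ->
  (forall i e, 0 < e -> \forall x \near F, p i (f x - l) < e) -> f @ F --> l.
Proof.
move=> FF [sp np] H A /np[n [r [r0 rA]]].
suff : \forall x \near F, forall i, (i <= n)%N -> p i (f x - l) < r.
  by apply: filterS => x; exact: rA.
elim: n {rA} => [|n IHn].
  by apply: filterS (H 0%N _ r0) => x pr i; rewrite leqn0 => /eqP->.
apply: filterS2 IHn (H n.+1 _ r0) => x h1 h2 i.
by rewrite leq_eqVlt => /orP[/eqP->//|]; rewrite ltnS; exact: h1.
Qed.

Lemma norm_seminorm : seminorm (fun x : R => `|x|).
Proof. split; [exact: ler_normD|exact: normrM]. Qed.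

Lemma generating_real : generating (fun (_ : nat) (x : R) => `|x|).
Proof.
split=> [_|x U]; first exact: norm_seminorm.
split=> [[e/= e0 eU]|[n [r [r0 rU]]]].
  by exists 0%N, e; split=> // y /(_ 0%N (leqnn _)) xy; apply: eU; rewrite /= distrC.
by exists r => //= y /= xy; apply: rU => i _; rewrite distrC.
Qed.

Lemma generating_prod E F (p : nat -> E -> R) (q : nat -> F -> R) :
  generating p -> generating q -> generating (fun i (z : E * F) => p i z.1 + q i z.2).
Proof.
move=> gp gq; have [sp np] := gp; have [sq nq] := gq; split=> [i|[x y] U].
  split=> [a b|a b] /=.
    by rewrite addrACA lerD// ?(sp i).1 ?(sq i).1.
  by rewrite (sp i).2 (sq i).2 mulrDr.
split=> [[[A B] [/= /np[n [r [r0 rA]]] /nq[m [s [s0 sB]]]] ABU]|[n [r [r0 rU]]]].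
  exists (maxn n m), (Num.min r s); split; first by rewrite lt_min r0.
  move=> [a b] /= H; apply: ABU; split=> /=.
    apply: rA => i ni; have := H i (leq_trans ni (leq_maxl _ _)).
    by rewrite lt_min => /andP[h _]; apply: le_lt_trans h; rewrite lerDl (seminorm_ge0 (sq i)).
  apply: sB => i ni; have := H i (leq_trans ni (leq_maxr _ _)).
  by rewrite lt_min => /andP[_ h]; apply: le_lt_trans h; rewrite lerDr (seminorm_ge0 (sp i)).
have r20 : 0 < r / 2 by rewrite divr_gt0.
exists ([set a | forall i, (i <= n)%N -> p i (a - x) < r / 2],
        [set b | forall i, (i <= n)%N -> q i (b - y) < r / 2]).
  by split; [apply/np|apply/nq]; exists n, (r / 2).
move=> [a b] [/= ha hb]; apply: rU => i ni /=.
by rewrite [ltRHS]splitr ltrD ?ha ?hb.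
Qed.

(** This class contains the real line and is closed under finite products. The calculus thus applies
    at once to [E * E * E], where the metric and the connection are jointly smooth, and to [R * R],
    where variations are parametrized. *)
Definition metrizable_lcs E : Prop :=
  hausdorff_space E /\ exists p : nat -> E -> R, generating p.

Lemma frechet_metrizable E : frechet_space E -> metrizable_lcs E.
Proof. by move=> [hE [p [sp np _]]]; split=> //; exists p; split. Qed.

Lemma hausdorff_real : hausdorff_space R.
Proof. exact: (@norm_hausdorff R R^o). Qed.

Lemma metrizable_real : metrizable_lcs R.
Proof.
by split; [exact: hausdorff_real|exists (fun _ x => `|x|); exact: generating_real].
Qed.

Lemma hausdorff_prod E F :
  hausdorff_space E -> hausdorff_space F -> hausdorff_space (E * F)%type.
Proof.
move=> hE hF [a b] [c d] H; congr (_, _).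
  apply: hE => A B Aa Bc.
  have h1 : nbhs (a, b) (A `*` setT) by exists (A, setT) => //; split=> //; exact: filterT.
  have h2 : nbhs (c, d) (B `*` setT) by exists (B, setT) => //; split=> //; exact: filterT.
  by have [[x y] [/= [Ax _] [Bx _]]] := H _ _ h1 h2; exists x.
apply: hF => A B Aa Bc.
have h1 : nbhs (a, b) (setT `*` A) by exists (setT, A) => //; split=> //; exact: filterT.
have h2 : nbhs (c, d) (setT `*` B) by exists (setT, B) => //; split=> //; exact: filterT.
by have [[x y] [/= [_ Ax] [_ Bx]]] := H _ _ h1 h2; exists y.
Qed.

Lemma metrizable_prod E F :
  metrizable_lcs E -> metrizable_lcs F -> metrizable_lcs (E * F)%type.
Proof.
move=> [hE [p gp]] [hF [q gq]]; split; first exact: hausdorff_prod.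
by eexists; exact: generating_prod gp gq.
Qed.

End Seminorms.

(** * Curves through rapidly converging points *)

Section GeneralCurve.
Context {R : realType} {E : tvsType R} (p : nat -> E -> R).
Hypotheses (hE : hausdorff_space E) (gp : generating p).

(** The times at which the curve meets the prescribed points. They accumulate at 0 and each is half
    of the preceding one, so the room around [node n] is proportional to [node n]. *)
Definition node (n : nat) : R := 2^-1 ^+ n.
(* [1 / rate n] is an eighth of [node n], which keeps the supports of the pieces
   centred at distinct nodes disjoint. *)
Definition rate (n : nat) : R := 2 ^+ n.+3.

Lemma node_gt0 n : 0 < node n.
Proof. by rewrite /node exprn_gt0// invr_gt0. Qed.

Lemma rate_gt0 n : 0 < rate n.
Proof. by rewrite /rate exprn_gt0. Qed.

Lemma rate_node n : rate n = 8 / node n.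
Proof.
rewrite /rate /node exprVn invrK -[n.+3]/(3 + n)%N exprD; congr (_ * _).
by rewrite !exprS expr0; ring.
Qed.

Lemma node_le m n : (m <= n)%N -> node n <= node m.
Proof.
move=> mn; rewrite /node; apply: ler_wiXn2l => //; lra.
Qed.

Lemma node_ltn m n : (m < n)%N -> 2 * node n <= node m.
Proof.
move=> mn; apply: le_trans (_ : 2 * node m.+1 <= _).
  by rewrite ler_pM2l//; exact: node_le.
by rewrite /node exprS mulrA divff ?mul1r.
Qed.

Lemma node_sum N : \sum_(n < N) node n <= 2.
Proof.
suff : \sum_(n < N) node n = 2 - 2 * node N by move=> ->; have := node_gt0 N; lra.
elim: N => [|N IHN]; first by rewrite big_ord0 /node expr0; ring.
by rewrite big_ord_recr /= IHN /node exprS; field.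
Qed.

Lemma node_small (e : R) : 0 < e -> exists N, forall n, (N <= n)%N -> node n < e.
Proof.
move=> e0; have : (fun n => 2^-1 ^+ n : R) @ \oo --> (0 : R).
  by apply: cvg_expr; rewrite ger0_norm; lra.
move=> /(@cvgrPdist_lt _ R^o) /(_ _ e0) [N _ H]; exists N => n Nn.
have := H n Nn; rewrite /= sub0r normrN ger0_norm//; exact/ltW/node_gt0.
Qed.

(** A derivative vanishes where the function vanishes on an open set; on the remaining compact
    interval it is continuous and attains a maximum. *)
Lemma bump_bounded (f : R -> R) k : (forall n, nderivable n setT f) ->
  (forall x, 2 <= `|x| -> f x = 0) ->
  [/\ exists2 B : R, 0 < B & forall x : R, `|iter k curve_derive f x| <= B
    & forall x, 2 < `|x| -> iter k curve_derive f x = 0].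
Proof.
move=> nf f0.
have sf : smooth_curve setT f.
  exact/(smooth_curveP _ hausdorff_real openT).
have oU : open [set x : R | 2 < `|x|].
  have -> : [set x : R | 2 < `|x|] = [set x | x > 2] `|` [set x | x < - 2].
    by apply/seteqP; split=> x /=; rewrite ltr_normr ltrNr => /orP.
  by apply: openU; [exact: open_gt|exact: open_lt].
have fU x : 2 < `|x| -> iter k curve_derive f x = 0.
  move=> x2; rewrite (@iter_curve_derive_eq _ R _ _ (fun=> 0) _ _ oU x2).
    elim: k x {x2} => [//|k IHk] x; rewrite iterS.
    apply: curve_derive_val; first exact: hausdorff_real.
    by apply: curve_derive_eq (curve_derive_cst (0 : R) x) => r; rewrite IHk.
  by move=> r /= /ltW; exact: f0.
split=> //.
have cf : {within `[-2, 2 : R], continuous (fun x => `|iter k curve_derive f x|)}.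
  apply: continuous_subspaceT => x; apply: (@continuous_comp _ _ _ (iter k curve_derive f) Num.norm).
    exact: (curve_derive_continuous (curve_derivableP (sf k x I))).
  exact: (@norm_continuous R R^o).
have m22 : -2 <= 2 :> R by lra.
have [c _ cM] := EVT_max m22 cf.
exists (`|iter k curve_derive f c| + 1); first by rewrite ltr_wpDl.
move=> x; have [x2|x2] := ltP 2 `|x|.
  by rewrite fU// normr0 addr_ge0.
by rewrite ler_wpDr// cM// in_itv /= -ler_norml.
Qed.

(** Fast convergence: [rate n ^- n] outweighs, for every fixed [k], the factor [rate n ^+ k] that
    [k] differentiations of a rescaled bump produce. *)
Context (z w : nat -> E).
Hypotheses (hz : forall i n, (i <= n)%N -> p i (z n) <= rate n ^- n)
           (hw : forall i n, (i <= n)%N -> p i (w n) <= rate n ^- n).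

(** At [node n] the curve [piece 0 n] has value [z n] and velocity [rate n *: w n], supplied by
    [bump] and [bump_id] respectively; [piece k n] is its [k]-th derivative in closed form. *)
Let piece (k n : nat) (t : R) : E := rate n ^+ k *:
  (iter k curve_derive bump (rate n * t + - (rate n * node n)) *: z n +
   iter k curve_derive bump_id (rate n * t + - (rate n * node n)) *: w n).

Let bumpP k := bump_bounded k nderivable_bump bump0.
Let bump_idP k := bump_bounded k nderivable_bump_id bump_id0.

Let piece_derive k n t : is_curve_derive (piece k n) t (piece k.+1 n t).
Proof.
have smooth (f : R -> R) : (forall n, nderivable n setT f) ->
    is_curve_derive (fun r => iter k curve_derive f (rate n * r + - (rate n * node n))) t
      (rate n * iter k.+1 curve_derive f (rate n * t + - (rate n * node n))).
  move=> nf; have sf : smooth_curve setT f.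
    exact/(smooth_curveP _ hausdorff_real openT).
  apply: (@curve_derive_comp _ R (iter k curve_derive f) (fun r => rate n * r + - (rate n * node n))).
    rewrite -[X in is_curve_derive _ _ X]addr0; apply: curve_deriveD; last exact: curve_derive_cst.
    have := @curve_derive_scale _ R (rate n) _ _ _ (curve_derive_id t).
    by rewrite [_ *: _]mulr1.
  exact/curve_derivableP/sf.
rewrite /piece exprSr -scalerA; apply: curve_derive_scale.
rewrite scalerDr !scalerA; apply: curve_deriveD.
  have := curve_deriveZ (smooth _ nderivable_bump) (curve_derive_cst (z n) t).
  by rewrite scaler0 addr0.
have := curve_deriveZ (smooth _ nderivable_bump_id) (curve_derive_cst (w n) t).
by rewrite scaler0 addr0.
Qed.

(** The profiles vanish beyond distance 2 from 0; after scaling by [rate n], which is [8 / node n],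
    this is distance [node n / 4] from [node n]. *)
Let piece0 k n t : node n / 4 < `|t - node n| -> piece k n t = 0.
Proof.
move=> h; have h2 : 2 < `|rate n * t + - (rate n * node n)|.
  have n0 := node_gt0 n.
  rewrite -mulrBr normrM gtr0_norm ?rate_gt0// rate_node -mulrA mulrCA ltr_pdivlMl//.
  by lra.
by rewrite /piece (bumpP k).2// (bump_idP k).2// !scale0r addr0 scaler0.
Qed.

(** For [n >= k + 3] the scalar [rate n ^+ k * rate n ^- n] is at most [node n ^+ 3]. On the support
    [node n <= 2 * t], so two of the three powers are traded for [(2 * t) ^+ 2], while the third
    remains to make the series summable. The constant 8 is 2, for the two summands, times 4. *)
Let piece_le k i n t B : (maxn i (k + 3) <= n)%N -> 0 < B ->
  (forall x, `|iter k curve_derive bump x| <= B) ->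
  (forall x, `|iter k curve_derive bump_id x| <= B) ->
  p i (piece k n t) <= 8 * B * t ^+ 2 * node n.
Proof.
move=> /[!geq_max]/andP[ni nk] B0 b1 b2; have sp := gp.1 i.
have n0 := node_gt0 n; have r0 := rate_gt0 n.
have [h|h] := ltP (node n / 4) `|t - node n|.
  rewrite piece0// (seminorm0 sp) mulr_ge0 ?(ltW n0)//; apply: mulr_ge0; last exact: sqr_ge0.
  by rewrite mulr_ge0// ltW.
have nt : node n <= 2 * t by move: h; rewrite ler_distl => /andP[+ _]; lra.
have t0 : 0 < t by lra.
rewrite (seminormZ sp) gtr0_norm ?exprn_gt0//.
have h1 : p i (iter k curve_derive bump (rate n * t + - (rate n * node n)) *: z n +
   iter k curve_derive bump_id (rate n * t + - (rate n * node n)) *: w n) <= 2 * B * rate n ^- n.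
  apply: le_trans (seminorm_triangle sp _ _) _; rewrite !(seminormZ sp).
  have -> : 2 * B * rate n ^- n = B * rate n ^- n + B * rate n ^- n by ring.
  by rewrite lerD// ler_pM// ?(seminorm_ge0 sp)// ?hz ?hw.
apply: le_trans (ler_wpM2l (ltW (exprn_gt0 k r0)) h1) _.
have h2 : rate n ^+ k * rate n ^- n <= node n ^+ 3.
  have -> : rate n ^+ k * rate n ^- n = (rate n)^-1 ^+ (n - k).
    rewrite -exprVn [X in _ * _ ^+ X](_ : n = (k + (n - k))%N); last first.
      by rewrite subnKC// (leq_trans (leq_addr _ _) nk).
    by rewrite exprD mulrA -exprMn divff ?gt_eqF// expr1n mul1r.
  have rn : (rate n)^-1 <= node n by rewrite rate_node invf_div; lra.
  apply: (@le_trans _ _ (node n ^+ (n - k))); first by apply: lerXn2r => //; rewrite nnegrE ?invr_ge0 ltW.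
  have n1 : node n <= 1 by have := node_le (leq0n n); rewrite {2}/node expr0.
  apply: ler_wiXn2l => //; first exact: ltW.
  by rewrite leq_subRL ?(leq_trans (leq_addr _ _) nk)// addnC addnC.
have -> : rate n ^+ k * (2 * B * rate n ^- n) = 2 * B * (rate n ^+ k * rate n ^- n) by ring.
apply: (@le_trans _ _ (2 * B * node n ^+ 3)); first by rewrite ler_pM2l ?mulr_gt0.
have -> : 2 * B * node n ^+ 3 = 2 * B * node n * node n ^+ 2 by ring.
have -> : 8 * B * t ^+ 2 * node n = 2 * B * node n * (2 * t) ^+ 2 by ring.
by rewrite ler_pM2l ?mulr_gt0// lerXn2r ?nnegrE// ltW// mulr_gt0.
Qed.

(** In place of a convergent series, the sum is finite at every [t] and locally finite off 0. The
    number [nb t] below is any admissible truncation, and [totalE] shows that its choice does not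
    matter. *)
Let cut (t : R) (N : nat) := forall n k, (N <= n)%N -> piece k n t = 0.

Let cut_le0 t : t <= 0 -> cut t 0.
Proof.
move=> t0 n k _; apply: piece0; have := node_gt0 n => n0.
by rewrite ltr0_norm; lra.
Qed.

Let cut_near t : t != 0 -> exists N, \forall r \near t, cut r N.
Proof.
move=> tn0; have [t0|t0] := ltP t 0.
  by exists 0%N; apply: filterS (lt_nbhsl t0) => r /ltW; exact: cut_le0.
have {tn0}t0 : 0 < t by rewrite lt_neqAle eq_sym tn0.
have t20 : 0 < t / 3 by rewrite divr_gt0.
have [N H] := node_small t20; exists N.
have : t / 2 < t by lra.
move/lt_nbhsr; apply: filterS => r tr n k /H nt; apply: piece0.
by rewrite gtr0_norm; lra.
Qed.

Let nb (t : R) : nat := xget 0%N [set N | cut t N].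

Let cut_nb t : cut t (nb t).
Proof.
rewrite /nb; case: xgetP => [N _ //|H].
have [t0|t0] := eqVneq t 0; first by apply: (H 0%N); apply: cut_le0; rewrite t0.
by have [N /nbhs_singleton cN] := cut_near t0; have := H _ cN.
Qed.

Let total (k : nat) (t : R) : E := \sum_(n < nb t) piece k n t.

Let cut_sum k t N M : cut t N -> (N <= M)%N ->
  \sum_(n < M) piece k n t = \sum_(n < N) piece k n t.
Proof.
move=> cN NM; rewrite -(subnKC NM) big_split_ord /= [X in _ + X]big1 ?addr0//.
by move=> i _; rewrite cN// leq_addr.
Qed.

Let totalE k t N : cut t N -> total k t = \sum_(n < N) piece k n t.
Proof.
move=> cN; rewrite /total; have [h|h] := leqP N (nb t).
  exact: cut_sum.
by apply/esym/cut_sum; [exact: cut_nb|exact: ltnW].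
Qed.

Let total0 k : total k 0 = 0.
Proof. by rewrite (totalE _ (cut_le0 (lexx 0))) big_ord0. Qed.

(** Pieces of index at least [m] obey [piece_le], and the weights [node n] add up to at most 2,
    whence [16 * B]. The finitely many pieces of index below [m] vanish as soon as
    [t < node m / 2]. *)
Let total_le k i : exists2 B, 0 < B & \forall t \near (0 : R), p i (total k t) <= B * t ^+ 2.
Proof.
have [[B1 B10 b1] _] := bumpP k; have [[B2 B20 b2] _] := bump_idP k.
pose B := B1 + B2; have B0 : 0 < B by rewrite addr_gt0.
have {}b1 x : `|iter k curve_derive bump x| <= B by rewrite (le_trans (b1 _))// lerDl ltW.
have {}b2 x : `|iter k curve_derive bump_id x| <= B by rewrite (le_trans (b2 _))// lerDr ltW.
exists (16 * B); first by rewrite mulr_gt0.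
have sp := gp.1 i; pose m := maxn i (k + 3).
have m0 : 0 < node m / 2 by rewrite divr_gt0// node_gt0.
apply: filterS (lt_nbhsl m0) => t tm.
apply: le_trans (seminorm_sum sp _) _.
apply: (@le_trans _ _ (\sum_(n < nb t) 8 * B * t ^+ 2 * node n)); last first.
  rewrite -mulr_sumr; have -> : 16 * B * t ^+ 2 = 8 * B * t ^+ 2 * 2 by ring.
  apply: ler_wpM2l; last exact: node_sum.
  by apply: mulr_ge0; [rewrite mulr_ge0// ltW|exact: sqr_ge0].
apply: ler_sum => n _; have [mn|nm] := leqP m n; first exact: piece_le.
rewrite piece0 ?(seminorm0 sp).
  apply: mulr_ge0; last exact/ltW/node_gt0.
  by apply: mulr_ge0; [rewrite mulr_ge0// ltW|exact: sqr_ge0].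
have := node_le (ltnW nm); have := node_gt0 n; have := node_gt0 m => h1 h2 h3.
by rewrite ltr0_norm; lra.
Qed.

(** Off 0 the sum is locally finite and is differentiated termwise. At 0 the quadratic bound sends
    the difference quotient to 0, which is the value of [total k.+1] there. *)
Let total_derive k t : is_curve_derive (total k) t (total k.+1 t).
Proof.
have [->|t0] := eqVneq t 0; last first.
  have [N cN] := cut_near t0.
  rewrite (totalE _ (nbhs_singleton cN)).
  apply: (@curve_derive_near _ _ (fun r => \sum_(n < N) piece k n r)).
    by apply: filterS cN => r cr; rewrite (totalE _ cr).
  elim: N {cN} => [|N IHN].
    by rewrite big_ord0; apply: curve_derive_eq (curve_derive_cst 0 t) => r; rewrite big_ord0.
  have := curve_deriveD IHN (@piece_derive k N t).
  by congr is_curve_derive; [apply/funext => r|]; rewrite big_ord_recr.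
rewrite total0; apply: (generating_cvg _ gp) => i e e0.
have [B B0 H] := total_le k i.
rewrite near_withinE; near=> h => h0.
rewrite addr0 total0 !subr0 (seminormZ (gp.1 i)).
have hB : p i (total k h) <= B * h ^+ 2 by near: h.
rewrite normrV ?unitfE// ltr_pdivrMl ?normr_gt0//.
apply: le_lt_trans hB _; rewrite -real_normK ?num_real// expr2 mulrA mulrC ltr_pM2l ?normr_gt0//.
by rewrite -ltr_pdivlMl//; near: h; apply: (@nbhs0_lt R R^o); rewrite mulr_gt0// invr_gt0.
Unshelve. all: by end_near. Qed.

(** A form of the general curve lemma of convenient calculus. Near [node n] the curve is a straight
    line through [x + z n], run at the unbounded rate [rate n]; a single smooth curve therefore
    probes infinitely many points and directions near [x]. *)
Lemma general_curve (x : E) : exists b : R -> E,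
  [/\ smooth_curve setT b, b 0 = x &
      forall n t, `|t - node n| < (rate n)^-1 ->
        b t = x + z n + (rate n * (t - node n)) *: w n].
Proof.
exists (fun t => x + total 0 t); split.
- apply/smooth_curveP => //; first exact: openT.
  move=> n; apply: nderivableD; first exact: nderivable_cst.
  elim: n 0%N => [//|n IHn] k; exists (total k.+1) => // t _; exact: total_derive.
- by rewrite total0 addr0.
move=> n t tn.
have n0 := node_gt0 n; have r0 := rate_gt0 n.
have tn8 : `|t - node n| < node n / 8 by move: tn; rewrite rate_node invf_div.
have [tn1 tn2] : node n - node n / 8 < t /\ t < node n + node n / 8.
  by apply/andP; rewrite -ltr_distl.
rewrite -addrA; congr (_ + _).
have other m : m != n -> piece 0 m t = 0.
  move=> mn; apply: piece0; have m0 := node_gt0 m.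
  move: mn; rewrite neq_ltn => /orP[/node_ltn|/node_ltn] h.
    by rewrite ltr0_norm; lra.
  by rewrite gtr0_norm; lra.
have cN : cut t n.+1.
  move=> m k nm; apply: piece0; have m0 := node_gt0 m.
  have := node_ltn nm => h; by rewrite gtr0_norm; lra.
rewrite (totalE _ cN) big_ord_recr /= big1 ?add0r; last first.
  by move=> i _; apply: other; rewrite ltn_eqF.
rewrite /piece expr0 scale1r /=.
have h1 : `|rate n * t + - (rate n * node n)| <= 1.
  by rewrite -mulrBr normrM gtr0_norm// -ler_pdivlMl// mulr1 ltW.
by rewrite bump1// bump_id_eq// scale1r mulrBr.
Qed.

End GeneralCurve.

(** * Directional derivatives of smooth maps *)

Lemma subrACAB (V : zmodType) (x y z t : V) : x - y - (z - t) = x - z - (y - t).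
Proof. by rewrite !opprB addrACA [RHS]addrACA [- y - z]addrC. Qed.

Lemma differenceE (V : zmodType) (d2 d1 m x1 x2 : V) :
  d2 - d1 - m = (d2 - x2) - (d1 - x1) + (x2 - x1 - m).
Proof. by rewrite subrACAB addrA subrK. Qed.

(** For $f_2,f_0,f_1,f_3$ the values at $y$, $y+hv$, $y+hw$, $y+hv+hw$, the second difference is a
    combination of the second-order Taylor remainders in the directions $v+w$, $v$ and $w$: the
    first-order terms cancel because the one for $v+w$ is $a+b$. *)
Lemma second_differenceE (R : realType) (V : lmodType R) (f0 f1 f2 f3 a b d k l : V)
    (h s : R) :
  f3 - f0 - (f1 - f2) - s *: (d - k - l) =
  (f3 - f2 - h *: (a + b) - s *: d) - (f0 - f2 - h *: a - s *: k) -
    (f1 - f2 - h *: b - s *: l).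
Proof.
rewrite (subrACAB (f3 - f2 - h *: (a + b)) (s *: d) (f0 - f2 - h *: a) (s *: k)).
rewrite (subrACAB (f3 - f2) (h *: (a + b)) (f0 - f2) (h *: a)).
rewrite (subrACAB f3 f2 f0 f2) subrr subr0 -[h *: (a + b) - _]scalerBr.
rewrite (_ : a + b - a = b); last by rewrite addrAC subrr add0r.
rewrite (subrACAB (f3 - f0 - h *: b) (s *: d - s *: k) (f1 - f2 - h *: b) (s *: l)).
by rewrite (subrACAB (f3 - f0) (h *: b) (f1 - f2) (h *: b)) subrr subr0 -!scalerBr.
Qed.

Section DirectionalDerivatives.
Context {R : realType} {E F : tvsType R}.
Hypotheses (mE : metrizable_lcs E) (mF : metrizable_lcs F).

(** Only the diagonal value $D^nf(x)(v,\dots,v)$, which is a derivative of a curve; [mixedD] later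
    recovers the mixed second derivative from it. *)
Definition ndirD (n : nat) (f : E -> F) (x v : E) : F :=
  iter n curve_derive (fun r : R => f (x + r *: v)) 0.

Lemma ndirD0 f x v : ndirD 0 f x v = f x.
Proof. by rewrite /ndirD /= scale0r addr0. Qed.

Context (U : set E) (f : E -> F).
Hypotheses (oU : open U) (sf : conv_smooth U f).

Lemma line_continuous (x v : E) : continuous (fun r : R => x + r *: v).
Proof.
move=> r; apply: tvs_cvgD; first exact: cvg_cst.
by apply: tvs_cvgZ; [exact: cvg_id|exact: cvg_cst].
Qed.

Lemma nderivable_line n (I : set R) (x v : E) : nderivable n I (fun r : R => x + r *: v).
Proof.
apply: nderivableD; first exact: nderivable_cst.
by apply: nderivableZ; [exact: nderivable_id|exact: nderivable_cst].
Qed.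

Lemma line_open (x v : E) : open [set r : R | U (x + r *: v)].
Proof. by apply: (@open_comp _ _ (fun r : R => x + r *: v)) => // r _; exact: line_continuous. Qed.

Lemma line_smooth (x v : E) :
  smooth_curve [set r : R | U (x + r *: v)] (fun r : R => f (x + r *: v)).
Proof.
apply: (@conv_smooth_curve _ _ _ _ f _ (fun r : R => x + r *: v) mE.1 sf) => //.
  exact: line_open.
apply/(smooth_curveP _ mE.1); first exact: line_open.
by move=> n; exact: nderivable_line.
Qed.

Lemma ndirD_line n (x v : E) (r : R) : U (x + r *: v) ->
  iter n curve_derive (fun s : R => f (x + s *: v)) r = ndirD n f (x + r *: v) v.
Proof.
move=> Uxr.
have := @iter_curve_derive_affine _ _ _ (fun s : R => f (x + s *: v)) 1 r n 0 mF.1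
  (@line_open x v) _ (@line_smooth x v).
rewrite mulr0 add0r expr1n scale1r => <-//; congr (iter n _ _ _).
by apply/funext => s; rewrite mul1r scalerDl addrAC addrA.
Qed.

Lemma ndirDZ n (x v : E) (a : R) : U x ->
  ndirD n f x (a *: v) = a ^+ n *: ndirD n f x v.
Proof.
move=> Ux.
have := @iter_curve_derive_affine _ _ _ (fun s : R => f (x + s *: v)) a 0 n 0 mF.1
  (@line_open x v) _ (@line_smooth x v).
rewrite mulr0 add0r => <-; last by rewrite /= scale0r addr0.
by congr (iter n _ _ _); apply/funext => s; rewrite addr0 scalerA mulrC.
Qed.

Lemma ndirD_derive n (x v : E) (r : R) : U (x + r *: v) ->
  is_curve_derive (fun s => ndirD n f (x + s *: v) v) r (ndirD n.+1 f (x + r *: v) v).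
Proof.
move=> Uxr; rewrite -ndirD_line//.
have := curve_derivableP (@line_smooth x v n r Uxr).
apply: curve_derive_near; apply: (open_near (@line_open x v) Uxr) => s Us.
exact: ndirD_line.
Qed.

(* Were the derivatives unbounded, a smooth curve through the bad points with
   the bad directions as velocities would contradict smoothness along curves. *)
Lemma ndirD_bounded n (x : E) (p : F -> R) : U x -> cont_seminorm p ->
  exists A B : set E, exists C : R, [/\ nbhs x A, nbhs 0 B, 0 < C, A `<=` U &
    forall y w, A y -> B w -> p (ndirD n f y w) <= C].
Proof.
move=> Ux cp; have [hE [q gq]] := mE; have sp := cp.1.
(* The radius [rate k ^- k] is the decay that [general_curve] asks of its data, so every choice of
   points in [A k] and directions in [B k] is admissible. *)
pose A k := [set y : E | (forall i, (i <= k)%N -> q i (y - x) < rate k ^- k) /\ U y].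
pose B k := [set w : E | forall i, (i <= k)%N -> q i (w - 0) < rate k ^- k].
have r0 k : 0 < rate k ^- k :> R by rewrite invr_gt0 exprn_gt0// rate_gt0.
have nA k : nbhs x (A k).
  apply: filterI; last exact: open_nbhs_nbhs.
  by apply/(gq.2); exists k, (rate k ^- k).
have nB k : nbhs 0 (B k) by apply/(gq.2); exists k, (rate k ^- k).
apply: contrapT => H.
have bad k : exists yw : E * E,
    [/\ A k yw.1, B k yw.2 & k.+1%:R < p (ndirD n f yw.1 yw.2)].
  apply: contrapT => K; apply: H; exists (A k), (B k), k.+1%:R.
  split=> //; first by move=> y [].
  by move=> y w Ay Bw; rewrite leNgt; apply/negP => lt; apply: K; exists (y, w).
have [yw /all_and3[Ay Bw big]] := choice bad.
have [||b [sb b0 bE]] := @general_curve _ _ q hE gq (fun k => (yw k).1 - x) (fun k => (yw k).2) _ _ x.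
- by move=> i k ik; apply: ltW; exact: (Ay k).1.
- by move=> i k ik; apply: ltW; have := Bw k i ik; rewrite subr0.
have bc : continuous b.
  by move=> t; exact: (curve_derive_continuous (curve_derivableP (sb 0%N t I))).
have oJ : open (b @^-1` U) by apply: (@open_comp _ _ b) => // t _; exact: bc.
have sfb : smooth_curve (b @^-1` U) (f \o b).
  apply: (@conv_smooth_curve _ _ _ _ f _ b mE.1 sf) => //.
  by move=> m t _; exact: sb.
have J0 : (b @^-1` U) 0 by rewrite /= b0.
pose u := iter n curve_derive (f \o b).
have uc : {for 0, continuous u} := curve_derive_continuous (curve_derivableP (sfb n 0 J0)).
have [d /= d0 dH] : \forall t \near (0 : R), (b @^-1` U) t /\ p (u t - u 0) < 1.
  apply: filterI; first exact: open_nbhs_nbhs.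
  exact: (cont_seminorm_cvg _ cp uc ltr01).
have [N HN] := node_small d0.
have [k Nk uk] : exists2 k, (N <= k)%N & p (u 0) + 1 < k.+1%:R.
  have pu0 : 0 <= p (u 0) + 1 by rewrite addr_ge0// (seminorm_ge0 sp).
  exists (maxn N (Num.truncn (p (u 0) + 1))); first exact: leq_maxl.
  apply: lt_le_trans (truncnS_gt _) _.
  by rewrite ler_nat ltnS leq_maxr.
have [Jk uk1] : (b @^-1` U) (node k) /\ p (u (node k) - u 0) < 1.
  by apply: dH; rewrite /= sub0r normrN gtr0_norm ?node_gt0// HN.
(* Around [node k] the curve is a line run at rate [rate k], so every derivative brings a factor
   [rate k]. This factor is at least 1 and can only enlarge the bad value. *)
have ukE : u (node k) = rate k ^+ n *: ndirD n f (yw k).1 (yw k).2.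
  pose J := ball (node k : R^o) (rate k)^-1.
  have rk0 : 0 < rate k :> R := rate_gt0 k.
  have Jn : J (node k) by apply: ballxx; rewrite invr_gt0.
  rewrite /u (@iter_curve_derive_eq _ _ J _ (fun t : R => f ((yw k).1 + (rate k * t + - (rate k * node k)) *: (yw k).2)))//.
  - rewrite (@iter_curve_derive_affine _ _ _ (fun s : R => f ((yw k).1 + s *: (yw k).2)) _ _ n _ mF.1 (@line_open _ _) _ (@line_smooth _ _)).
      by rewrite subrr.
    by rewrite /= subrr scale0r addr0; exact: (Ay k).2.
  - exact: ball_open.
  move=> t Jt /=; rewrite (bE k); last by rewrite distrC.
  by rewrite subrKC mulrBr.
have := lt_trans uk (big k); apply/negP; rewrite -leNgt.
apply: (@le_trans _ _ (p (u (node k)))).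
  rewrite ukE (seminormZ sp) gtr0_norm ?exprn_gt0 ?rate_gt0//.
  rewrite ler_peMl ?(seminorm_ge0 sp)//; apply: exprn_ege1.
  by rewrite /rate exprn_ege1// ler1n.
rewrite -(subrK (u 0) (u (node k))); apply: le_trans (seminorm_triangle sp _ _) _.
by rewrite addrC lerD2l ltW.
Qed.

(** The mean value inequality on a segment, with the bound [C] on first derivatives from
    [ndirD_bounded]. By homogeneity, shrinking the directions by [e / C] turns [C] into [e]; the
    radii [r / 2] keep the segment inside [A]. *)
Lemma conv_smooth_lipschitz (x : E) (p : F -> R) (e : R) : U x -> cont_seminorm p ->
  0 < e -> exists A B : set E, [/\ nbhs x A, nbhs 0 B &
    forall y w h, A y -> B w -> `|h| <= 1 -> p (f (y + h *: w) - f y) <= e * `|h|].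
Proof.
move=> Ux cp e0; have [hE [q gq]] := mE; have sp := cp.1.
have [A [B [C [nA nB C0 AU bound]]]] := ndirD_bounded 1 Ux cp.
have [n [r [r0 rA]]] := (gq.2 _ _).1 nA.
have [m [s [s0 sB]]] := (gq.2 _ _).1 nB.
have r20 : 0 < r / 2 by rewrite divr_gt0.
have es0 : 0 < s * (e / C) by rewrite mulr_gt0// divr_gt0.
pose A1 := [set y | forall i, (i <= n)%N -> q i (y - x) < r / 2].
pose B1 := [set w | forall i, (i <= n)%N -> q i (w - 0) < r / 2].
pose B2 := [set w | forall i, (i <= m)%N -> q i (w - 0) < s * (e / C)].
exists A1, (B1 `&` B2); split.
- by apply/gq.2; exists n, (r / 2).
- by apply: filterI; apply/gq.2; [exists n, (r / 2)|exists m, (s * (e / C))].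
suff K y w h : A1 y -> (B1 `&` B2) w -> 0 <= h <= 1 -> p (f (y + h *: w) - f y) <= e * `|h|.
  move=> y w h Ay Bw; rewrite ler_norml => /andP[h1 h2].
  have [h0|h0] := leP 0 h; first by apply: K => //; rewrite h0.
  have -> : h *: w = (- h) *: (- w) by rewrite scaleNr scalerN opprK.
  rewrite -normrN; apply: K => //; last by rewrite lerNl h1 oppr_ge0 ltW.
  split=> i ni.
    by have := Bw.1 i ni; rewrite !subr0 (seminormN (gq.1 i)).
  by have := Bw.2 i ni; rewrite !subr0 (seminormN (gq.1 i)).
move=> Ay [Bw1 Bw2] /andP[h0 h1].
have Ayt t : 0 <= t <= h -> A (y + t *: w).
  move=> /andP[t0 th]; apply: rA => i ni.
  rewrite addrAC; apply: le_lt_trans (seminorm_triangle (gq.1 i) _ _) _.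
  rewrite [ltRHS]splitr ltrD ?Ay// (seminormZ (gq.1 i)) ger0_norm//.
  apply: le_lt_trans (_ : q i w < _); last by have := Bw1 i ni; rewrite subr0.
  by rewrite ler_piMl ?(seminorm_ge0 (gq.1 i))// (le_trans th).
have := @mean_value _ _ p (fun t => f (y + t *: w)) (fun t => ndirD 1 f (y + t *: w) w) 0 h e cp h0.
rewrite scale0r addr0 subr0 ger0_norm//; apply=> t th.
  have := @ndirD_derive 0 y w t (AU _ (Ayt t th)).
  by under eq_fun do rewrite ndirD0.
have eC0 : 0 < e / C by rewrite divr_gt0.
have Ut := AU _ (Ayt t th).
have := ndirDZ 1 ((e / C)^-1 *: w) (e / C) Ut.
rewrite scalerA divff ?gt_eqF// scale1r => ->.
rewrite expr1 (seminormZ sp) gtr0_norm//.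
apply: le_trans (ler_wpM2l (ltW eC0) (bound _ _ (Ayt t th) _)) _; last first.
  by rewrite divfK ?gt_eqF.
apply: sB => i mi; rewrite subr0 (seminormZ (gq.1 i)) gtr0_norm ?invr_gt0//.
by rewrite ltr_pdivrMl// mulrC; have := Bw2 i mi; rewrite subr0.
Qed.

Lemma conv_smooth_continuous (x : E) : U x -> {for x, continuous f}.
Proof.
move=> Ux; have [hF [q gq]] := mF; apply: (generating_cvg _ gq) => i e e0.
have [A [B [nA nB H]]] := conv_smooth_lipschitz Ux (generating_cont i gq) (divr_gt0 e0 (ltr0n R 2)).
have : \forall y \near x, B (y - x).
  have : (fun y => y - x) @ x --> 0.
    by rewrite -[X in _ --> X](subrr x); apply: tvs_cvgB; [exact: cvg_id|exact: cvg_cst].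
  exact.
apply: filterS => y Bxy.
have := H x (y - x) 1 (nbhs_singleton nA) Bxy.
rewrite normr1 scale1r subrKC mulr1 => /(_ (lexx 1)) /le_lt_trans; apply.
by rewrite ltr_pdivrMr// ltr_pMr// ltr1n.
Qed.

(** The curve is compared with its tangent line: [c (h + t)] differs from [c t + h *: v] by [h]
    times a vector tending to 0, which [conv_smooth_lipschitz] makes negligible, and along the line
    the derivative is [dirD] by definition. *)
Lemma conv_smooth_chain (c : R -> E) (t : R) (v : E) : U (c t) ->
  is_curve_derive c t v -> is_curve_derive (f \o c) t (dirD f (c t) v).
Proof.
move=> Ut cv; have [hF [q gq]] := mF; apply: (generating_cvg _ gq) => i e e0 /=.
have cp := generating_cont i gq; have sp := gq.1 i.
have e20 : 0 < e / 2 by rewrite divr_gt0.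
have [A [B [nA nB H]]] := conv_smooth_lipschitz Ut cp e20.
have uD : is_curve_derive (fun r => f (c t + r *: v)) 0 (dirD f (c t) v).
  have := @ndirD_derive 0 (c t) v 0; rewrite scale0r addr0 => /(_ Ut).
  by under eq_fun do rewrite ndirD0.
have nD : \forall h \near (0 : R)^',
    q i (h^-1 *: (f (c t + h *: v) - f (c t)) - dirD f (c t) v) < e / 2.
  apply: filterS (cont_seminorm_cvg _ cp uD e20) => h.
  by rewrite addr0 scale0r addr0.
have wB : \forall h \near (0 : R)^', B (h^-1 *: (c (h + t) - c t) - v).
  have : (fun h => h^-1 *: (c (h + t) - c t) - v) @ (0 : R)^' --> 0.
    by rewrite -[X in _ --> X](subrr v); apply: tvs_cvgB => //; exact: cvg_cst.
  exact.
have hA : \forall h \near (0 : R)^', A (c t + h *: v).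
  have : (fun h : R => c t + h *: v) @ (0 : R)^' --> c t.
    apply: cvg_within_filter; rewrite -{2}[c t]addr0 -(scale0r v); exact: line_continuous.
  exact.
near=> h.
have h0 : h != 0 by near: h; exact: nbhs_dnbhs_neq.
have -> : h^-1 *: (f (c (h + t)) - f (c t)) - dirD f (c t) v =
  h^-1 *: (f (c (h + t)) - f (c t + h *: v)) +
  (h^-1 *: (f (c t + h *: v) - f (c t)) - dirD f (c t) v).
  by rewrite addrA -scalerDr addrA subrK.
apply: le_lt_trans (seminorm_triangle sp _ _) _; rewrite [ltRHS]splitr ler_ltD//.
  rewrite (seminormZ sp) normrV ?unitfE// ler_pdivrMl ?normr_gt0// mulrC.
  have -> : c (h + t) = c t + h *: v + h *: (h^-1 *: (c (h + t) - c t) - v).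
    by rewrite scalerBr scalerA divff// scale1r addrA [_ + (c _ - c t)]addrC addrA subrK addrK.
  apply: H; [near: h; exact: hA|near: h; exact: wB|].
  by near: h; apply: dnbhs0_le.
by near: h; exact: nD.
Unshelve. all: by end_near. Qed.

Lemma near_line (x v : E) (A : set E) : nbhs x A ->
  exists2 B, nbhs x B & exists2 d : R, 0 < d & forall y (h : R), B y -> `|h| <= d -> A (y + h *: v).
Proof.
move=> nA; have : (fun z : E * R => z.1 + z.2 *: v) @ (x, 0 : R) --> x + 0 *: v.
  apply: tvs_cvgD; first exact: cvg_fst.
  by apply: tvs_cvgZ; [exact: cvg_snd|exact: cvg_cst].
rewrite scale0r addr0 => /(_ _ nA) [[B D] /= [nB [d /= d0 dD]] BD].
exists B => //; exists (d / 2); first by rewrite divr_gt0.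
move=> y h By hd; apply: (BD (y, h)); split=> //=; apply: dD; rewrite /= sub0r normrN.
by apply: le_lt_trans hd _; rewrite ltr_pdivrMr// ltr_pMr// ltr1n.
Qed.

Lemma near_bounded n (x v : E) (p : F -> R) : U x -> cont_seminorm p ->
  exists2 C : R, 0 < C & \forall y \near x, U y /\ p (ndirD n f y v) <= C.
Proof.
move=> Ux cp; have [A [B [C [nA nB C0 AU H]]]] := ndirD_bounded n Ux cp.
have [B1 nB1 [d d0 dH]] := near_line v nB.
have {dH}Bd : B (d *: v).
  by rewrite -[_ *: _]add0r; apply: dH; [exact: nbhs_singleton|rewrite gtr0_norm].
exists (C / d ^+ n); first by rewrite divr_gt0// exprn_gt0.
apply: filterS nA => y Ay; split; first exact: AU.
rewrite ler_pdivlMr ?exprn_gt0// mulrC -[X in X * _]gtr0_norm ?exprn_gt0//.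
rewrite -(seminormZ cp.1) -ndirDZ; [exact: H|exact: AU].
Qed.

Lemma near_taylor1 n (x v : E) (p : F -> R) : U x -> cont_seminorm p ->
  exists2 C : R, 0 < C & exists2 B, nbhs x B & exists2 d : R, 0 < d &
  forall y (h : R), B y -> `|h| <= d ->
   p (ndirD n f (y + h *: v) v - ndirD n f y v - h *: ndirD n.+1 f y v) <= C * h ^+ 2.
Proof.
move=> Ux cp; have [C C0 nC] := near_bounded n.+2 v Ux cp.
have [B nB [d d0 H]] := near_line v nC.
exists C => //; exists B => //; exists d => // y h By hd.
have := @taylor1 _ _ p (fun r => ndirD n f (y + r *: v) v) (fun r => ndirD n.+1 f (y + r *: v) v)
  (fun r => ndirD n.+2 f (y + r *: v) v) h C cp.
rewrite scale0r addr0; apply=> t th; have [Ut Ct] := H y t By (le_trans th hd) => //;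
  exact: ndirD_derive.
Qed.

(** By induction the difference quotients of [ndirD n] with a fixed step [h] are continuous. By
    [near_taylor1] they approximate [ndirD n.+1] within [C * h], uniformly near [x], so continuity
    passes to the limit; the step is chosen to make this error at most [e / 4]. *)
Lemma ndirD_continuous n (x v : E) : U x -> {for x, continuous (ndirD n f ^~ v)}.
Proof.
elim: n x => [|n IHn] x Ux.
  have -> : ndirD 0 f ^~ v = f by apply/funext => y; rewrite ndirD0.
  exact: conv_smooth_continuous.
have [hF [q gq]] := mF; apply: (generating_cvg _ gq) => i e e0.
have cp := generating_cont i gq; have sp := gq.1 i.
have [C C0 [B nB [d d0 H]]] := near_taylor1 n v Ux cp.
have nU : nbhs x U by exact: open_nbhs_nbhs.
have [B' nB' [d' d'0 H']] := near_line v nU.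
pose h := Num.min (Num.min d d') (e / 4 / C).
have h0 : 0 < h by rewrite !lt_min d0 d'0/= divr_gt0// divr_gt0.
have hd : `|h| <= d by rewrite gtr0_norm// !ge_min lexx.
have hd' : `|h| <= d' by rewrite gtr0_norm// !ge_min lexx orbT.
have hC : C * h <= e / 4.
  by rewrite mulrC -ler_pdivlMr// !ge_min lexx orbT.
have Uxh : U (x + h *: v) by apply: H' => //; exact: nbhs_singleton.
have gh : (fun y => h^-1 *: (ndirD n f (y + h *: v) v - ndirD n f y v)) @ x -->
     h^-1 *: (ndirD n f (x + h *: v) v - ndirD n f x v).
  apply: tvs_cvgZ; first exact: cvg_cst.
  apply: tvs_cvgB; last exact: IHn.
  have yc : (fun y => y + h *: v) @ x --> x + h *: v.
    by apply: tvs_cvgD; [exact: cvg_id|exact: cvg_cst].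
  exact: (cvg_comp _ _ yc (IHn _ Uxh)).
have K y : B y -> q i (h^-1 *: (ndirD n f (y + h *: v) v - ndirD n f y v) - ndirD n.+1 f y v) <= e / 4.
  move=> By; apply: le_trans hC.
  have -> : h^-1 *: (ndirD n f (y + h *: v) v - ndirD n f y v) - ndirD n.+1 f y v =
    h^-1 *: (ndirD n f (y + h *: v) v - ndirD n f y v - h *: ndirD n.+1 f y v).
    by rewrite [in RHS]scalerBr scalerA mulVf ?gt_eqF// scale1r.
  rewrite (seminormZ sp) gtr0_norm ?invr_gt0// ler_pdivrMl//.
  apply: le_trans (H y h By hd) _; by rewrite expr2 mulrCA.
have e40 : 0 < e / 4 by rewrite divr_gt0.
near=> y.
have By : B y by near: y.
have gy : q i (h^-1 *: (ndirD n f (y + h *: v) v - ndirD n f y v) -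
    h^-1 *: (ndirD n f (x + h *: v) v - ndirD n f x v)) < e / 4.
  by near: y; exact: (cont_seminorm_cvg _ cp gh e40).
have Ky := K y By; have Kx := K x (nbhs_singleton nB).
rewrite (seminormBC sp) in Ky.
apply: le_lt_trans (seminorm_dist sp _ (h^-1 *: (ndirD n f (y + h *: v) v - ndirD n f y v)) _) _.
apply: le_lt_trans (lerD Ky (seminorm_dist sp _ (h^-1 *: (ndirD n f (x + h *: v) v - ndirD n f x v)) _)) _.
rewrite [ltRHS](_ : e = e / 4 + (e / 4 + e / 4 + e / 4)); last by field.
rewrite ler_ltD// ltr_leD// ltr_pwDr//; exact: ltW.
Unshelve. all: by end_near. Qed.

(** Continuity of the second derivative makes the remainder small against [h ^+ 2] for all base
    points near [x] at once; the subdivision into squares in [mixedD_derive] depends on this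
    uniformity. *)
Lemma near_taylor2 (x v : E) (p : F -> R) (e : R) : U x -> cont_seminorm p -> 0 < e ->
  exists2 B, nbhs x B & exists2 d : R, 0 < d & forall y (h : R), B y -> `|h| <= d ->
   p (f (y + h *: v) - f y - h *: ndirD 1 f y v - (h ^+ 2 / 2) *: ndirD 2 f y v)
     <= e * h ^+ 2.
Proof.
move=> Ux cp e0; have sp := cp.1.
have e20 : 0 < e / 2 by rewrite divr_gt0.
have nC : \forall y \near x, U y /\ p (ndirD 2 f y v - ndirD 2 f x v) < e / 2.
  apply: filterI; first exact: open_nbhs_nbhs.
  exact: (cont_seminorm_cvg _ cp (@ndirD_continuous 2 x v Ux) e20).
have [B nB [d d0 H]] := near_line v nC.
exists (B `&` [set y | U y /\ p (ndirD 2 f y v - ndirD 2 f x v) < e / 2]); first exact: filterI.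
exists d => // y h [By [Uy py]] hd.
have := @taylor2 _ _ p (fun r => ndirD 0 f (y + r *: v) v) (fun r => ndirD 1 f (y + r *: v) v)
  (fun r => ndirD 2 f (y + r *: v) v) h e cp.
rewrite scale0r addr0 !ndirD0; apply=> t th; have [Ut Ct] := H y t By (le_trans th hd).
- exact: ndirD_derive.
- exact: ndirD_derive.
apply: le_trans (seminorm_dist sp _ (ndirD 2 f x v) _) _.
rewrite [leRHS]splitr; apply: lerD; first exact: ltW.
by apply: ltW; rewrite (seminormBC sp (ndirD 2 f x v) (ndirD 2 f y v)).
Qed.

(** The increment along [v + w] is one along [v] followed by one along [w] from the moving base
    point [x + r *: v]. The second is handled by the Taylor estimate uniform in the base point,
    together with continuity of [ndirD 1 f] in direction [w]. *)
Lemma ndirD1_add (x v w : E) : U x ->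
  ndirD 1 f x (v + w) = ndirD 1 f x v + ndirD 1 f x w.
Proof.
move=> Ux; have [hF [q gq]] := mF.
apply: (@curve_derive_val _ _ _ _ _ hF).
apply: (@curve_derive_eq _ _ (fun r : R => f (x + r *: v) + (f (x + r *: v + r *: w) - f (x + r *: v)))).
  by move=> r; rewrite subrKC scalerDr addrA.
apply: curve_deriveD.
  have := @ndirD_derive 0 x v 0; rewrite scale0r addr0 => /(_ Ux).
  by under eq_fun do rewrite ndirD0.
apply: (generating_cvg _ gq) => i e e0.
have cp := generating_cont i gq; have sp := gq.1 i.
have [C C0 [B nB [d d0 H]]] := near_taylor1 0 w Ux cp.
have e20 : 0 < e / 2 by rewrite divr_gt0.
have lc : (fun h : R => x + h *: v) @ (0 : R)^' --> x.
  by apply: cvg_within_filter; rewrite -{2}[x]addr0 -(scale0r v); exact: line_continuous.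
have D1 : \forall h \near (0 : R)^', q i (ndirD 1 f (x + h *: v) w - ndirD 1 f x w) < e / 2.
  exact: (cont_seminorm_cvg _ cp (cvg_comp _ _ lc (@ndirD_continuous 1 x w Ux)) e20).
near=> h.
have h0 : h != 0 by near: h; exact: nbhs_dnbhs_neq.
rewrite addr0 !scale0r !addr0 subrr subr0.
have By : B (x + h *: v) by near: h; exact: lc.
have hd : `|h| <= d by near: h; apply: dnbhs0_le.
have := H _ _ By hd; rewrite !ndirD0 => H1.
have D1h : q i (ndirD 1 f (x + h *: v) w - ndirD 1 f x w) < e / 2 by near: h.
apply: le_lt_trans (seminorm_dist sp _ (ndirD 1 f (x + h *: v) w) _) _.
rewrite [ltRHS]splitr ler_ltD//.
have -> : h^-1 *: (f (x + h *: v + h *: w) - f (x + h *: v)) - ndirD 1 f (x + h *: v) w =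
    h^-1 *: (f (x + h *: v + h *: w) - f (x + h *: v) - h *: ndirD 1 f (x + h *: v) w).
  by rewrite [in RHS]scalerBr scalerA mulVf// scale1r.
rewrite (seminormZ sp) normrV ?unitfE// ler_pdivrMl ?normr_gt0//.
apply: le_trans H1 _.
have -> : C * h ^+ 2 = `|h| * (C * `|h|) by rewrite -[h ^+ 2]real_normK ?num_real// expr2; ring.
rewrite ler_pM2l ?normr_gt0//.
rewrite -ler_pdivlMl//; near: h; apply: dnbhs0_le; by rewrite mulr_gt0// invr_gt0.
Unshelve. all: by end_near. Qed.

(** Polarization of the second derivative, symmetric by construction. Symmetry of mixed derivatives
    thus reduces to showing, in [mixedD_derive], that it is the derivative along [v] of the
    derivative along [w]. *)
Definition mixedD (x v w : E) : F :=
  2^-1 *: (ndirD 2 f x (v + w) - ndirD 2 f x v - ndirD 2 f x w).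

Lemma mixedDC x v w : mixedD x v w = mixedD x w v.
Proof.
rewrite /mixedD (addrC v w); move: (ndirD 2 f x _) (ndirD 2 f x v) (ndirD 2 f x w) => a b c.
by rewrite addrAC.
Qed.

Lemma mixedD_continuous (x v w : E) : U x -> {for x, continuous (fun y => mixedD y v w)}.
Proof.
move=> Ux; apply: tvs_cvgZ; first exact: cvg_cst.
by apply: tvs_cvgB; [apply: tvs_cvgB|]; exact: ndirD_continuous.
Qed.

Let square (y v w : E) (h : R) : F :=
  f (y + h *: v + h *: w) - f (y + h *: v) - (f (y + h *: w) - f y).

Let near_square (x v w : E) (p : F -> R) (e : R) : U x -> cont_seminorm p -> 0 < e ->
  exists2 B, nbhs x B & exists2 d : R, 0 < d & forall y (h : R), B y -> `|h| <= d ->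
   p (square y v w h - h ^+ 2 *: mixedD y v w) <= e * h ^+ 2.
Proof.
move=> Ux cp e0; have sp := cp.1.
have e30 : 0 < e / 3 by rewrite divr_gt0.
have [B1 nB1 [d1 d10 H1]] := near_taylor2 (v + w) Ux cp e30.
have [B2 nB2 [d2 d20 H2]] := near_taylor2 v Ux cp e30.
have [B3 nB3 [d3 d30 H3]] := near_taylor2 w Ux cp e30.
exists (U `&` (B1 `&` (B2 `&` B3))).
  by apply: filterI; [exact: open_nbhs_nbhs|apply: filterI => //; exact: filterI].
exists (Num.min d1 (Num.min d2 d3)); first by rewrite !lt_min d10 d20.
move=> y h [Uy [B1y [B2y B3y]]]; rewrite !le_min => /andP[hd1 /andP[hd2 hd3]].
have := H1 y h B1y hd1; have := H2 y h B2y hd2; have := H3 y h B3y hd3.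
rewrite ndirD1_add// /square /mixedD scalerA scalerDr addrA.
move: (f _) (f _) (f _) (f _) (ndirD 1 f y v) (ndirD 1 f y w)
  (ndirD 2 f y (v + w)) (ndirD 2 f y v) (ndirD 2 f y w) => f3 f0 f2 f1 a b d e' g.
move=> k1 k2 k3; rewrite (second_differenceE f0 f1 f2 f3 a b _ _ _ h) (_ : e = e / 3 + e / 3 + e / 3); last by field.
apply: le_trans (seminorm_triangle sp _ _) _; rewrite (seminormN sp) 2!mulrDl lerD//.
by apply: le_trans (seminorm_triangle sp _ _) _; rewrite (seminormN sp) lerD.
Qed.

(** [near_square] controls equal increments along [v] and [w], whereas here the increment along [w]
    has to tend to 0 first. A thin rectangle is therefore tiled by squares: each contributes
    [b ^+ 2 *: mixedD x v w] up to [e / 2 * b ^+ 2], and dividing the sum by [b] leaves an error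
    [e / 2 * |a|]. *)
Lemma mixedD_derive (x v w : E) : U x ->
  is_curve_derive (fun r => ndirD 1 f (x + r *: v) w) 0 (mixedD x v w).
Proof.
move=> Ux; have [hF [q gq]] := mF; apply: (generating_cvg _ gq) => i e e0.
have cp := generating_cont i gq; have sp := gq.1 i.
have e40 : 0 < e / 4 by rewrite divr_gt0.
have [B nB [d d0 HB]] := near_square v w Ux cp e40.
have nM : \forall y \near x, B y /\ U y /\ q i (mixedD y v w - mixedD x v w) < e / 4.
  apply: filterI => //; apply: filterI; first exact: open_nbhs_nbhs.
  exact: (cont_seminorm_cvg _ cp (@mixedD_continuous x v w Ux) e40).
have [B1 /nbhs_singleton B1x [d1 d10 H1]] := near_line v nM.
near=> a.
have a0 : a != 0 by near: a; exact: nbhs_dnbhs_neq.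
have ad1 : `|a| <= d1 by near: a; exact: dnbhs0_le.
rewrite !(addr0, scale0r).
have [_ [Uxa _]] := H1 x a B1x ad1.
suff : q i (ndirD 1 f (x + a *: v) w - ndirD 1 f x w - a *: mixedD x v w) <= e / 2 * `|a|.
  move=> h; have -> : a^-1 *: (ndirD 1 f (x + a *: v) w - ndirD 1 f x w) - mixedD x v w =
     a^-1 *: (ndirD 1 f (x + a *: v) w - ndirD 1 f x w - a *: mixedD x v w).
    by rewrite [in RHS]scalerBr scalerA mulVf// scale1r.
  rewrite (seminormZ sp) normrV ?unitfE// ltr_pdivrMl ?normr_gt0//.
  apply: le_lt_trans h _; rewrite mulrC ltr_pM2l ?normr_gt0//.
  by rewrite ltr_pdivrMr// ltr_pMr// ltr1n.
(* The rectangle with sides [a] and [a / n] is cut into [n] squares. *)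
apply/ler_addgt0Pr => g g0.
have g20 : 0 < g / 2 by rewrite divr_gt0.
have D y : U y -> \forall h \near (0 : R)^', q i (h^-1 *: (f (y + h *: w) - f y) - ndirD 1 f y w) < g / 2.
  move=> Uy; have := @ndirD_derive 0 y w 0; rewrite scale0r addr0 => /(_ Uy) dD.
  apply: filterS (cont_seminorm_cvg _ cp dD g20) => h.
  by rewrite !ndirD0 addr0 scale0r addr0.
have [d2 /= d20 H2] : \forall h \near (0 : R), h != 0 ->
    q i (h^-1 *: (f (x + h *: w) - f x) - ndirD 1 f x w) < g / 2 /\
    q i (h^-1 *: (f (x + a *: v + h *: w) - f (x + a *: v)) - ndirD 1 f (x + a *: v) w) < g / 2.
  exact: (filterI (D _ Ux) (D _ Uxa)).
(* The number of squares is so large that the side [a / m] is below [d], the range of [near_square],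
   and below [d2], where both difference quotients along [w] are within [g / 2] of their limits. *)
pose m := (Num.truncn (`|a| / Num.min d d2)).+1.
have m0 : 0 < m%:R :> R by rewrite ltr0n.
pose b := a / m%:R.
have bd : `|b| < Num.min d d2.
  rewrite normrM normfV [`|m%:R|]ger0_norm// ltr_pdivrMr// mulrC -ltr_pdivrMr ?lt_min ?d0//.
  exact: truncnS_gt.
have b0 : b != 0 by rewrite mulf_neq0// invr_eq0 gt_eqF.
have {}bd : `|b| <= d /\ `|b| < d2 by move: bd; rewrite lt_min => /andP[/ltW].
have mb : m%:R * b = a by rewrite mulrC divfK// gt_eqF.
clearbody b.
have sum : \sum_(j < m) square (x + (j%:R * b) *: v) v w b =
    f (x + a *: v + b *: w) - f (x + a *: v) - (f (x + b *: w) - f x).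
  rewrite -mb; elim: (m) => [|k IHk].
    by rewrite big_ord0 mul0r scale0r addr0 subrr.
  rewrite big_ord_recr /= IHk /square.
  have -> : x + (k%:R * b) *: v + b *: v = x + (k.+1%:R * b) *: v.
    by rewrite -addrA -scalerDl -[k.+1]addn1 natrD mulrDl mul1r.
  by rewrite addrC [_ - _ + (_ - _ - _)]addrA subrK.
have small j : (j < m)%N -> q i (square (x + (j%:R * b) *: v) v w b - b ^+ 2 *: mixedD x v w)
    <= e / 2 * b ^+ 2.
  move=> jm; have jb : `|j%:R * b| <= d1.
    apply: le_trans ad1; rewrite -mb !normrM ler_wpM2r// !ger0_norm ?ler0n// ler_nat ltnW//.
  have [By [Uy My]] := H1 x (j%:R * b) B1x jb.
  have := HB _ b By bd.1 => h1.
  apply: le_trans (seminorm_dist sp _ (b ^+ 2 *: mixedD (x + (j%:R * b) *: v) v w) _) _.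
  rewrite (_ : e / 2 * b ^+ 2 = e / 4 * b ^+ 2 + e / 4 * b ^+ 2); last by field.
  apply: lerD; first exact: h1.
  rewrite -scalerBr (seminormZ sp) ger0_norm ?sqr_ge0// mulrC.
  by apply: ler_wpM2r; [exact: sqr_ge0|exact: ltW].
have S : q i (f (x + a *: v + b *: w) - f (x + a *: v) - (f (x + b *: w) - f x) -
    (a * b) *: mixedD x v w) <= e / 2 * `|a| * `|b|.
  rewrite -sum (_ : (a * b) *: mixedD x v w = \sum_(j < m) b ^+ 2 *: mixedD x v w); last first.
    by rewrite sumr_const card_ord -scaler_nat scalerA expr2 mulrA mb.
  rewrite -sumrB; apply: le_trans (seminorm_sum sp _) _.
  apply: (@le_trans _ _ (\sum_(j < m) (e / 2 * b ^+ 2))); first by apply: ler_sum => j _; exact: small.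
  rewrite sumr_const card_ord -mb normrM [`|m%:R|]ger0_norm// -[b ^+ 2]real_normK ?num_real//.
  by rewrite -mulr_natl expr2; lra.
have [k1 k2] := H2 b ltac:(by rewrite /ball_ /= sub0r normrN bd.2) b0.
set X1 := b^-1 *: _ in k1; set X2 := b^-1 *: _ in k2.
have k3 : q i (X2 - X1 - a *: mixedD x v w) <= e / 2 * `|a|.
  have -> : X2 - X1 - a *: mixedD x v w = b^-1 *: (f (x + a *: v + b *: w) - f (x + a *: v) -
      (f (x + b *: w) - f x) - (a * b) *: mixedD x v w).
    rewrite [RHS]scalerBr [in RHS]scalerBr [b^-1 *: (_ *: mixedD _ _ _)]scalerA.
    by rewrite mulrCA mulVf// mulr1.
  rewrite (seminormZ sp) normrV ?unitfE// ler_pdivrMl ?normr_gt0//.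
  by apply: le_trans S _; rewrite [leLHS]mulrC.
rewrite (differenceE _ _ _ X1 X2) (_ : e / 2 * `|a| + g = g / 2 + g / 2 + e / 2 * `|a|); last by field.
apply: le_trans (seminorm_triangle sp _ _) _; apply: lerD => //.
apply: le_trans (seminorm_triangle sp _ _) _; rewrite (seminormN sp); apply: lerD.
  by rewrite (seminormBC sp (ndirD 1 f (x + a *: v) w) X2); exact: ltW.
by rewrite (seminormBC sp (ndirD 1 f x w) X1); exact: ltW.
Unshelve. all: by end_near. Qed.

End DirectionalDerivatives.

(** * The Jacobi metric *)

Lemma real_scaleE (R : realType) (a b : R) : a *: b = a * b.
Proof. by []. Qed.

Lemma addrACA3 (V : zmodType) (a1 a2 b1 b2 c1 c2 : V) :
  a1 + a2 + (b1 + b2) - (c1 + c2) = (a1 + b1 - c1) + (a2 + b2 - c2).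
Proof. by rewrite opprD (addrACA a1) (addrACA (a1 + b1)). Qed.

Section SymmetricBilinear.
Context {R : realType} {E F : tvsType R} (b : E -> E -> F).
Hypothesis hb : L2sym b.

Lemma L2symC h k : b h k = b k h. Proof. by case: hb. Qed.

Lemma L2symDr h k l : b h (k + l) = b h k + b h l.
Proof. by have [_ + _ _] := hb => /(_ h 1 k l); rewrite !scale1r. Qed.

Lemma L2sym0r h : b h 0 = 0.
Proof. by apply: (addrI (b h 0)); rewrite -L2symDr !addr0. Qed.

Lemma L2symZr h a k : b h (a *: k) = a *: b h k.
Proof. by have [_ + _ _] := hb => /(_ h a k 0); rewrite !addr0 L2sym0r addr0. Qed.

Lemma L2symNr h k : b h (- k) = - b h k.
Proof. by rewrite -scaleN1r L2symZr scaleN1r. Qed.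

Lemma L2symBr h k l : b h (k - l) = b h k - b h l.
Proof. by rewrite L2symDr L2symNr. Qed.

Lemma L2symDl h k l : b (h + k) l = b h l + b k l.
Proof. by rewrite L2symC L2symDr !(L2symC l). Qed.

Lemma L2symZl h a k : b (a *: h) k = a *: b h k.
Proof. by rewrite L2symC L2symZr L2symC. Qed.

Lemma L2symNl h k : b (- h) k = - b h k.
Proof. by rewrite L2symC L2symNr L2symC. Qed.

Lemma L2symBl h k l : b (h - k) l = b h l - b k l.
Proof. by rewrite L2symDl L2symNl. Qed.

Lemma L2sym0l h : b 0 h = 0.
Proof. by rewrite L2symC L2sym0r. Qed.

End SymmetricBilinear.

Section ConvSmooth.
Context {R : realType}.
Implicit Types E F : tvsType R.

Lemma smooth_curve_pair E F (I : set R) (u : R -> E) (v : R -> F) :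
  hausdorff_space E -> hausdorff_space F -> open I ->
  smooth_curve I (fun t => (u t, v t)) <-> smooth_curve I u /\ smooth_curve I v.
Proof.
move=> hE hF oI; have hEF := hausdorff_prod hE hF; split.
  move=> /(smooth_curveP _ hEF oI) s.
  by split; apply/smooth_curveP => // n; have /nderivable_pair[] := s n.
move=> [/(smooth_curveP _ hE oI) su /(smooth_curveP _ hF oI) sv].
by apply/smooth_curveP => // n; apply/nderivable_pair.
Qed.

Lemma smooth_curveZ E (I : set R) (a : R -> R) (u : R -> E) :
  hausdorff_space E -> open I -> smooth_curve I a -> smooth_curve I u ->
  smooth_curve I (fun t => a t *: u t).
Proof.
move=> hE oI /(smooth_curveP _ hausdorff_real oI) sa /(smooth_curveP _ hE oI) su.
by apply/(smooth_curveP _ hE oI) => n; exact: nderivableZ.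
Qed.

Lemma smooth_curveD E (I : set R) (u v : R -> E) :
  hausdorff_space E -> open I -> smooth_curve I u -> smooth_curve I v ->
  smooth_curve I (fun t => u t + v t).
Proof.
move=> hE oI /(smooth_curveP _ hE oI) su /(smooth_curveP _ hE oI) sv.
by apply/(smooth_curveP _ hE oI) => n; exact: nderivableD.
Qed.

Lemma smooth_curve_cst E (I : set R) (a : E) :
  hausdorff_space E -> open I -> smooth_curve I (fun=> a).
Proof.
by move=> hE oI; apply/(smooth_curveP _ hE oI) => n; exact: nderivable_cst.
Qed.

Lemma smooth_curveB E (I : set R) (u v : R -> E) :
  hausdorff_space E -> open I -> smooth_curve I u -> smooth_curve I v ->
  smooth_curve I (fun t => u t - v t).
Proof.
move=> hE oI /(smooth_curveP _ hE oI) su /(smooth_curveP _ hE oI) sv.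
by apply/(smooth_curveP _ hE oI) => n; exact: nderivableB.
Qed.

Lemma smooth_curveV (I : set R) (a : R -> R) : open I -> (forall t, I t -> a t != 0) ->
  smooth_curve I a -> smooth_curve I (fun t => (a t)^-1).
Proof.
move=> oI a0 /(smooth_curveP _ hausdorff_real oI) sa.
by apply/(smooth_curveP _ hausdorff_real oI) => n; exact: nderivableV.
Qed.

Lemma smooth_curve_derive E (I : set R) (u : R -> E) :
  smooth_curve I u -> smooth_curve I (curve_derive u).
Proof. by move=> su n t It; have := su n.+1 t It; rewrite iterSr. Qed.

Lemma smooth_is_derive E (I : set R) (u : R -> E) t : smooth_curve I u -> I t ->
  is_curve_derive u t (curve_derive u t).
Proof. by move=> su It; exact/curve_derivableP/(su 0%N). Qed.

End ConvSmooth.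

(** * Differentiating the metric along curves, and the Levi-Civita property of the Jacobi
    connection *)

Section WeakPseudoRiemannian.
Context {R : realType} {E : tvsType R} (N : set E).
Context (G : E -> E -> E -> R) (Gam : E -> E -> E -> E).
Hypotheses (mE : metrizable_lcs E) (hG : weak_pseudo_riemannian N G Gam).

Let hE := mE.1.
Let hE2 := hausdorff_prod hE hE.
Let hE3 := hausdorff_prod hE2 hE.
Let mE3 := metrizable_prod (metrizable_prod mE mE) mE.
Let oN := wpr_open hG.
Let LG g (Ng : N g) : L2sym (G g) := (wpr_metric hG).1 g Ng.
Let LGam g (Ng : N g) : L2sym (Gam g) := (wpr_connection hG).1 g Ng.

Lemma open_base : open [set p : E * E * E | N p.1.1].
Proof.
apply: (@open_comp _ _ (fun p : E * E * E => p.1.1)) => // p _.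
by apply: (@cvg_comp _ _ _ _ fst); [exact: cvg_fst|exact: cvg_fst].
Qed.

Lemma metric_continuous p : N p.1.1 ->
  {for p, continuous (fun p : E * E * E => G p.1.1 p.1.2 p.2)}.
Proof.
move=> Np; exact: (conv_smooth_continuous mE3 metrizable_real open_base (wpr_metric hG).2 Np).
Qed.

Lemma connection_continuous p : N p.1.1 ->
  {for p, continuous (fun p : E * E * E => Gam p.1.1 p.1.2 p.2)}.
Proof.
move=> Np; exact: (conv_smooth_continuous mE3 mE open_base (wpr_connection hG).2 Np).
Qed.

Lemma metric_smooth (I : set R) (g h k : R -> E) : open I ->
  (forall t, I t -> N (g t)) -> smooth_curve I g -> smooth_curve I h -> smooth_curve I k ->
  smooth_curve I (fun t => G (g t) (h t) (k t)).
Proof.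
move=> oI Ng sg sh sk.
apply: (conv_smooth_curve (c := fun t => (g t, h t, k t)) hE3 (wpr_metric hG).2 oI) => //.
by apply/smooth_curve_pair => //; split=> //; exact/smooth_curve_pair.
Qed.

Lemma connection_smooth (I : set R) (g h k : R -> E) : open I ->
  (forall t, I t -> N (g t)) -> smooth_curve I g -> smooth_curve I h -> smooth_curve I k ->
  smooth_curve I (fun t => Gam (g t) (h t) (k t)).
Proof.
move=> oI Ng sg sh sk.
apply: (conv_smooth_curve (c := fun t => (g t, h t, k t)) hE3 (wpr_connection hG).2 oI) => //.
by apply/smooth_curve_pair => //; split=> //; exact/smooth_curve_pair.
Qed.

Lemma metric_slice_derive (g l h k : E) : N g ->
  is_curve_derive (fun r : R => G (g + r *: l) h k) 0 (- G g (Gam g l h) k - G g h (Gam g l k)).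
Proof.
move=> Ng.
have sGhk : conv_smooth N (fun x => G x h k).
  by move=> c sc Nc; apply: metric_smooth => //; [exact: openT|exact: smooth_curve_cst openT|exact: smooth_curve_cst openT].
have -> : - G g (Gam g l h) k - G g h (Gam g l k) = dirD (fun x => G x h k) g l.
  by have := wpr_levi_civita hG Ng l h k; lra.
have := ndirD_derive mE metrizable_real oN sGhk (n := 0) (x := g) (v := l) (r := 0).
rewrite scale0r addr0 => /(_ Ng).
by under eq_fun do rewrite ndirD0.
Qed.

(** The chain rule on [E * E * E] reduces the claim to a straight line in all three arguments, and
    there bilinearity leaves only the base-point derivative, which the Levi-Civita identity
    expresses by [Gam]. In covariant terms this is $\frac{d}{dt}G(h,k)=G(\nabla h,k)+G(h,\nabla
    k)$. *)
Lemma metric_derive (g h k : R -> E) (t : R) (g' h' k' : E) : N (g t) ->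
  is_curve_derive g t g' -> is_curve_derive h t h' -> is_curve_derive k t k' ->
  is_curve_derive (fun t => G (g t) (h t) (k t)) t
    (- G (g t) (Gam (g t) g' (h t)) (k t) - G (g t) (h t) (Gam (g t) g' (k t)) +
     (G (g t) h' (k t) + G (g t) (h t) k')).
Proof.
move=> Ng gg' hh' kk'.
have dp : is_curve_derive (fun t => (g t, h t, k t)) t (g', h', k').
  by apply/curve_derive_pair; split=> //; exact/curve_derive_pair.
have := conv_smooth_chain mE3 metrizable_real open_base (wpr_metric hG).2 (c := fun t => (g t, h t, k t)) Ng dp.
congr is_curve_derive; apply: (curve_derive_val hausdorff_real).
pose A r := G (g t + r *: g') (h t) (k t).
pose B r := G (g t + r *: g') h' (k t) + G (g t + r *: g') (h t) k'.
pose D r := G (g t + r *: g') h' k'.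
have dA := @metric_slice_derive (g t) g' (h t) (k t) Ng.
have dB := curve_deriveD (@metric_slice_derive (g t) g' h' (k t) Ng) (@metric_slice_derive (g t) g' (h t) k' Ng).
have dD := @metric_slice_derive (g t) g' h' k' Ng.
have oL := @line_open _ _ _ oN (g t) g'.
have L0 : [set r : R | N (g t + r *: g')] 0 by rewrite /= scale0r addr0.
(* Expanded in [r], the coefficients [A], [B], [D] vary only through the base point [g t + r *: g'];
   the product rule at 0 then keeps the derivative of [A] and the value of [B]. *)
apply: (@curve_derive_near _ R (fun r : R => A r + r *: (B r + r *: D r))).
  apply: (open_near oL L0) => r /= Nr.
  rewrite /A /B /D !(L2symDl (LG Nr)) !(L2symDr (LG Nr)) !(L2symZl (LG Nr)) !(L2symZr (LG Nr)).
  by rewrite !real_scaleE; ring.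
have id0 := curve_derive_id (0 : R).
have := curve_deriveD dA (curve_deriveZ (E := R) id0 (curve_deriveD dB (curve_deriveZ (E := R) id0 dD))).
by rewrite /B /= !(scale0r, addr0, scale1r).
Qed.

Context (V : E -> R) (gradV : E -> E) (e : R).
Hypotheses (hV : conv_smooth N V) (hgradV : is_gradient N G V gradV).

Lemma potential_continuous g : N g -> {for g, continuous V}.
Proof. by move=> Ng; exact: (conv_smooth_continuous mE metrizable_real oN hV Ng). Qed.

Lemma gradient_continuous g : N g -> {for g, continuous gradV}.
Proof. by move=> Ng; exact: (conv_smooth_continuous mE mE oN hgradV.1 Ng). Qed.

Lemma potential_derive (g : R -> E) (t : R) (g' : E) : N (g t) ->
  is_curve_derive g t g' -> is_curve_derive (V \o g) t (G (g t) (gradV (g t)) g').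
Proof.
move=> Ng gg'; rewrite -(hgradV.2 _ Ng).
exact: (conv_smooth_chain mE metrizable_real oN hV Ng gg').
Qed.

Lemma factor_derive (g : R -> E) (t : R) (g' : E) : N (g t) ->
  is_curve_derive g t g' ->
  is_curve_derive (jacobi_factor V e \o g) t (- 2 * G (g t) (gradV (g t)) g').
Proof.
move=> Ng gg'.
have := @curve_derive_scale _ R 2 _ _ _ (curve_deriveB (curve_derive_cst (e : R) t) (potential_derive Ng gg')).
by congr is_curve_derive; rewrite sub0r real_scaleE mulrN mulNr.
Qed.

Lemma dirD_factor (g h : E) : N g ->
  dirD (jacobi_factor V e) g h = - 2 * G g (gradV g) h.
Proof.
move=> Ng; apply: (curve_derive_val hausdorff_real).
have gh : is_curve_derive (fun r : R => g + r *: h) 0 h.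
  have := curve_deriveD (curve_derive_cst g 0) (curve_deriveZ (curve_derive_id 0) (curve_derive_cst h 0)).
  by rewrite scaler0 addr0 scale1r add0r.
by have := factor_derive (g := fun r : R => g + r *: h) (t := 0); rewrite scale0r addr0; exact.
Qed.

(** The factors $-2$ in $df$ and in $\operatorname{grad}f$ cancel against $-(2f)^{-1}$, leaving
    $f^{-1}$ and the gradient of $V$. *)
Lemma jacobi_connectionE (g h k : E) : N g ->
  jacobi_connection G Gam V gradV e g h k = Gam g h k + (jacobi_factor V e g)^-1 *:
    (G g (gradV g) h *: k + G g (gradV g) k *: h - G g h k *: gradV g).
Proof.
move=> Ng; rewrite /jacobi_connection !dirD_factor// scalerA.
rewrite (_ : (G g h k * - 2) = - 2 * G g h k); last by rewrite mulrC.
rewrite -!scalerA -!scalerDr -scalerBr scalerA -scaleNr; congr (_ + _ *: _).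
by rewrite invfM mulrN opprK mulrAC mulVf ?mul1r.
Qed.

Lemma factor_neq0 g : V g != e -> jacobi_factor V e g != 0.
Proof. by move=> Vg; rewrite mulf_neq0// subr_eq0 eq_sym. Qed.

Lemma factor_smooth (I : set R) (g : R -> E) : open I -> (forall t, I t -> N (g t)) ->
  smooth_curve I g -> smooth_curve I (jacobi_factor V e \o g).
Proof.
move=> oI Ng sg; have hR : hausdorff_space R := hausdorff_real.
apply: (smooth_curveZ (E := R)) => //; first exact: smooth_curve_cst.
by apply: smooth_curveB => //; [exact: smooth_curve_cst|exact: (conv_smooth_curve hE hV oI sg)].
Qed.

Lemma jacobi_weak_pseudo_riemannian :
  weak_pseudo_riemannian (jacobi_domain V e N) (jacobi_metric G V e)
    (jacobi_connection G Gam V gradV e).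
Proof.
have hR : hausdorff_space R := hausdorff_real.
pose f := jacobi_factor V e.
split.
- rewrite openE => g [Ng Vg]; apply: filterI; first exact: open_nbhs_nbhs.
  have ne : nbhs (V g) [set x | x != e] by apply: open_nbhs_nbhs; split=> //; exact: open_neq.
  exact: (potential_continuous Ng ne).
- split=> [g [Ng Vg]|c sc Nc].
    have Lg := LG Ng; split.
    + by move=> h k; rewrite /jacobi_metric L2symC.
    + move=> h a k l; rewrite /jacobi_metric (L2symDr Lg) (L2symZr Lg) !real_scaleE; ring.
    + move=> h a k l; rewrite /jacobi_metric (L2symDl Lg) (L2symZl Lg) !real_scaleE; ring.
    + move=> p; apply: cvgM; first exact: cvg_cst.
      by have [_ _ _] := Lg; exact.
  have /(smooth_curve_pair _ _ hE2 hE openT)[s12 s3] :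
    smooth_curve setT (fun t => ((c t).1, (c t).2)).
    by congr smooth_curve: sc; apply/funext => t; case: (c t).
  have /(smooth_curve_pair _ _ hE hE openT)[s1 s2] :
    smooth_curve setT (fun t => ((c t).1.1, (c t).1.2)).
    by congr smooth_curve: s12; apply/funext => t; case: (c t).1.
  apply: (smooth_curveZ (E := R) hR openT).
    by apply: (factor_smooth openT) s1 => t _; have [] := Nc t.
  by apply: (metric_smooth openT) => // t _; have [] := Nc t.
- move=> g [Ng Vg] h H; apply: (wpr_nondegenerate hG Ng) => k.
  apply: (mulfI (factor_neq0 Vg)); rewrite mulr0; exact: H.
- split=> [g [Ng Vg]|c sc Nc].
    have Lg := LG Ng; have Kg := LGam Ng.
    have sym h k : jacobi_connection G Gam V gradV e g h k = jacobi_connection G Gam V gradV e g k h.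
      rewrite !jacobi_connectionE// (L2symC Kg) (L2symC Lg h k).
      by rewrite [X in _ *: (X - _)]addrC.
    have lin h : linear (jacobi_connection G Gam V gradV e g h).
      move=> a k l; rewrite !jacobi_connectionE// (L2symDr Kg) (L2symZr Kg).
      rewrite [a *: (Gam g h k + _)]scalerDr [RHS]addrACA; congr (_ + _).
      rewrite [a *: (_ *: _)]scalerA [a * _]mulrC -[(_ * a) *: _]scalerA -scalerDr; congr (_ *: _).
      rewrite !(L2symDr Lg) !(L2symZr Lg) !real_scaleE scalerDr !scalerDl addrACA3; congr (_ + _).
      by rewrite scalerBr scalerDr !scalerA [a * G g (gradV g) h]mulrC.
    split.
    + exact: sym.
    + exact: lin.
    + by move=> h a k l; rewrite !(sym _ h); exact: lin.
    + move=> p.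
      rewrite (_ : (fun p => _) = (fun p : E * E => Gam g p.1 p.2 + (f g)^-1 *:
        (G g (gradV g) p.1 *: p.2 + G g (gradV g) p.2 *: p.1 - G g p.1 p.2 *: gradV g))); last first.
        by apply/funext => q; rewrite jacobi_connectionE.
      have [_ _ _ cG] := Lg; have [_ _ _ cK] := Kg.
      have c1 : (fun q : E * E => G g (gradV g) q.1) @ p --> G g (gradV g) p.1.
        apply: (@continuous_comp _ _ _ (fun q : E * E => (gradV g, q.1)) (fun q : E * E => G g q.1 q.2)).
          by apply: cvg_pair; [exact: cvg_cst|exact: cvg_fst].
        exact: cG.
      have c2 : (fun q : E * E => G g (gradV g) q.2) @ p --> G g (gradV g) p.2.
        apply: (@continuous_comp _ _ _ (fun q : E * E => (gradV g, q.2)) (fun q : E * E => G g q.1 q.2)).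
          by apply: cvg_pair; [exact: cvg_cst|exact: cvg_snd].
        exact: cG.
      apply: tvs_cvgD; first exact: cK.
      apply: tvs_cvgZ; first exact: cvg_cst.
      apply: tvs_cvgB; last by apply: tvs_cvgZ; [exact: cG|exact: cvg_cst].
      by apply: tvs_cvgD; apply: tvs_cvgZ => //; [exact: cvg_snd|exact: cvg_fst].
  have /(smooth_curve_pair _ _ hE2 hE openT)[s12 s3] :
    smooth_curve setT (fun t => ((c t).1, (c t).2)).
    by congr smooth_curve: sc; apply/funext => t; case: (c t).
  have /(smooth_curve_pair _ _ hE hE openT)[s1 s2] :
    smooth_curve setT (fun t => ((c t).1.1, (c t).1.2)).
    by congr smooth_curve: s12; apply/funext => t; case: (c t).1.
  have Nc1 t : [set: R] t -> N (c t).1.1 by move=> _; have [] := Nc t.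
  have sV := conv_smooth_curve hE hgradV.1 openT s1 Nc1.
  rewrite (_ : _ \o _ = (fun t => Gam (c t).1.1 (c t).1.2 (c t).2 + (f (c t).1.1)^-1 *:
    (G (c t).1.1 (gradV (c t).1.1) (c t).1.2 *: (c t).2 + G (c t).1.1 (gradV (c t).1.1) (c t).2 *: (c t).1.2
     - G (c t).1.1 (c t).1.2 (c t).2 *: gradV (c t).1.1))); last first.
    by apply/funext => t; rewrite /= jacobi_connectionE//; exact: Nc1.
  apply: (smooth_curveD hE openT); first exact: (connection_smooth openT Nc1 s1 s2 s3).
  apply: (smooth_curveZ hE openT).
    apply: (smooth_curveV openT); last exact: (factor_smooth openT Nc1 s1).
    by move=> t _; have [_ /factor_neq0] := Nc t.
  apply: (smooth_curveB hE openT).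
    apply: (smooth_curveD hE openT); apply: (smooth_curveZ hE openT) => //.
      exact: (metric_smooth openT Nc1 s1 sV s2).
    exact: (metric_smooth openT Nc1 s1 sV s3).
  by apply: (smooth_curveZ hE openT) => //; exact: (metric_smooth openT Nc1 s1 s2 s3).
- move=> g [Ng Vg] l h k; have Lg := LG Ng; have f0 := factor_neq0 Vg.
  have gl : is_curve_derive (fun r : R => g + r *: l) 0 l.
    have := curve_deriveD (curve_derive_cst g 0) (curve_deriveZ (curve_derive_id 0) (curve_derive_cst l 0)).
    by rewrite scaler0 addr0 scale1r add0r.
  have dF := factor_derive (g := fun r : R => g + r *: l) (t := 0).
  rewrite scale0r addr0 in dF.
  have -> : dirD (fun x => jacobi_metric G V e x h k) g l =
     - 2 * G g (gradV g) l * G g h k + f g * (- G g (Gam g l h) k - G g h (Gam g l k)).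
    apply: (curve_derive_val hR).
    have := curve_deriveZ (E := R) (dF l Ng gl) (@metric_slice_derive g l h k Ng).
    by rewrite /= scale0r addr0.
  (* In the sum of the two correction terms the parts with $G(l,h)\,G(\operatorname{grad}V,k)$ and
     $G(l,k)\,G(\operatorname{grad}V,h)$ cancel; what remains, $2G(\operatorname{grad}V,l)\,G(h,k)$,
     compensates $df(l)\,G(h,k)$. *)
  rewrite /jacobi_metric !jacobi_connectionE// -/f.
  rewrite !(L2symDl Lg) !(L2symDr Lg) !(L2symZl Lg) !(L2symZr Lg).
  rewrite !(L2symBl Lg) !(L2symBr Lg) !(L2symDl Lg) !(L2symDr Lg) !(L2symZl Lg) !(L2symZr Lg).
  rewrite !real_scaleE (L2symC Lg h l) (L2symC Lg h (gradV g)).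
  by field.
Qed.

End WeakPseudoRiemannian.

(** * Integration and change of parameter on the line *)

Section RealAnalysis.
Context {R : realType}.
Notation mu := (@lebesgue_measure R).

Lemma within_continuous (A : set R) (f : R -> R) :
  (forall t, A t -> {for t, continuous f}) -> {within A, continuous f}.
Proof.
by move=> cf; apply: continuous_in_subspaceT => t /set_mem; exact: cf.
Qed.

Lemma integrable_segment (a b : R) (f : R -> R) :
  (forall t, a <= t <= b -> {for t, continuous f}) -> mu.-integrable `[a, b] (EFin \o f).
Proof.
move=> cf; apply: continuous_compact_integrable; first exact: segment_compact.
by apply: within_continuous => t; rewrite /= in_itv; exact: cf.
Qed.

Lemma curve_FTC2 (q q' : R -> R) (a b : R) : a < b ->
  (forall t, a <= t <= b -> is_curve_derive q t (q' t)) ->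
  (forall t, a <= t <= b -> {for t, continuous q'}) ->
  (\int[mu]_(t in `[a, b]) q' t)%R = q b - q a.
Proof.
move=> ab qq' cq'.
have dq t : a <= t <= b -> is_derive t 1 q (q' t) by move=> /qq' /is_curve_deriveE.
have cq t : a <= t <= b -> {for t, continuous q}.
  by move=> /qq'; exact: curve_derive_continuous.
rewrite /Rintegral (@continuous_FTC2 _ q' q) //.
- by apply: within_continuous => t; rewrite /= in_itv; exact: cq'.
- split.
  + by move=> t; rewrite in_itv /= => /andP[at_ tb]; have [] := dq t ltac:(by rewrite !ltW).
  + by apply: cvg_at_right_filter; apply: cq; rewrite lexx ltW.
  + by apply: cvg_at_left_filter; apply: cq; rewrite lexx ltW.
- move=> t; rewrite in_itv /= => /andP[at_ tb]; rewrite derive1E.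
  by have [] := dq t ltac:(by rewrite !ltW).
Qed.

Lemma derive_under_integral (J : set R) (f f' : R -> R -> R) :
  open J -> compact (closure J) ->
  (forall s t, closure J t -> is_curve_derive (f ^~ t) s (f' s t)) ->
  (forall s t, closure J t -> {for t, continuous (f s)}) ->
  (forall s t, closure J t -> {for (s, t), continuous (fun p : R * R => f' p.1 p.2)}) ->
  is_derive (0 : R) (1 : R) (fun s => \int[mu]_(t in J) f s t)%R (\int[mu]_(t in J) f' 0 t)%R.
Proof.
move=> oJ cJ ff' cf cf'.
have mJ : measurable J by exact: measurable_realfun.open_measurable.
have mcJ : measurable (closure J) by apply: measurable_realfun.closed_measurable; exact: closed_closure.
have JcJ : J `<=` closure J by exact: subset_closure.
have int (g : R -> R) : (forall t, closure J t -> {for t, continuous g}) ->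
    mu.-integrable J (EFin \o g).
  move=> cg; have i1 : mu.-integrable (closure J) (EFin \o g).
    by apply: continuous_compact_integrable => //; exact: within_continuous.
  have H := @integrableS _ _ R mu (closure J) J (EFin \o g).
  by apply: H; [exact: mcJ|exact: mJ|exact: JcJ|exact: i1].
pose K : set (R * R) := `[(-1 : R), 1] `*` closure J.
have cK : compact K by apply: compact_setX => //; exact: segment_compact.
have ck : {within K, continuous (fun p : R * R => f' p.1 p.2)}.
  by apply: continuous_in_subspaceT => -[s t] /set_mem[_ /= Jt]; exact: cf'.
have [M [_ HM]] := compact_bounded (continuous_compact ck cK).
(* [compact_bounded] vouches only for bounds strictly above [M]. *)
pose B := `|M| + 1.
have HB s t : -1 <= s <= 1 -> closure J t -> `|f' s t| <= B.
  move=> s1 Jt; apply: (HM B); first by rewrite /B (le_lt_trans (ler_norm _))// ltrDl.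
  by exists (s, t) => //; split=> //=; rewrite in_itv.
have m11 : `](-1 : R), 1[%classic 0 by rewrite /= in_itv /=; apply/andP; split; lra.
have d1 s t : closure J t -> partial1of2 f s t = f' s t.
  move=> Jt; rewrite partial1of2E.
  by have /is_curve_deriveE[_] := ff' s t Jt.
apply/is_curve_deriveE.
have := @cvg_differentiation_under_integral R _ _ mu f J mJ 0 (-1) 1 m11 _ _ (fun=> B) _ _ _.
rewrite /is_curve_derive => H.
have -> : (\int[mu]_(t in J) f' 0 t)%R = (\int[mu]_(t in J) partial1of2 f 0 t)%R.
  by apply: eq_Rintegral => t /set_mem /JcJ /d1.
apply: H.
- by move=> s _; apply: int => t; exact: cf.
- by move=> s t _ /JcJ Jt; have /is_curve_deriveE[] := ff' s t Jt.
- by move=> _; rewrite /B addr_ge0.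
- by apply: (int (fun=> B)) => t _; exact: cvg_cst.
- by move=> s t; rewrite /= in_itv /= => /andP[s1 s2] /JcJ Jt; rewrite d1// HB// !ltW.
Qed.

Lemma open_itv_left (I : set R) t : open I -> I t -> exists2 a, a < t & forall r, a <= r <= t -> I r.
Proof.
move=> oI It; have [d /= d0 dI] := open_nbhs_nbhs (conj oI It).
exists (t - d / 2); first by rewrite ltrBlDr ltrDl divr_gt0.
move=> r /andP[r1 r2]; apply: dI; rewrite /= ger0_norm ?subr_ge0//.
by rewrite ltrBlDr; apply: (@lt_le_trans _ _ (d + (t - d / 2))); [lra|rewrite lerD2l].
Qed.

Lemma open_itv_right (I : set R) t : open I -> I t -> exists2 b, t < b & forall r, t <= r <= b -> I r.
Proof.
move=> oI It; have [d /= d0 dI] := open_nbhs_nbhs (conj oI It).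
exists (t + d / 2); first by rewrite ltrDl divr_gt0.
move=> r /andP[r1 r2]; apply: dI; rewrite /= ler0_norm ?subr_le0//.
by rewrite opprB ltrBlDl (le_lt_trans r2)// ltrD2l ltr_pdivrMr// ltr_pMr// ltr1n.
Qed.

(** The extreme points of [K] belong to [K], hence to the open set [I], which leaves room beyond
    them. The minimum is obtained as the maximum of the reflected set. *)
Lemma compact_in_open_interval (I K : set R) : open I -> is_interval I ->
  K !=set0 -> compact K -> K `<=` I ->
  exists a b, [/\ a < b, forall t, a <= t <= b -> I t & forall t, K t -> a < t < b].
Proof.
move=> oI iI K0 cK KI.
have clK : closed K by apply: compact_closed => //; exact: hausdorff_real.
have hs := compact_has_sup K0 cK.
have Ks : K (sup K) by apply: clK; exact: (closure_sup K0 hs.2).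
have cK' : compact (-%R @` K).
  by apply: continuous_compact => //; apply: continuous_subspaceT; exact: opp_continuous.
have K'0 : (-%R @` K) !=set0 by have [x Kx] := K0; exists (- x), x.
have hs' := compact_has_sup K'0 cK'.
have [i Ki iE] : (-%R @` K) (sup (-%R @` K)).
  have clK' : closed (-%R @` K) by apply: compact_closed => //; exact: hausdorff_real.
  by apply: clK'; exact: (closure_sup K'0 hs'.2).
have [a ai aI] := open_itv_left oI (KI _ Ki).
have [b sb bI] := open_itv_right oI (KI _ Ks).
have leK t : K t -> i <= t <= sup K.
  move=> Kt; apply/andP; split; last exact: (ub_le_sup hs.2).
  by rewrite -lerN2 iE; apply: (ub_le_sup hs'.2); exists t.
have iK := leK _ Ks.
exists a, b; split.
- by apply: (lt_trans ai); apply: (le_lt_trans _ sb); have /andP[] := iK.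
- move=> t /andP[at_ tb].
  have [ti|it] := leP t i; first by apply: aI; rewrite at_.
  have [st|ts] := leP (sup K) t; first by apply: bI; rewrite st.
  by apply: (iI i (sup K)); [exact: KI|exact: KI|rewrite !ltW].
by move=> t /leK /andP[h1 h2]; rewrite (lt_le_trans ai h1) (le_lt_trans h2 sb).
Qed.

(** With a base point [a] to the left of both [t0] and [t], the oriented integral is
    [Phi x - Phi t0] near [t] whichever of [t0] and [x] is larger, so one primitive covers both
    orientations. *)
Lemma oriented_integral_derive (I : set R) (f : R -> R) (t0 t : R) :
  open I -> is_interval I -> I t0 -> I t ->
  (forall r, I r -> {for r, continuous f}) ->
  is_derive t (1 : R) (fun x => oriented_integral t0 x f) (f t).
Proof.
move=> oI iI It0 It cf.
have cK : compact [set t0; t] by apply: compactU; exact: compact_set1.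
have [a [b [ab abI Kab]]] : exists a b, [/\ a < b, forall t, a <= t <= b -> I t &
    forall r, [set t0; t] r -> a < r < b].
  by apply: compact_in_open_interval => //; [exists t; right|move=> r [] ->].
have /andP[at0 t0b] := Kab t0 (or_introl erefl); have /andP[at_ tb] := Kab t (or_intror erefl).
pose Phi x := (\int[mu]_(r in `[a, x]) f r)%R.
have int c d : a <= c -> d <= b -> mu.-integrable `[c, d] (EFin \o f).
  move=> ac db; apply: integrable_segment => r /andP[cr rd]; apply/cf/abI.
  by rewrite (le_trans ac cr) (le_trans rd db).
have split x y : a < x -> x <= y -> y < b -> Phi y - Phi x = (\int[mu]_(r in `[x, y]) f r)%R.
  move=> ax xy yb; rewrite /Phi Rintegral_itvB.
  - apply: Rintegral_itv_obnd_cbnd.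
    apply: (integrableS _ _ _ (int x y (ltW ax) (ltW yb))) => //.
    exact: subset_itv_oc_cc.
  - exact: int (lexx _) (ltW yb).
  - by rewrite bnd_simp ltW.
  - by rewrite bnd_simp.
have dPhi : is_derive t 1 Phi (f t).
  have [d1 d2] := continuous_FTC1_closed tb (int a b (lexx _) (lexx _)) at_ (cf t It).
  by apply: DeriveDef; [exact: d1|rewrite -derive1E; exact: d2].
have dPhi0 : is_derive t 1 (fun x => Phi x - Phi t0) (f t).
  by have := is_deriveB dPhi (is_derive_cst (Phi t0) t 1); rewrite subr0.
apply/is_curve_deriveE; move/is_curve_deriveE: dPhi0; apply: curve_derive_near.
have : \forall r \near t, a < r < b.
  by have := near_in_itvoo (_ : t \in `]a, b[); rewrite in_itv /= at_ tb => /(_ isT); apply: filterS => r; rewrite in_itv.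
apply: filterS => r /andP[ar rb]; rewrite /oriented_integral.
case: ifPn => [t0r|]; first exact: split.
by rewrite -ltNge => /ltW rt0; rewrite -split// opprB.
Qed.

(** * Changes of parameter with nowhere vanishing derivative of either sign *)

Section Reparametrization.
Context (J : set R) (tau g : R -> R).
Hypotheses (oJ : open J) (iJ : is_interval J).
Hypothesis (dtau : forall x, J x -> is_derive x (1 : R) tau (g x)).
Hypothesis (cg : forall x, J x -> {for x, continuous g}).
Hypothesis (g0 : forall x, J x -> g x != 0).

Let ctau x : J x -> {for x, continuous tau}.
Proof. by move=> /dtau/is_curve_deriveE; exact: curve_derive_continuous. Qed.

Let sub x y : J x -> J y -> forall t, x <= t <= y -> J t.
Proof. by move=> Jx Jy t; exact: iJ. Qed.

Let mvt x y : J x -> J y -> x < y ->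
  exists2 c, x < c < y & tau y - tau x = g c * (y - x).
Proof.
move=> Jx Jy xy; have [c] := @MVT _ tau g x y xy
  (fun t h => dtau (sub Jx Jy (subset_itv_oo_cc h)))
  (within_continuous (fun t h => ctau (sub Jx Jy h))).
by rewrite in_itv; exists c.
Qed.

(** A continuous function without zeros on an interval cannot change sign. *)
Let same_sign x y : J x -> J y -> 0 < g x * g y.
Proof.
wlog xy : x y / x <= y.
  by move=> H Jx Jy; have [/H|/ltW/H] := leP x y; [exact|rewrite mulrC; exact].
move=> Jx Jy; rewrite ltNge; apply/negP => le0.
have [c] := @IVT _ g x y 0 xy (within_continuous (fun t h => cg (sub Jx Jy h)))
  ltac:(by move: le0 (g0 Jx) (g0 Jy); rewrite ge_min le_max; case: (ltgtP (g x) 0); case: (ltgtP (g y) 0) => //; nra).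
by rewrite in_itv => /(sub Jx Jy)/g0 /eqP.
Qed.

Lemma reparam_inj : set_inj J tau.
Proof.
have K x y : J x -> J y -> x < y -> tau x = tau y -> False.
  move=> Jx Jy xy txy; have [c /andP[xc cy]] := mvt Jx Jy xy.
  rewrite txy subrr => /esym/eqP; rewrite mulf_eq0 subr_eq0 (gt_eqF xy) orbF.
  by apply/negP/g0/(sub Jx Jy); rewrite !ltW.
move=> x y /set_mem Jx /set_mem Jy txy.
by have [/(K _ _ Jx Jy)/(_ txy)|/(K _ _ Jy Jx)/(_ (esym txy))|] := ltgtP x y.
Qed.

Lemma reparam_interval : is_interval (tau @` J).
Proof.
move=> _ _ [x Jx <-] [y Jy <-] z /andP[xz zy].
have [xy|/ltW yx] := leP x y.
  have [|c cxy <-] := @IVT _ tau x y z xy (within_continuous (fun t h => ctau (sub Jx Jy h))).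
    by rewrite ge_min xz le_max zy orbT.
  by exists c => //; apply: (sub Jx Jy); move: cxy; rewrite in_itv.
have [|c cxy <-] := @IVT _ tau y x z yx (within_continuous (fun t h => ctau (sub Jy Jx h))).
  by rewrite ge_min xz orbT le_max zy.
by exists c => //; apply: (sub Jy Jx); move: cxy; rewrite in_itv.
Qed.

(** The mean value theorem on both sides of [x] and constancy of the sign of [g] put [tau x]
    strictly between [tau a] and [tau b]; the values in between are attained. The two cases are
    increasing and decreasing [tau]. *)
Lemma reparam_open : open (tau @` J).
Proof.
rewrite openE => _ [x Jx <-].
have [a ax aJ] := open_itv_left oJ Jx; have [b xb bJ] := open_itv_right oJ Jx.
have Ja : J a by apply: aJ; rewrite lexx ltW.
have Jb : J b by apply: bJ; rewrite lexx ltW.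
have [c1 /andP[ac1 c1x] e1] := mvt Ja Jx ax; have [c2 /andP[xc2 c2b] e2] := mvt Jx Jb xb.
have Jc1 : J c1 by apply: aJ; rewrite !ltW.
have Jc2 : J c2 by apply: bJ; rewrite !ltW.
have ss := same_sign Jc1 Jc2.
have img z : Num.min (tau a) (tau b) <= z <= Num.max (tau a) (tau b) -> (tau @` J) z.
  move=> hz; have ab := ltW (lt_trans ax xb).
  have [c cab <-] := @IVT _ tau a b z ab (within_continuous (fun t h => ctau (sub Ja Jb h))) hz.
  by exists c => //; apply: (sub Ja Jb); move: cab; rewrite in_itv.
have xa0 : 0 < x - a by rewrite subr_gt0.
have bx0 : 0 < b - x by rewrite subr_gt0.
have [p|n] := ltP 0 (g c1).
  have q : 0 < g c2 by rewrite -(pmulr_rgt0 _ p).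
  have h1 : tau a < tau x by rewrite -subr_gt0 e1 mulr_gt0.
  have h2 : tau x < tau b by rewrite -subr_gt0 e2 mulr_gt0.
  apply: filterS (near_in_itvoo (_ : tau x \in `]tau a, tau b[)); last by rewrite in_itv /= h1.
  move=> z; rewrite in_itv /= => /andP[z1 z2]; apply: img.
  by rewrite ge_min (ltW z1) le_max (ltW z2) orbT.
have {}n : g c1 < 0 by rewrite lt_neqAle g0.
have q : g c2 < 0 by rewrite -(nmulr_rgt0 _ n).
have h1 : tau x < tau a by rewrite -subr_lt0 e1 nmulr_rlt0.
have h2 : tau b < tau x by rewrite -subr_lt0 e2 nmulr_rlt0.
apply: filterS (near_in_itvoo (_ : tau x \in `]tau b, tau a[)); last by rewrite in_itv /= h1 h2.
move=> z; rewrite in_itv /= => /andP[z1 z2]; apply: img.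
by rewrite ge_min (ltW z1) orbT le_max (ltW z2).
Qed.

Lemma reparam_inverse (sigma : R -> R) : (forall x, J x -> sigma (tau x) = x) ->
  forall x, J x -> is_derive (tau x) (1 : R) sigma (g x)^-1.
Proof.
move=> st x Jx; apply: (@is_derive_inverse _ tau).
- exact: (open_near oJ Jx).
- exact: (open_near oJ Jx).
- exact: dtau.
- exact: g0.
Qed.

End Reparametrization.

End RealAnalysis.

(** * First variation and Euler-Lagrange equation *)

Section Variation.
Context {R : realType} {E : tvsType R}.
Hypothesis mE : metrizable_lcs E.
Context (I : set R) (C : R * R -> E).
Hypotheses (oI : open I) (sC : conv_smooth [set p : R * R | I p.2] C).

Let mR2 := metrizable_prod (@metrizable_real R) (@metrizable_real R).

Definition var_s (p : R * R) : E := ndirD 1 C p (1, 0).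
Definition var_t (p : R * R) : E := ndirD 1 C p (0, 1).
(** One function for both iterated derivatives: it is the $s$-derivative of [var_t] and, by symmetry
    of [mixedD], the $t$-derivative of [var_s]. *)
Definition var_st (p : R * R) : E := mixedD C p (1, 0) (0, 1).

Lemma continuous_pair (T U W : topologicalType) (f : T -> U) (g : T -> W) (p : T) :
  {for p, continuous f} -> {for p, continuous g} -> {for p, continuous (fun q => (f q, g q))}.
Proof. by move=> cf cg; exact: (cvg_pair cf cg). Qed.

Lemma open_strip : open [set p : R * R | I p.2].
Proof. by apply: (@open_comp _ _ (fun p : R * R => p.2)) => // p _; exact: cvg_snd. Qed.

Lemma line_s (s t r : R) : (s, t) + r *: ((1, 0) : R * R) = (s + r, t).
Proof.
congr (_, _); first by rewrite -[LHS]/(s + r * 1) mulr1.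
by rewrite -[LHS]/(t + r * 0) mulr0 addr0.
Qed.

Lemma line_t (s t r : R) : (s, t) + r *: ((0, 1) : R * R) = (s, t + r).
Proof.
congr (_, _); first by rewrite -[LHS]/(s + r * 0) mulr0 addr0.
by rewrite -[LHS]/(t + r * 1) mulr1.
Qed.

Lemma curve_derive_shift (F : tvsType R) (u : R -> F) (t : R) l :
  is_curve_derive (fun r => u (t + r)) 0 l -> is_curve_derive u t l.
Proof.
apply: cvg_trans; apply: near_eq_cvg; apply: nearW => h.
by rewrite !addr0 [t + h]addrC.
Qed.

Lemma var_s_derive s t : I t -> is_curve_derive (fun r => C (r, t)) s (var_s (s, t)).
Proof.
move=> It; have := @ndirD_derive _ _ _ mR2 mE _ _ open_strip sC 0 (0, t) (1, 0) s.
rewrite line_s add0r => /(_ It); apply: curve_derive_eq => r.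
by rewrite line_s ndirD0 add0r.
Qed.

Lemma var_t_derive s t : I t -> is_curve_derive (fun r => C (s, r)) t (var_t (s, t)).
Proof.
move=> It; have := @ndirD_derive _ _ _ mR2 mE _ _ open_strip sC 0 (s, 0) (0, 1) t.
rewrite line_t add0r => /(_ It); apply: curve_derive_eq => r.
by rewrite line_t ndirD0 add0r.
Qed.

Lemma var_tE s t : I t -> curve_derive (fun r => C (s, r)) t = var_t (s, t).
Proof. by move=> It; exact: (curve_derive_val mE.1 (@var_t_derive s t It)). Qed.

Lemma var_t_derive_s s t : I t -> is_curve_derive (fun r => var_t (r, t)) s (var_st (s, t)).
Proof.
move=> It; apply: curve_derive_shift.
have := @mixedD_derive _ _ _ mR2 mE _ _ open_strip sC (s, t) (1, 0) (0, 1) It.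
by apply: curve_derive_eq => r; rewrite line_s.
Qed.

Lemma var_s_derive_t s t : I t -> is_curve_derive (fun r => var_s (s, r)) t (var_st (s, t)).
Proof.
move=> It; apply: curve_derive_shift; rewrite /var_st mixedDC.
have := @mixedD_derive _ _ _ mR2 mE _ _ open_strip sC (s, t) (0, 1) (1, 0) It.
by apply: curve_derive_eq => r; rewrite line_t.
Qed.

Lemma variation_continuous p : I p.2 -> {for p, continuous C}.
Proof. exact: (conv_smooth_continuous mR2 mE open_strip sC). Qed.

Lemma var_s_continuous p : I p.2 -> {for p, continuous var_s}.
Proof. exact: (@ndirD_continuous _ _ _ mR2 mE _ _ open_strip sC 1 p (1, 0)). Qed.

Lemma var_t_continuous p : I p.2 -> {for p, continuous var_t}.
Proof. exact: (@ndirD_continuous _ _ _ mR2 mE _ _ open_strip sC 1 p (0, 1)). Qed.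

Lemma var_st_continuous p : I p.2 -> {for p, continuous var_st}.
Proof. exact: (@mixedD_continuous _ _ _ mR2 mE _ _ open_strip sC p (1, 0) (0, 1)). Qed.

Context (N : set E) (G : E -> E -> E -> R) (Gam : E -> E -> E -> E).
Context (V : E -> R) (gradV : E -> E).
Hypotheses (hG : weak_pseudo_riemannian N G Gam).
Hypotheses (hV : conv_smooth N V) (hgradV : is_gradient N G V gradV).
Hypothesis NC : forall s t, I t -> N (C (s, t)).

Let LG g (Ng : N g) : L2sym (G g) := (wpr_metric hG).1 g Ng.
Let LGam g (Ng : N g) : L2sym (Gam g) := (wpr_connection hG).1 g Ng.

Definition lagrangian_derive (p : R * R) : R :=
  - G (C p) (Gam (C p) (var_s p) (var_t p)) (var_t p) + G (C p) (var_st p) (var_t p)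
  - G (C p) (gradV (C p)) (var_s p).

Lemma lagrangian_deriveP s t : I t ->
  is_curve_derive (fun r => lagrangian G V (C (r, t)) (curve_derive (fun t => C (r, t)) t)) s
    (lagrangian_derive (s, t)).
Proof.
move=> It.
rewrite (_ : (fun r => _) = (fun r => 2^-1 * G (C (r, t)) (var_t (r, t)) (var_t (r, t)) - V (C (r, t)))); last first.
  by apply/funext => r; rewrite /lagrangian var_tE.
have dC := @var_s_derive s t It; have dT := @var_t_derive_s s t It; have Ns := NC s It.
have d1 := metric_derive mE hG (g := fun r => C (r, t)) (t := s) Ns dC dT dT.
have d2 := potential_derive mE hG hV hgradV (g := fun r => C (r, t)) (t := s) Ns dC.
have := curve_deriveB (@curve_derive_scale _ R 2^-1 _ _ _ d1) d2.
congr is_curve_derive; have Lg := LG Ns; rewrite /lagrangian_derive real_scaleE.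
rewrite (L2symC Lg (var_t (s, t)) (Gam _ _ _)) (L2symC Lg (var_t (s, t)) (var_st _)); lra.
Qed.

Let metric_cvg p (g h k : R * R -> E) : N (g p) -> {for p, continuous g} ->
  {for p, continuous h} -> {for p, continuous k} ->
  {for p, continuous (fun q => G (g q) (h q) (k q))}.
Proof.
move=> Ng cg ch ck.
apply: (@continuous_comp _ _ _ (fun q => (g q, h q, k q)) (fun q : E * E * E => G q.1.1 q.1.2 q.2)).
  by apply: continuous_pair => //; exact: continuous_pair.
exact: (metric_continuous mE hG).
Qed.

Lemma lagrangian_derive_continuous p : I p.2 -> {for p, continuous lagrangian_derive}.
Proof.
case: p => s t It; have Np := NC s It.
have cC := variation_continuous (p := (s, t)) It.
have cs := var_s_continuous (p := (s, t)) It.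
have ct := var_t_continuous (p := (s, t)) It.
have cst := var_st_continuous (p := (s, t)) It.
have cGam : {for (s, t), continuous (fun q => Gam (C q) (var_s q) (var_t q))}.
  apply: (@continuous_comp _ _ _ (fun q => (C q, var_s q, var_t q)) (fun q : E * E * E => Gam q.1.1 q.1.2 q.2)).
    by apply: continuous_pair => //; exact: continuous_pair.
  exact: (connection_continuous mE hG).
have cgrad : {for (s, t), continuous (gradV \o C)}.
  by apply: continuous_comp => //; exact: (gradient_continuous mE hG hgradV).
apply: cvgB; last exact: (metric_cvg Np cC cgrad cs).
apply: cvgD; last exact: (metric_cvg Np cC cst ct).
by apply: cvgN; exact: (metric_cvg Np cC cGam ct).
Qed.

Lemma lagrangian_continuous s t : I t ->
  {for t, continuous (fun t => lagrangian G V (C (s, t)) (curve_derive (fun t => C (s, t)) t))}.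
Proof.
move=> It; have Np := NC s It.
have pc (F : topologicalType) (f : R * R -> F) :
    {for (s, t), continuous f} -> {for t, continuous (fun r => f (s, r))}.
  move=> cf; apply: (@continuous_comp _ _ _ (fun r => (s, r)) f) => //.
  by apply: continuous_pair; [exact: cvg_cst|exact: cvg_id].
have cL : {for t, continuous (fun r => 2^-1 * G (C (s, r)) (var_t (s, r)) (var_t (s, r)) - V (C (s, r)))}.
  apply: (pc _ (fun q => 2^-1 * G (C q) (var_t q) (var_t q) - V (C q))).
  have cC := variation_continuous (p := (s, t)) It.
  have ct := var_t_continuous (p := (s, t)) It.
  apply: cvgB.
    by apply: cvgM; [exact: cvg_cst|exact: (metric_cvg Np cC ct ct)].
  by apply: (@continuous_comp _ _ _ C V) => //; exact: (potential_continuous mE hG hV).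
rewrite /prop_for /continuous_at /lagrangian var_tE//; apply: cvg_trans cL.
apply: near_eq_cvg; apply: (open_near oI It) => r Ir; by rewrite var_tE.
Qed.

Lemma action_derive (J : set R) : open J -> compact (closure J) -> closure J `<=` I ->
  is_derive (0 : R) (1 : R)
    (fun s => lagrangian_action (lagrangian G V) J (fun t => C (s, t)))
    (\int[@lebesgue_measure R]_(t in J) lagrangian_derive (0, t))%R.
Proof.
move=> oJ cJ JI.
apply: (@derive_under_integral _ J
  (fun s t => lagrangian G V (C (s, t)) (curve_derive (fun t => C (s, t)) t))
  (fun s t => lagrangian_derive (s, t))) => //.
- by move=> s t /JI; exact: lagrangian_deriveP.
- by move=> s t /JI; exact: lagrangian_continuous.
- move=> s t /JI It; have := lagrangian_derive_continuous (p := (s, t)) It.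
  by rewrite (_ : (fun p => _) = lagrangian_derive); last by apply/funext => -[].
Qed.

Context (c : R -> E).
Hypotheses (sc : smooth_curve I c) (C0 : forall t, I t -> C (0, t) = c t).

Definition euler_lagrange (t : R) : E := curve_derive (curve_derive c) t -
  Gam (c t) (curve_derive c t) (curve_derive c t) + gradV (c t).

Lemma var_t0 t : I t -> var_t (0, t) = curve_derive c t.
Proof.
move=> It; rewrite -var_tE//.
exact: (@iter_curve_derive_eq _ _ _ (fun t => C (0, t)) c 1 t oI It C0).
Qed.

(** The integration by parts of the first variation, in pointwise form: over an interval at whose
    ends the variation vanishes, the integrals of [lagrangian_derive] and of
    $G(\partial_sC,\mathrm{EL})$ are opposite. *)
Lemma boundary_term_derive t : I t ->
  is_curve_derive (fun r => G (c r) (var_s (0, r)) (curve_derive c r)) t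
    (lagrangian_derive (0, t) + G (c t) (var_s (0, t)) (euler_lagrange t)).
Proof.
move=> It; have Nt : N (c t) by rewrite -C0//; exact: NC.
have dc := smooth_is_derive sc It.
have ddc := smooth_is_derive (smooth_curve_derive sc) It.
have := metric_derive mE hG Nt dc (@var_s_derive_t 0 t It) ddc.
congr is_curve_derive; have Lg := LG Nt; have Kg := LGam Nt.
rewrite /lagrangian_derive C0// var_t0// /euler_lagrange (L2symDr Lg) (L2symBr Lg).
rewrite (L2symC Kg (curve_derive c t) (var_s _)) (L2symC Lg (gradV _)); lra.
Qed.

End Variation.

Lemma Rintegral_subset (R : realType) (A B : set R) (f : R -> R) : A `<=` B ->
  (forall t, B t -> ~ A t -> f t = 0) ->
  (\int[@lebesgue_measure R]_(t in B) f t = \int[@lebesgue_measure R]_(t in A) f t)%R.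
Proof.
move=> AB f0; rewrite Rintegral_mkcond [RHS]Rintegral_mkcond; congr Rintegral.
apply/funext => t; rewrite !patchE; case: ifPn => [/set_mem Bt|nBt].
  by case: ifPn => // /negP nAt; apply: f0 => // At; apply: nAt; exact: mem_set.
by rewrite ifF//; apply/negbTE; apply: contra nBt => /set_mem At; exact/mem_set/AB.
Qed.

Lemma bump_scaled_continuous (R : realType) (a b : R) (t : R) :
  {for t, continuous (fun t : R => bump (a * (t - b)))}.
Proof.
have [v pv _] : nderivable 1 setT (fun t : R => bump (a * (t - b))); last first.
  exact: (curve_derive_continuous (pv t Logic.I)).
apply: (@nderivable_comp _ _ _ _ setT (@bump R) (fun t => a * (t - b))) => //.
  by apply: (@nderivable_scale _ R); apply: nderivableB; [exact: nderivable_id|exact: nderivable_cst].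
exact: nderivable_bump.
Qed.

(** The mean value theorem for a primitive of [q] on three consecutive intervals: the outer
    increments are nonnegative, the middle one is positive. *)
Lemma integral_pos (R : realType) (I : set R) (q : R -> R) (a x y b : R) :
  open I -> is_interval I -> (forall t, a <= t <= b -> I t) ->
  (forall t, I t -> {for t, continuous q}) -> (forall t, a <= t <= b -> 0 <= q t) ->
  a < x -> x < y -> y < b -> (forall t, x <= t <= y -> 0 < q t) ->
  0 < (\int[@lebesgue_measure R]_(t in `[a, b]) q t)%R.
Proof.
move=> oI iI abI cq q0 ax xy yb qpos.
have ab : a < b by apply: lt_trans yb; exact: lt_trans xy.
have Ia : I a by apply: abI; rewrite lexx ltW.
pose Q r := oriented_integral a r q.
have dQ t : I t -> is_derive t 1 Q (q t).
  by move=> It; exact: oriented_integral_derive oI iI Ia It cq.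
have mvt u v : a <= u -> v <= b -> u < v -> exists2 z, u < z < v & Q v - Q u = q z * (v - u).
  move=> au vb uv.
  have sub t : u <= t <= v -> I t.
    by move=> /andP[h1 h2]; apply: abI; rewrite (le_trans au h1) (le_trans h2 vb).
  have [z] := @MVT _ Q q u v uv (fun t h => dQ t (sub t (subset_itv_oo_cc h)))
    (within_continuous (fun t h => curve_derive_continuous ((is_curve_deriveE Q t (q t)).2 (dQ t (sub t h))))).
  by rewrite in_itv; exists z.
rewrite (curve_FTC2 (q := Q) ab); last 2 first.
- by move=> t /abI/dQ/is_curve_deriveE.
- by move=> t /abI; exact: cq.
have [z1 /andP[l1 u1] e1] := mvt a x (lexx a) (ltW (lt_trans xy yb)) ax.
have [z2 /andP[l2 u2] e2] := mvt x y (ltW ax) (ltW yb) xy.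
have [z3 /andP[l3 u3] e3] := mvt y b (ltW (lt_trans ax xy)) (lexx b) yb.
have h1 : 0 <= q z1.
  by apply: q0; rewrite (ltW l1) ltW// (lt_trans u1)// (lt_trans xy).
have h2 : 0 < q z2 by apply: qpos; rewrite !ltW.
have h3 : 0 <= q z3.
  by apply: q0; rewrite (ltW u3) ltW// (lt_trans _ l3)// (lt_trans ax).
rewrite -[Q b](subrK (Q y)) e3 -[Q y](subrK (Q x)) e2 -[Q x](subrK (Q a)) e1 !addrA addrK.
have p3 := mulr_ge0 h3 (ltW (etrans (subr_gt0 _ _) yb)).
have p1 := mulr_ge0 h1 (ltW (etrans (subr_gt0 _ _) ax)).
by apply: ltr_wpDr => //; apply: ltr_wpDl => //; rewrite mulr_gt0 ?subr_gt0.
Qed.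

(** * Extremals and the equation of motion *)

Section EulerLagrange.
Context {R : realType} {E : tvsType R} (N : set E).
Context (G : E -> E -> E -> R) (Gam : E -> E -> E -> E) (V : E -> R) (gradV : E -> E).
Hypotheses (mE : metrizable_lcs E) (hG : weak_pseudo_riemannian N G Gam).
Hypotheses (hV : conv_smooth N V) (hgradV : is_gradient N G V gradV).
Context (I : set R) (c : R -> E).
Hypotheses (oI : open I) (iI : is_interval I).
Hypotheses (sc : smooth_curve I c) (Nc : forall t, I t -> N (c t)).
Notation mu := (@lebesgue_measure R).

Let LG g (Ng : N g) : L2sym (G g) := (wpr_metric hG).1 g Ng.
Let hE := mE.1.
Let L := lagrangian G V.
Let EL := euler_lagrange Gam gradV c.

Section Support.
Context (C : R * R -> E) (K : set R).
Hypotheses (sC : conv_smooth [set p : R * R | I p.2] C)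
  (NC : forall s t, I t -> N (C (s, t)))
  (clK : closed K) (CK : forall s t, I t -> ~ K t -> C (s, t) = c t).

Lemma var_s_off t : I t -> ~ K t -> var_s C (0, t) = 0.
Proof.
move=> It nKt; apply: (curve_derive_unique hE (var_s_derive mE oI sC (s := 0) It)).
by apply: curve_derive_eq (curve_derive_cst (c t) 0) => s; rewrite CK.
Qed.

(** The complement of [K] is open, so [var_s] vanishes in a whole neighbourhood of [t] and not only
    at [t]. *)
Lemma var_st_off t : I t -> ~ K t -> var_st C (0, t) = 0.
Proof.
move=> It nKt; apply: (curve_derive_unique hE (var_s_derive_t mE oI sC (s := 0) It)).
have oK : open (I `&` ~` K) by apply: openI => //; exact: closed_openC.
apply: curve_derive_near (curve_derive_cst (0 : E) t).
by apply: (open_near oK (conj It nKt)) => r [Ir nKr]; rewrite var_s_off.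
Qed.

Lemma lagrangian_derive_off t : I t -> ~ K t -> lagrangian_derive C G Gam gradV (0, t) = 0.
Proof.
move=> It nKt; have Lc := LG (NC 0 It); have Kc := (wpr_connection hG).1 _ (NC 0 It).
rewrite /lagrangian_derive var_s_off// var_st_off// (L2sym0l Kc) !(L2sym0l Lc) (L2sym0r Lc).
by rewrite oppr0 !addr0.
Qed.

End Support.

Lemma extremal_of_euler_lagrange : (forall t, I t -> EL t = 0) -> extremal N L I c.
Proof.
move=> EL0; split=> // C K sC NC C0 cK KI CK.
have clK : closed K by apply: compact_closed => //; exact: hausdorff_real.
(* An empty [K] encloses in no canonical interval; the empty set then serves as [J'], with an action
   identically 0. *)
have [K0|/set0P/negP/negPn/eqP K0] := pselect (K !=set0); last first.
  exists set0; rewrite closure0; split=> //.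
  - exact: compact0.
  - by rewrite K0.
  have -> : (fun s => lagrangian_action L set0 (fun t => C (s, t))) = cst 0.
    by apply/funext => s; rewrite /lagrangian_action Rintegral_set0.
  exact: is_derive_cst.
have [a [b [ab abI Kab]]] := compact_in_open_interval oI iI K0 cK KI.
have cl : closure `]a, b[ `<=` `[a, b] by exact: itv_closure.
exists `]a, b[%classic; split.
- exact: itv_open.
- apply: (subclosed_compact _ (segment_compact (a := a) (b := b)) cl).
  exact: closed_closure.
- by move=> t /cl; rewrite /= in_itv; exact: abI.
- by move=> t /Kab; rewrite /= in_itv.
have JI : closure `]a, b[ `<=` I by move=> t /cl; rewrite /= in_itv; exact: abI.
have := action_derive mE oI sC hG hV hgradV NC (itv_open a b) _ JI.
have -> : (\int[mu]_(t in `]a, b[) lagrangian_derive C G Gam gradV (0, t))%R = 0; last first.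
  apply; apply: (subclosed_compact _ (segment_compact (a := a) (b := b)) cl).
  exact: closed_closure.
have nK t : (t = a \/ t = b) -> ~ K t.
  by move=> [] -> /Kab; rewrite ltxx ?andbF.
have Ia : I a by apply: abI; rewrite lexx ltW.
have Ib : I b by apply: abI; rewrite lexx ltW.
(* The endpoints lie outside [K], so the integrand vanishes there; the closed interval is the form
   that the fundamental theorem of calculus asks for. *)
rewrite -(@Rintegral_subset _ `]a, b[ `[a, b]); last 2 first.
- exact: subset_itv_oo_cc.
- move=> t; rewrite /= !in_itv /= => /andP[at_ tb] nab.
  have tt : t = a \/ t = b.
    move: at_ tb nab; rewrite !le_eqVlt => /orP[/eqP<-|at_] /orP[/eqP->|tb]; [by left|by left|by right|].
    by move=> nab; exfalso; apply: nab; rewrite at_ tb.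
  by apply: (lagrangian_derive_off sC NC clK CK) (nK _ tt); case: tt => ->.
have bd t : I t -> is_curve_derive (fun r => G (c r) (var_s C (0, r)) (curve_derive c r)) t
    (lagrangian_derive C G Gam gradV (0, t)).
  move=> It; have := boundary_term_derive (gradV := gradV) mE oI sC hG NC sc C0 It.
  by rewrite -/EL EL0// (L2sym0r (LG (Nc It))) addr0.
rewrite (curve_FTC2 ab (fun t h => bd t (abI t h))).
  rewrite !(var_s_off sC CK) //; [|exact: nK (or_introl erefl)|exact: nK (or_intror erefl)].
  by rewrite (L2sym0l (LG (Nc Ia))) (L2sym0l (LG (Nc Ib))) subr0.
move=> t /abI It; apply: (@continuous_comp _ _ _ (fun t => (0 : R, t)) (lagrangian_derive C G Gam gradV)).
  by apply: continuous_pair; [exact: cvg_cst|exact: cvg_id].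
exact: (lagrangian_derive_continuous mE oI sC hG hgradV NC (p := (0, t))).
Qed.

Lemma euler_lagrange_smooth : smooth_curve I EL.
Proof.
have s1 := smooth_curve_derive sc.
apply: (smooth_curveD hE oI); last exact: (conv_smooth_curve hE hgradV.1 oI sc Nc).
apply: (smooth_curveB hE oI); first exact: smooth_curve_derive.
exact: (connection_smooth mE hG oI Nc sc s1 s1).
Qed.

Section BumpVariation.
Context (t1 d : R) (h : E).
Hypotheses (d0 : 0 < d) (It1 : forall t, `|t - t1| < 3 * d -> I t)
  (Nh : forall t r, `|t - t1| < 3 * d -> `|r| < 3 * d -> N (c t + r *: h)).

Let phi (t : R) : R := bump (d^-1 * (t - t1)).
(** The amplitude agrees with [s] near 0 but stays within [2 * d], because a variation in [extremal]
    has to remain in [N] for every real [s]. The support of [phi] has the same radius [2 * d], and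
    the hypotheses grant [3 * d] to leave strict room. *)
Let sigma (s : R) : R := d * bump_id (d^-1 * s).
Let C (p : R * R) : E := c p.2 + (sigma p.1 * phi p.2) *: h.

Let phi0 t : 2 * d <= `|t - t1| -> phi t = 0.
Proof.
move=> h2; rewrite /phi bump0// normrM gtr0_norm ?invr_gt0//.
by rewrite ler_pdivlMl// mulrC.
Qed.

Let sphi n : nderivable n setT phi.
Proof.
apply: (@nderivable_comp _ _ _ _ setT bump (fun t => d^-1 * (t - t1))) => //.
  apply: (@nderivable_scale _ R); apply: nderivableB; [exact: nderivable_id|exact: nderivable_cst].
exact: nderivable_bump.
Qed.

Let ssigma n : nderivable n setT sigma.
Proof.
apply: (@nderivable_scale _ R).
apply: (@nderivable_comp _ _ _ _ setT bump_id (fun s => d^-1 * s)) => //.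
  by apply: (@nderivable_scale _ R); exact: nderivable_id.
exact: nderivable_bump_id.
Qed.

Let sC : conv_smooth [set p : R * R | I p.2] C.
Proof.
move=> p sp Ip; have hR : hausdorff_space R := hausdorff_real.
have /(smooth_curve_pair _ _ hR hR openT)[s1 s2] : smooth_curve setT (fun t => ((p t).1, (p t).2)).
  by congr smooth_curve: sp; apply/funext => t; case: (p t).
have comp (u v : R -> R) : (forall n, nderivable n setT u) -> smooth_curve setT v ->
    smooth_curve setT (u \o v).
  move=> nu /(smooth_curveP _ hR openT) nv; apply/(smooth_curveP _ hR openT) => n.
  by apply: (@nderivable_comp _ _ _ _ setT).
apply: (smooth_curveD hE openT).
  apply/(smooth_curveP _ hE openT) => n; apply: (@nderivable_comp _ _ _ _ I c (fun t => (p t).2)) => //.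
  - by move=> t _; exact: Ip.
  - by move: n; apply/(smooth_curveP _ hR openT).
  - by move: n; apply/(smooth_curveP _ hE oI).
apply: (smooth_curveZ hE openT); last exact: (smooth_curve_cst _ hE openT).
by apply: (smooth_curveZ (E := R) hR openT); apply: comp.
Qed.

Let NC s t : I t -> N (C (s, t)).
Proof.
move=> It; rewrite /C /=; have [h2|h2] := leP (2 * d) `|t - t1|.
  by rewrite phi0// mulr0 scale0r addr0; exact: Nc.
apply: Nh; first by apply: lt_trans h2 _; rewrite ltr_pM2r// ltr_nat.
have /andP[b0 b1] := bump_itv (d^-1 * (t - t1)).
rewrite normrM (ger0_norm b0) normrM (gtr0_norm d0).
apply: (@le_lt_trans _ _ (2 * d)); last by rewrite ltr_pM2r// ltr_nat.
rewrite [2 * d]mulrC -[leRHS]mulr1; apply: ler_pM => //.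
  by apply: mulr_ge0; [exact: ltW|exact: normr_ge0].
by rewrite ler_pM2l// bump_id_norm.
Qed.

Let C0 t : I t -> C (0, t) = c t.
Proof. by move=> _; rewrite /C /= /sigma mulr0 /bump_id mul0r mulr0 mul0r scale0r addr0. Qed.

Let K := `[t1 - 2 * d, t1 + 2 * d]%classic.

Let Koff t : ~ K t -> 2 * d <= `|t - t1|.
Proof.
move=> nK; rewrite leNgt ltr_distl; apply/negP => /andP[h1 h2]; apply: nK.
by rewrite /K /= in_itv /= !ltW.
Qed.

Let KI t : t1 - 2 * d <= t <= t1 + 2 * d -> I t.
Proof.
rewrite -ler_distl => h2; apply: It1; apply: le_lt_trans h2 _.
by rewrite ltr_pM2r// ltr_nat.
Qed.

Let CK s t : I t -> ~ K t -> C (s, t) = c t.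
Proof. by move=> _ /Koff h2; rewrite /C /= phi0// mulr0 scale0r addr0. Qed.

Let var_sE t : I t -> var_s C (0, t) = phi t *: h.
Proof.
move=> It; apply: (curve_derive_unique hE (var_s_derive mE oI sC (s := 0) It)).
have ds : is_curve_derive sigma 0 (1 : R).
  apply: (@curve_derive_near _ R (fun r : R => r)); last exact: curve_derive_id.
  have : \forall r \near (0 : R), `|r| <= d by exact: nbhs0_le.
  apply: filterS => r rd; rewrite /sigma bump_id_eq.
    by rewrite mulrA divff ?mul1r// gt_eqF.
  by rewrite normrM gtr0_norm ?invr_gt0// ler_pdivrMl// mulr1.
have := curve_deriveD (curve_derive_cst (c t) 0) (curve_deriveZ
  (curve_deriveZ (E := R) ds (curve_derive_cst (phi t : R) 0)) (curve_derive_cst h 0)).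
by rewrite !scaler0 !addr0 add0r real_scaleE mul1r.
Qed.

Let w t := G (c t) (EL t) h.

Let cw t : I t -> {for t, continuous w}.
Proof.
move=> It; apply: (curve_derive_continuous (smooth_is_derive (I := I) _ It)).
exact: (metric_smooth mE hG oI Nc sc euler_lagrange_smooth (smooth_curve_cst h hE oI)).
Qed.

Lemma bump_variation : extremal N L I c ->
  (\int[mu]_(t in `[t1 - 2 * d, t1 + 2 * d]) (phi t * w t))%R = 0.
Proof.
move=> [_ _ /(_ C K sC NC C0 (segment_compact (a := _) (b := _)))].
have KI' : K `<=` I by move=> t; rewrite /K /= in_itv; exact: KI.
move=> /(_ KI' CK) [J [oJ cJ JI KJ dJ]].
have dJ' := action_derive mE oI sC hG hV hgradV NC oJ cJ JI.
have clK : closed K by exact: itv_closed.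
have JcJ : J `<=` closure J by exact: subset_closure.
(* The open set [J] supplied by extremality is only known to contain [K]; as the integrand vanishes
   on [J] off [K], the integral is moved to the segment [K], where the fundamental theorem of
   calculus applies. *)
have int0 : (\int[mu]_(t in K) lagrangian_derive C G Gam gradV (0, t))%R = 0.
  rewrite -(@Rintegral_subset _ K J) //.
    by case: dJ' => _ <-; case: dJ.
  by move=> t /JcJ/JI It; exact: (lagrangian_derive_off sC NC clK CK).
have ab : t1 - 2 * d < t1 + 2 * d by rewrite ltrD2l gtrN// mulr_gt0.
have cLd t : I t -> {for t, continuous (fun t => lagrangian_derive C G Gam gradV (0, t))}.
  move=> It; apply: (@continuous_comp _ _ _ (fun t => (0 : R, t)) (lagrangian_derive C G Gam gradV)).
    by apply: continuous_pair; [exact: cvg_cst|exact: cvg_id].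
  exact: (lagrangian_derive_continuous mE oI sC hG hgradV NC (p := (0, t))).
have cpw t : I t -> {for t, continuous (fun t => phi t * w t)}.
  by move=> It; apply: cvgM; [exact: bump_scaled_continuous|exact: cw].
have bd t : I t -> is_curve_derive (fun r => G (c r) (var_s C (0, r)) (curve_derive c r)) t
    (lagrangian_derive C G Gam gradV (0, t) + phi t * w t).
  move=> It; have := boundary_term_derive (gradV := gradV) mE oI sC hG NC sc C0 It.
  have Lc := LG (Nc It).
  by rewrite -/EL [in X in _ + X]var_sE// (L2symZl Lc) real_scaleE (L2symC Lc h).
have Ia : I (t1 - 2 * d) by apply: KI; rewrite lexx ltW.
have Ib : I (t1 + 2 * d) by apply: KI; rewrite lexx ltW.
have := curve_FTC2 ab (fun t h => bd t (KI h)).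
rewrite !var_sE// !phi0; last 2 first.
- by rewrite addrAC subrr sub0r normrN ler_norm.
- by rewrite addrAC subrr add0r ler_norm.
rewrite !scale0r (L2sym0l (LG (Nc Ia))) (L2sym0l (LG (Nc Ib))) subr0 => H.
move: H; rewrite RintegralD //.
- rewrite -/K int0 add0r; apply=> t /KI It.
  by apply: cvgD; [exact: cLd|exact: cpw].
- by apply: integrable_segment => t /KI; exact: cLd.
- by apply: integrable_segment => t /KI; exact: cpw.
Qed.

End BumpVariation.

(** The fundamental lemma of the calculus of variations, for the scalar functions $G(\mathrm{EL},h)$
    with a fixed vector $h$; weak non-degeneracy at [t1] then gives $\mathrm{EL}(t_1)=0$. *)
Lemma euler_lagrange_of_extremal : extremal N L I c -> forall t, I t -> EL t = 0.
Proof.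
move=> xc t1 It1; apply: (wpr_nondegenerate hG (Nc It1)) => h.
pose w t := G (c t) (EL t) h; rewrite -/(w t1).
have cw t : I t -> {for t, continuous w}.
  move=> It; apply: (curve_derive_continuous (smooth_is_derive (I := I) _ It)).
  exact: (metric_smooth mE hG oI Nc sc euler_lagrange_smooth (smooth_curve_cst h hE oI)).
apply/eqP/negPn/negP => w0.
have [[A B] /= [nA nB] AB] : nbhs (t1, 0 : R) [set p | N (c p.1 + p.2 *: h)].
  have cc : {for t1, continuous c} := curve_derive_continuous (smooth_is_derive sc It1).
  have : (fun p : R * R => c p.1 + p.2 *: h) @ (t1, 0 : R) --> c t1 + 0 *: h.
    apply: tvs_cvgD; first by apply: (@cvg_comp _ _ _ fst c _ (nbhs t1)); [exact: cvg_fst|].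
    by apply: tvs_cvgZ; [exact: cvg_snd|exact: cvg_cst].
  apply; rewrite scale0r addr0.
  by apply: open_nbhs_nbhs; split; [exact: wpr_open hG|exact: Nc].
have pw : nbhs t1 [set t | 0 < w t * w t1].
  have : (fun t => w t * w t1) @ t1 --> w t1 * w t1 by apply: cvgM; [exact: cw|exact: cvg_cst].
  move/(_ [set x | 0 < x]); apply; apply: open_nbhs_nbhs; split; first exact: open_gt.
  by rewrite /= -expr2 exprn_even_gt0.
have nI : nbhs t1 ((I `&` [set t | 0 < w t * w t1]) `&` A).
  by apply: filterI => //; apply: filterI => //; exact: (open_nbhs_nbhs (conj oI It1)).
have [d1 /= d10 H1] := (nbhs_ballP _ _).1 nI.
have [d2 /= d20 H2] := (nbhs_ballP _ _).1 nB.
pose d := Num.min d1 d2 / 3.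
have d3 : 3 * d = Num.min d1 d2 by rewrite mulrC divfK.
have d0 : 0 < d by rewrite divr_gt0// lt_min d10.
have near1 t : `|t - t1| < 3 * d -> [/\ I t, 0 < w t * w t1 & A t].
  rewrite d3 lt_min => /andP[h1 _]; have [] := H1 t; first by rewrite /ball/= distrC.
  by case.
have Nh t r : `|t - t1| < 3 * d -> `|r| < 3 * d -> N (c t + r *: h).
  move=> /near1[_ _ At] h2; apply: (AB (t, r)); split=> //=; apply: H2.
  by rewrite /ball/= sub0r normrN; move: h2; rewrite d3 lt_min => /andP[].
have int0 := bump_variation d0 (fun t h => let: And3 i _ _ := near1 t h in i) Nh xc.
pose phi t := bump (d^-1 * (t - t1)).
(* The constant factor [w t1] makes the product positive near [t1] whatever the sign of [w]
   there. *)
pose q t := phi t * w t * w t1.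
have ab3 t : t1 - 2 * d <= t <= t1 + 2 * d -> `|t - t1| < 3 * d.
  rewrite -ler_distl => h2; apply: le_lt_trans h2 _.
  by rewrite ltr_pM2r// ltr_nat.
have q0 t : t1 - 2 * d <= t <= t1 + 2 * d -> 0 <= q t.
  move=> /ab3/near1[_ wt _]; rewrite /q -mulrA; apply: mulr_ge0; last exact: ltW.
  by have /andP[] := bump_itv (d^-1 * (t - t1)).
have cq t : I t -> {for t, continuous q}.
  move=> It; apply: cvgM; last exact: cvg_cst.
  apply: cvgM; last exact: cw.
  exact: bump_scaled_continuous.
have intq : (\int[mu]_(t in `[t1 - 2 * d, t1 + 2 * d]) q t)%R = 0.
  rewrite -[RHS](mulr0 (w t1)) -int0 -RintegralZl//.
    by congr Rintegral; apply/funext => t; rewrite /q mulrC.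
  apply: integrable_segment => t /ab3/near1[It _ _].
  by apply: cvgM; [exact: bump_scaled_continuous|exact: cw].
suff : 0 < (\int[mu]_(t in `[t1 - 2 * d, t1 + 2 * d]) q t)%R by rewrite intq ltxx.
apply: (integral_pos oI iI _ cq q0 (x := t1 - d) (y := t1 + d)).
- by move=> t /ab3/near1[].
- by rewrite ltrD2l ltrN2 ltr_pMl// ltr1n.
- by rewrite ltrD2l gtrN.
- by rewrite ltrD2l ltr_pMl// ltr1n.
move=> t; rewrite -ler_distl => td; have [|_ wt _] := near1 t.
  by apply: le_lt_trans td _; rewrite ltr_pMl// ltr1n.
rewrite /q -mulrA /phi bump1 ?mul1r//.
by rewrite normrM gtr0_norm ?invr_gt0// ler_pdivrMl// mulr1.
Qed.

End EulerLagrange.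

(** * Reparametrization *)

Section ReparametrizedCurve.
Context {R : realType} {E : tvsType R} (hE : hausdorff_space E).
Context (I K : set R) (u tau : R -> R) (c : R -> E).
Hypotheses (oI : open I) (oK : open K) (KI : forall x, K x -> I (tau x)).
Hypotheses (su : smooth_curve I u) (sc : smooth_curve I c).
Hypothesis (dtau : forall x, K x -> is_curve_derive tau x (u (tau x))).

(** The parameter solves the autonomous equation $\tau'=u\circ\tau$ with $u$ smooth, so [n]
    derivatives of [tau] yield [n + 1]. *)
Lemma reparam_smooth : smooth_curve K (c \o tau).
Proof.
have hR : hausdorff_space R := hausdorff_real.
have nu := (smooth_curveP u hR oI).1 su; have nc := (smooth_curveP c hE oI).1 sc.
suff ntau n : nderivable n K tau by apply/smooth_curveP => // n; exact: (@nderivable_comp _ E n K I c tau).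
by elim: n => [//|n IHn]; exists (u \o tau) => //; exact: (@nderivable_comp _ R n K I u tau).
Qed.

Lemma reparam_derive x : K x ->
  curve_derive (c \o tau) x = u (tau x) *: curve_derive c (tau x).
Proof.
move=> Kx; apply: (curve_derive_val hE).
by apply: curve_derive_comp; [exact: dtau|exact/(smooth_is_derive sc)/KI].
Qed.

Lemma reparam_derive2 x : K x -> curve_derive (curve_derive (c \o tau)) x =
  (u (tau x) * curve_derive u (tau x)) *: curve_derive c (tau x) +
  (u (tau x) * u (tau x)) *: curve_derive (curve_derive c) (tau x).
Proof.
move=> Kx; apply: (curve_derive_val hE); have It := KI Kx.
apply: (@curve_derive_near _ _ (fun y => u (tau y) *: curve_derive c (tau y))).
  by apply: (open_near oK Kx) => y Ky; rewrite reparam_derive.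
rewrite -[X in _ + X]scalerA; apply: (@curve_deriveZ _ _ (u \o tau) (curve_derive c \o tau)).
  exact: (curve_derive_comp (dtau Kx) (smooth_is_derive su It)).
exact: (curve_derive_comp (dtau Kx) (smooth_is_derive (smooth_curve_derive sc) It)).
Qed.

End ReparametrizedCurve.

(** Here $u=1/f$, $g=G(\operatorname{grad}V,c')$, $x=c'$, $y=\Gamma(c',c')$ and
    $z=\operatorname{grad}V$. The left side is $\gamma''$ after the equation of motion, with
    $u'=2gu^2$; the right side is $\widetilde\Gamma(\gamma',\gamma')$, with $G(c',c')=f$. *)
Lemma jacobi_geodesic_balance (R : fieldType) (E : lmodType R) (f u g : R) (x y z : E) :
  u * f = 1 ->
  (u * (2 * g * u * u)) *: x + (u * u) *: (y - z) =
  (u * u) *: y + u *: ((u * g) *: (u *: x) + (u * g) *: (u *: x) - (u * (u * f)) *: z).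
Proof.
move=> uf; rewrite uf mulr1 !scalerBr !scalerDr !scalerA addrCA; congr (_ + (_ - _)).
by rewrite -scalerDl; congr (_ *: _); ring.
Qed.

(** The same computation in the parameter of $\gamma$: $x=\gamma'$, $y=\Gamma(\gamma',\gamma')$,
    $z=\operatorname{grad}V$, $g=G(\operatorname{grad}V,\gamma')$ and $a=G(\gamma',\gamma')$. Unit
    speed enters as $fa=1$, and $-2g$ is the derivative of $f\circ\gamma$. *)
Lemma jacobi_extremal_balance (R : fieldType) (E : lmodType R) (f u g a : R) (x y z : E) :
  u * f = 1 -> f * a = 1 ->
  (f * (- 2 * g)) *: x + (f * f) *: (y + u *: (g *: x + g *: x - a *: z)) -
  (f * f) *: y + z = 0.
Proof.
move=> uf fa; have ffu : f * f * u = f by rewrite -mulrA [f * u]mulrC uf mulr1.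
rewrite scalerDr addrCA [_ - _]addrAC subrr add0r scalerA ffu scalerBr scalerDr !scalerA fa.
by rewrite scale1r -addrA subrK -!scalerDl (_ : _ + _ = 0) ?scale0r//; ring.
Qed.

(** * The two directions of the Jacobi-Maupertuis principle *)

Section Maupertuis.
Context {R : realType} {E : tvsType R} (N : set E).
Context (G : E -> E -> E -> R) (Gam : E -> E -> E -> E) (V : E -> R) (gradV : E -> E) (e : R).
Hypotheses (mE : metrizable_lcs E) (hG : weak_pseudo_riemannian N G Gam).
Hypotheses (hV : conv_smooth N V) (hgradV : is_gradient N G V gradV).
Notation L := (lagrangian G V).
Notation f := (jacobi_factor V e).
Notation Ne := (jacobi_domain V e N).
Notation Gt := (jacobi_metric G V e).
Notation Gamt := (jacobi_connection G Gam V gradV e).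

Let hE := mE.1.
Let hR : hausdorff_space R := hausdorff_real.
Let LG g (Ng : N g) : L2sym (G g) := (wpr_metric hG).1 g Ng.
Let LGam g (Ng : N g) : L2sym (Gam g) := (wpr_connection hG).1 g Ng.

Section Curve.
Context (I : set R) (c : R -> E).
Hypotheses (oI : open I) (sc : smooth_curve I c) (Nc : forall t, I t -> Ne (c t)).

Lemma factor_curve_smooth : smooth_curve I (f \o c).
Proof. by apply: (factor_smooth mE e hV oI _ sc) => t /Nc[]. Qed.

Lemma factor_curve_neq0 t : I t -> f (c t) != 0.
Proof. by move=> /Nc[_]; exact: factor_neq0. Qed.

Lemma factor_curve_inv_smooth : smooth_curve I (fun t => (f (c t))^-1).
Proof. exact: (smooth_curveV oI factor_curve_neq0 factor_curve_smooth). Qed.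

Lemma factor_curve_continuous t : I t -> {for t, continuous (fun t => f (c t))}.
Proof. by move=> It; exact: (curve_derive_continuous (smooth_is_derive factor_curve_smooth It)). Qed.

Lemma factor_curve_inv_continuous t : I t -> {for t, continuous (fun t => (f (c t))^-1)}.
Proof. by move=> It; exact: (curve_derive_continuous (smooth_is_derive factor_curve_inv_smooth It)). Qed.

Lemma factor_curve_derive t : I t -> is_curve_derive (f \o c) t
  (- 2 * G (c t) (gradV (c t)) (curve_derive c t)).
Proof.
move=> It; have [Nt _] := Nc It.
exact: (factor_derive mE hG e hV hgradV Nt (smooth_is_derive sc It)).
Qed.

End Curve.

Section ExtremalToGeodesic.
Context (I K : set R) (c : R -> E) (tau : R -> R).
Hypotheses (oI : open I) (iI : is_interval I) (oK : open K).
Hypotheses (KI : forall x, K x -> I (tau x)).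
Hypotheses (xc : extremal N L I c) (Nc : forall t, I t -> Ne (c t)).
Hypothesis (ec : forall t, I t -> energy G V (c t) (curve_derive c t) = e).
Hypothesis (dtau : forall x, K x -> is_derive x (1 : R) tau (f (c (tau x)))^-1).

Let sc : smooth_curve I c. Proof. by case: xc. Qed.
Let su := factor_curve_inv_smooth oI sc Nc.
Let dtau' x : K x -> is_curve_derive tau x (f (c (tau x)))^-1.
Proof. by move=> /dtau/is_curve_deriveE. Qed.

(** The energy condition in the form in which it is used: it evaluates the term
    $G(c',c')\operatorname{grad}V$ of the Jacobi connection and gives unit speed. *)
Let speed t : I t -> G (c t) (curve_derive c t) (curve_derive c t) = f (c t).
Proof. by move=> /ec; rewrite /energy /jacobi_factor; lra. Qed.

Let dgam x : K x -> curve_derive (c \o tau) x = (f (c (tau x)))^-1 *: curve_derive c (tau x).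
Proof. exact: (reparam_derive hE (u := fun t => (f (c t))^-1) KI sc dtau'). Qed.

Lemma extremal_geodesic : geodesic Ne Gamt K (c \o tau).
Proof.
split=> [|x /KI /Nc //|x Kx]; first exact: (reparam_smooth hE oI oK KI su sc dtau').
have It := KI Kx; have [Nt _] := Nc It.
rewrite (reparam_derive2 hE (u := fun t => (f (c t))^-1) oK KI su sc dtau')// dgam//.
have EL0 := euler_lagrange_of_extremal mE hG hV hgradV oI iI sc (fun t h => (Nc h).1) xc It.
have -> : curve_derive (curve_derive c) (tau x) =
    Gam (c (tau x)) (curve_derive c (tau x)) (curve_derive c (tau x)) - gradV (c (tau x)).
  by apply/eqP; rewrite -subr_eq0 opprB addrA addrAC; apply/eqP; exact: EL0.
have -> := curve_derive_val hR (curve_derive_inv (a := f \o c) (factor_curve_neq0 Nc It)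
  (factor_curve_derive sc Nc It)).
rewrite (jacobi_connectionE mE hG e hV hgradV _ _ Nt).
rewrite (L2symZl (LGam Nt)) (L2symZr (LGam Nt)) scalerA.
rewrite (L2symZr (LG Nt)) (L2symZl (LG Nt)) (L2symZr (LG Nt)) speed// !real_scaleE.
rewrite mulNr opprK; apply: jacobi_geodesic_balance.
by rewrite mulVf// (factor_curve_neq0 Nc).
Qed.

Lemma extremal_unit_speed x : K x -> Gt ((c \o tau) x)
  (curve_derive (c \o tau) x) (curve_derive (c \o tau) x) = 1.
Proof.
move=> Kx; have It := KI Kx; have [Nt _] := Nc It.
rewrite dgam// /jacobi_metric (L2symZl (LG Nt)) (L2symZr (LG Nt)).
by rewrite speed// !real_scaleE mulVf ?mulr1 ?divff// (factor_curve_neq0 Nc).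
Qed.

End ExtremalToGeodesic.

Section GeodesicToExtremal.
Context (J K : set R) (gamma : R -> E) (s : R -> R).
Hypotheses (oJ : open J) (oK : open K) (iK : is_interval K).
Hypotheses (KJ : forall t, K t -> J (s t)).
Hypotheses (hgam : geodesic Ne Gamt J gamma).
Hypothesis (speed1 : forall x, J x ->
  Gt (gamma x) (curve_derive gamma x) (curve_derive gamma x) = 1).
Hypothesis (ds : forall t, K t -> is_derive t (1 : R) s (f (gamma (s t)))).

Let sg : smooth_curve J gamma. Proof. by case: hgam. Qed.
Let Ng x : J x -> Ne (gamma x). Proof. by case: hgam => _ + _; exact. Qed.
Let su := factor_curve_smooth oJ sg Ng.
Let ds' t : K t -> is_curve_derive s t (f (gamma (s t))).
Proof. by move=> /ds/is_curve_deriveE. Qed.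

Let dc t : K t -> curve_derive (gamma \o s) t = f (gamma (s t)) *: curve_derive gamma (s t).
Proof. exact: (reparam_derive hE (u := f \o gamma) KJ sg ds'). Qed.

Lemma geodesic_extremal : extremal N L K (gamma \o s).
Proof.
apply: (extremal_of_euler_lagrange mE hG hV hgradV oK iK).
- exact: (reparam_smooth hE oJ oK KJ su sg ds').
- by move=> t /KJ/Ng[].
move=> t Kt; have Jx := KJ Kt; have [Nt _] := Ng Jx.
rewrite /euler_lagrange (reparam_derive2 hE (u := f \o gamma) oK KJ su sg ds')// dc//.
rewrite (curve_derive_val hR (factor_curve_derive sg Ng Jx)).
have [_ _ ->//] := hgam.
rewrite (jacobi_connectionE mE hG e hV hgradV _ _ Nt).
rewrite (L2symZl (LGam Nt)) (L2symZr (LGam Nt)) scalerA.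
apply: jacobi_extremal_balance; first by rewrite mulVf// (factor_curve_neq0 Ng).
exact: speed1.
Qed.

Lemma geodesic_energy t : K t ->
  energy G V ((gamma \o s) t) (curve_derive (gamma \o s) t) = e.
Proof.
move=> Kt; have Jx := KJ Kt; have [Nt _] := Ng Jx.
rewrite dc// /energy (L2symZl (LG Nt)) (L2symZr (LG Nt)) !real_scaleE.
have := speed1 Jx; rewrite /jacobi_metric => ->; rewrite mulr1 /jacobi_factor /=.
by rewrite mulrA mulVf// mul1r subrK.
Qed.

End GeodesicToExtremal.

End Maupertuis.

Theorem theorem6p2 (R : realType) (E : tvsType R) (N : set E)
    (G : E -> E -> E -> R) (Gam : E -> E -> E -> E)
    (V : E -> R) (gradV : E -> E) (e : R)
    (hE : frechet_space E)
    (hG : weak_pseudo_riemannian N G Gam)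
    (hV : conv_smooth N V)
    (hgradV : is_gradient N G V gradV) :
  let L := lagrangian G V in
  let f := jacobi_factor V e in
  let Ne := jacobi_domain V e N in
  let Gt := jacobi_metric G V e in
  let Gamt := jacobi_connection G Gam V gradV e in
  [/\ weak_pseudo_riemannian Ne Gt Gamt,
      forall (I : set R) (c : R -> E) (t0 : R),
        open I -> is_interval I -> I t0 ->
        extremal N L I c ->
        (forall t, I t -> Ne (c t)) ->
        (forall t, I t -> energy G V (c t) (curve_derive c t) = e) ->
        let s := fun t : R => oriented_integral t0 t (fun r => f (c r)) in
        [/\ forall t, I t -> is_derive t (1 : R) s (f (c t)),
            set_inj I s,
            open (s @` I),
            is_interval (s @` I)
          & forall tau : R -> R, (forall t, I t -> tau (s t) = t) ->
              let gamma := c \o tau in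
              geodesic Ne Gamt (s @` I) gamma /\
              forall x, (s @` I) x ->
                Gt (gamma x) (curve_derive gamma x) (curve_derive gamma x) = 1]
    & forall (J : set R) (gamma : R -> E),
        open J -> is_interval J ->
        geodesic Ne Gamt J gamma ->
        (forall x, J x ->
          Gt (gamma x) (curve_derive gamma x) (curve_derive gamma x) = 1) ->
        (exists tau : R -> R,
          forall x, J x -> is_derive x (1 : R) tau (f (gamma x))^-1) /\
        forall tau : R -> R,
          (forall x, J x -> is_derive x (1 : R) tau (f (gamma x))^-1) ->
          [/\ set_inj J tau,
              open (tau @` J),
              is_interval (tau @` J)
            & forall s : R -> R, (forall x, J x -> s (tau x) = x) ->
                let c := gamma \o s in
                extremal N L (tau @` J) c /\
                forall t, (tau @` J) t ->
                  energy G V (c t) (curve_derive c t) = e]].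
Proof.
have mE := frechet_metrizable hE; move=> L f Ne Gt Gamt; split.
- exact: (jacobi_weak_pseudo_riemannian mE hG e hV hgradV).
- move=> I c t0 oI iI It0 xc Nc ec s; have sc : smooth_curve I c by case: xc.
  have cf := factor_curve_continuous mE hV oI sc Nc.
  have ds t : I t -> is_derive t (1 : R) s (f (c t)).
    by move=> It; exact: (oriented_integral_derive oI iI It0 It cf).
  have f0 t : I t -> f (c t) != 0 := factor_curve_neq0 Nc (t := t).
  have oK : open (s @` I) by apply: (reparam_open oI iI ds).
  split=> //.
  + exact: (reparam_inj iI ds f0).
  + exact: (reparam_interval iI ds).
  move=> tau stau gamma.
  have KI x : (s @` I) x -> I (tau x) by move=> [t It <-]; rewrite stau.
  have dtau x : (s @` I) x -> is_derive x (1 : R) tau (f (c (tau x)))^-1.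
    by move=> [t It <-]; rewrite stau//; exact: (reparam_inverse oI ds f0 stau It).
  split; first exact: (extremal_geodesic mE hG hV hgradV oI iI oK KI xc Nc ec dtau).
  move=> x Kx; exact: (extremal_unit_speed mE hG KI xc Nc ec dtau Kx).
- move=> J gamma oJ iJ hgam speed1; have [sg Ng _] := hgam.
  have cf := factor_curve_inv_continuous mE hV oJ sg Ng.
  have f0 x : J x -> (f (gamma x))^-1 != 0.
    by move=> Jx; rewrite invr_eq0 (factor_curve_neq0 Ng).
  split.
    have [[x0 Jx0]|J0] := pselect (J !=set0); last first.
      (* An empty [J] offers no base point for the integral, and any function then satisfies the
         condition. *)
      by exists id => x Jx; exfalso; apply: J0; exists x.
    exists (fun x => oriented_integral x0 x (fun r => (f (gamma r))^-1)) => x Jx.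
    exact: (oriented_integral_derive oJ iJ Jx0 Jx cf).
  move=> tau dtau.
  have oK : open (tau @` J) by apply: (reparam_open oJ iJ dtau).
  have iK : is_interval (tau @` J) by exact: (reparam_interval iJ dtau).
  split=> //; first exact: (reparam_inj iJ dtau f0).
  move=> s stau c.
  have KJ t : (tau @` J) t -> J (s t) by move=> [x Jx <-]; rewrite stau.
  have ds t : (tau @` J) t -> is_derive t (1 : R) s (f (gamma (s t))).
    move=> [x Jx <-]; rewrite stau// -[f _]invrK.
    exact: (reparam_inverse oJ dtau f0 stau Jx).
  split; first exact: (geodesic_extremal mE hG hV hgradV oJ oK iK KJ hgam speed1 ds).
  by move=> t Kt; exact: (geodesic_energy mE hG KJ hgam speed1 ds Kt).
Qed.
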